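(* Let $X$ be a $\operatorname{CAT}(0)$ space. Then there exists a constant $C>0$ such that every Lipschitz $2$-sphere $f\colon S^2\to X$ extends to a Lipschitz ball $\bar f\colon B^3\to X$ (with $\bar f|_{S^2}=f$) satisfying $\operatorname{vol}(\bar f)\le C\cdot\operatorname{area}(f)^{3/2}$.
   Context: A $\operatorname{CAT}(0)$ space is a complete geodesic space whose geodesic triangles are no fatter than Euclidean comparison triangles. For a Lipschitz map $f$ from a $k$-dimensional domain into $X$, $\operatorname{vol}_k(f)=\int_X\#f^{-1}(y)\,d\mathcal H^k(y)$ (equivalently the integral of the Jacobian of the metric differential); for $k=2$ this is the area. *)

(* Defs.v *)
From HB Require Import structures.
From mathcomp Require Import all_boot all_order all_algebra.
From mathcomp Require Import all_classical all_reals.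
From mathcomp Require Import ereal topology normedtype sequences esum measure
  lebesgue_integral trigo exp.

Set Implicit Arguments.
Unset Strict Implicit.
Unset Printing Implicit Defensive.
Import Order.TTheory GRing.Theory Num.Theory.
Local Open Scope classical_set_scope.
Local Open Scope ring_scope.

Section metric.
Context {R : realType} {T : Type} (d : T -> T -> R).

Definition is_metric : Prop :=
  [/\ forall x y, 0 <= d x y,
      forall x y, d x y = 0 <-> x = y,
      forall x y, d x y = d y x &
      forall x y z, d x z <= d x y + d y z].

Definition metric_complete : Prop :=
  forall u : nat -> T,
    (forall e : R, 0 < e -> exists N : nat, forall m n : nat,
        (N <= m)%N -> (N <= n)%N -> d (u m) (u n) < e) ->
    exists x : T, forall e : R, 0 < e -> exists N : nat, forall n : nat,
        (N <= n)%N -> d (u n) x < e.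

Definition geodesic_segment (g : R -> T) (a b : T) : Prop :=
  [/\ g 0 = a, g (d a b) = b &
      forall s t, 0 <= s <= d a b -> 0 <= t <= d a b ->
        d (g s) (g t) = `|s - t|].

Definition geodesic_space : Prop :=
  forall a b : T, exists g : R -> T, geodesic_segment g a b.

Definition edist2 (P Q : R * R) : R :=
  Num.sqrt ((P.1 - Q.1) ^+ 2 + (P.2 - Q.2) ^+ 2).

(* The point of the Euclidean segment [P, Q] at distance s from P,
   where l = |P - Q| (for l = 0 this is P, since s / 0 = 0). *)
Definition eseg (P Q : R * R) (l s : R) : R * R :=
  (P.1 + s / l * (Q.1 - P.1), P.2 + s / l * (Q.2 - P.2)).

Definition cat0_comparison : Prop :=
  forall (a : 'I_3 -> T) (g : 'I_3 -> R -> T) (P : 'I_3 -> R * R),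
    (forall i, geodesic_segment (g i) (a i) (a (ordS i))) ->
    (forall i, edist2 (P i) (P (ordS i)) = d (a i) (a (ordS i))) ->
    forall (i j : 'I_3) (s t : R),
      0 <= s <= d (a i) (a (ordS i)) -> 0 <= t <= d (a j) (a (ordS j)) ->
      d (g i s) (g j t) <=
      edist2 (eseg (P i) (P (ordS i)) (d (a i) (a (ordS i))) s)
             (eseg (P j) (P (ordS j)) (d (a j) (a (ordS j))) t).

Definition CAT0 : Prop :=
  [/\ is_metric, metric_complete, geodesic_space & cat0_comparison].

End metric.

(* Volume of the unit ball in R^k: w_0 = 1, w_1 = 2,
   w_(k+2) = 2 pi / (k+2) * w_k. *)
Fixpoint omega_ {R : realType} (k : nat) : R :=
  match k with
  | 0 => 1
  | 1 => 2
  | k'.+2 => 2 * pi / k'.+2%:R * omega_ k'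
  end.

Lemma omega_ge0 {R : realType} k : 0 <= @omega_ R k.
Proof.
elim/ltn_ind: k => -[|[|k]] IH //=.
apply: mulr_ge0; last exact: IH.
apply: divr_ge0 => //; apply: mulr_ge0 => //.
exact: ltW (pi_gt0 R).
Qed.

Section hausdorff.
Context {R : realType} {T : pointedType} (d : T -> T -> R).

(* diameter (0 for the empty set; only used for bounded sets) *)
Definition diam (A : set T) : R :=
  sup ([set 0] `|` [set d x y | x in A & y in A]).

Lemma diam_ge0 A : 0 <= diam A.
Proof.
rewrite /diam; have [hs|hs] := pselect (has_sup ([set 0] `|` [set d x y | x in A & y in A])).
  by apply: sup_ubound; [case: hs|left].
by rewrite sup_out.
Qed.

Definition small (delta : R) : set (set T) :=
  [set A | forall x y, A x -> A y -> d x y <= delta].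

Definition smallT (delta : R) : Type := T.
HB.instance Definition _ delta := Pointed.on (smallT delta).

Lemma small0 delta : small delta set0. Proof. by []. Qed.

Lemma smallI delta : setI_closed (small delta).
Proof. by move=> A B hA _ x y [Ax _] [Ay _]; exact: hA. Qed.

Lemma smallD delta : semi_setD_closed (small delta).
Proof.
move=> A B hA _; exists [set A `\` B]; split.
- exact: finite_set1.
- by move=> _ -> x y [Ax _] [Ay _]; exact: hA.
- by rewrite bigcup_set1.
- exact: trivIset1.
Qed.

HB.instance Definition _ delta :=
  @isSemiRingOfSets.Build default_measure_display (smallT delta)
    (small delta) (small0 delta) (@smallI delta) (@smallD delta).

Definition hcost (k : nat) (A : set T) : \bar R :=
  if `[< A = set0 >] then 0%E else (omega_ k * (diam A / 2) ^+ k)%:E.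

Lemma hcost_ge0 k A : (0 <= hcost k A)%E.
Proof.
rewrite /hcost; case: ifPn => // _.
rewrite lee_fin; apply: mulr_ge0; first exact: omega_ge0.
by apply: exprn_ge0; apply: divr_ge0 => //; exact: diam_ge0.
Qed.

(* H^k_delta: infimum over countable covers by sets of diameter
   at most delta of sum_i omega_k (diam C_i / 2)^k *)
Definition hausdorff_delta (k : nat) (delta : R) (A : set T) : \bar R :=
  mu_ext (hcost k : set (smallT delta) -> \bar R) A.

Definition hausdorff (k : nat) (A : set T) : \bar R :=
  ereal_sup [set hausdorff_delta k delta A | delta in [set delta : R | 0 < delta]].

Lemma hausdorff_delta_ge0 k delta A : (0 <= hausdorff_delta k delta A)%E.
Proof. by apply: mu_ext_ge0 => B; exact: hcost_ge0. Qed.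

Lemma hcost0 k : hcost k set0 = 0%E.
Proof. by rewrite /hcost asboolT. Qed.

Lemma hausdorff_delta0 k delta : hausdorff_delta k delta set0 = 0%E.
Proof. by apply: mu_ext0; [exact: hcost0|move=> B; exact: hcost_ge0]. Qed.

Lemma hausdorff_delta_le k delta : {homo hausdorff_delta k delta : A B / A `<=` B >-> (A <= B)%E}.
Proof. by move=> A B AB; apply: le_mu_ext. Qed.

Lemma hausdorff_delta_sub k delta : sigma_subadditive (hausdorff_delta k delta).
Proof.
move=> F; rewrite /hausdorff_delta.
exact: (@mu_ext_sigma_subadditive _ (smallT delta) R (hcost k) (hcost_ge0 k) F).
Qed.

Local Open Scope ereal_scope.

Lemma hausdorff_delta_le_hausdorff k delta A : (0 < delta)%R ->
  hausdorff_delta k delta A <= hausdorff k A.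
Proof. by move=> d0; apply: ereal_sup_ubound; exists delta. Qed.

Lemma hausdorff0 k : hausdorff k set0 = 0.
Proof.
apply/eqP; rewrite eq_le; apply/andP; split.
  by apply: ge_ereal_sup => _ [delta _ <-]; rewrite hausdorff_delta0.
by rewrite -(hausdorff_delta0 k 1); exact: hausdorff_delta_le_hausdorff.
Qed.

Lemma hausdorff_ge0 k A : 0 <= hausdorff k A.
Proof.
apply: le_trans (hausdorff_delta_le_hausdorff k A (ltr01 : (0 < 1 :> R)%R)).
exact: hausdorff_delta_ge0.
Qed.

Lemma le_hausdorff k : {homo hausdorff k : A B / A `<=` B >-> A <= B}.
Proof.
move=> A B AB; apply: ge_ereal_sup => _ [delta d0 <-].
apply: le_trans (hausdorff_delta_le_hausdorff k B d0).
exact: hausdorff_delta_le.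
Qed.

Lemma hausdorff_sigma_subadditive k : sigma_subadditive (hausdorff k).
Proof.
move=> F; apply: ge_ereal_sup => _ [delta d0 <-].
apply: le_trans (hausdorff_delta_sub k delta F) _.
apply: lee_nneseries => [i _ _|i _]; first exact: hausdorff_delta_ge0.
exact: hausdorff_delta_le_hausdorff.
Qed.

HB.instance Definition _ k := isOuterMeasure.Build R T (hausdorff k)
  (hausdorff0 k) (hausdorff_ge0 k) (@le_hausdorff k)
  (hausdorff_sigma_subadditive k).

Definition Hmeasure (k : nat) : set (caratheodory_type (hausdorff k)) -> \bar R :=
  hausdorff k.

Lemma Hmeasure0 k : @Hmeasure k set0 = 0.
Proof. exact: hausdorff0. Qed.

Lemma Hmeasure_ge0 k A : 0 <= @Hmeasure k A.
Proof. exact: hausdorff_ge0. Qed.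

Lemma Hmeasure_semi_sigma_additive k : semi_sigma_additive (@Hmeasure k).
Proof. exact: caratheodory_measure_sigma_additive. Qed.

HB.instance Definition _ k := isMeasure.Build _ _ _ (@Hmeasure k)
  (@Hmeasure0 k) (@Hmeasure_ge0 k) (@Hmeasure_semi_sigma_additive k).

Local Close Scope ereal_scope.
End hausdorff.

Section volume.
Context {R : realType}.

Definition edist {n : nat} (x y : 'rV[R]_n) : R :=
  Num.sqrt (\sum_(i < n) (x ord0 i - y ord0 i) ^+ 2).

Definition sphere2 : set 'rV[R]_3 := [set x | \sum_(i < 3) x ord0 i ^+ 2 = 1].
Definition ball3 : set 'rV[R]_3 := [set x | \sum_(i < 3) x ord0 i ^+ 2 <= 1].

Context {T : pointedType} (d : T -> T -> R).

Definition lipschitz_map_on {n : nat} (A : set 'rV[R]_n) (f : 'rV[R]_n -> T) : Prop :=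
  exists L : R, forall x y, A x -> A y -> d (f x) (f y) <= L * edist x y.

Definition multiplicity {n : nat} (A : set 'rV[R]_n) (f : 'rV[R]_n -> T) (y : T)
  : \bar R := (\esum_(x in [set x | A x /\ f x = y]) 1)%E.

Definition vol (k : nat) {n : nat} (A : set 'rV[R]_n) (f : 'rV[R]_n -> T) : \bar R :=
  (\int[@Hmeasure R T d k]_(y in [set: caratheodory_type (hausdorff d k)])
     multiplicity A f y)%E.

End volume.

(* Main.v *)
(** Only a conical geodesic bicombing of X is used. The area of a map is replaced by a
    covering measure on its domain, which sees multiplicities. Pushing a map along
    geodesics towards locally constant targets changes this measure in a controlled way
    and sweeps out a volume of at most a constant times displacement times area.

    Fix s comparable to the square root of the area A. Around a point o the area of the
    part of the map in the ball of radius r cannot keep growing quadratically up to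
    r = s / 2; hence some sphere around o has a thin collar of small area whose
    components have small diameter. Squeeze each component to a point, then contract
    the ball to o, dragging arcs along. This kills the area inside the ball, creates at most
    a quarter of it anew in the collar, and sweeps out a volume of at most a constant times
    s times the area killed. No topology of the sphere is needed since the arcs have no area.
    Surgeries at the points of an s / 4 - net halve the area. Iterating with the same s, the
    swept volumes form a geometric series of sum at most a constant times s A, while the
    diameter grows linearly in the number of rounds; so finally a geodesic cone closes the
    sphere at negligible cost. *)

Require Import Defs.
From HB Require Import structures.
From mathcomp Require Import all_boot all_order all_algebra.
From mathcomp Require Import all_classical all_reals.
From mathcomp Require Import ereal topology normedtype sequences esum measure
  lebesgue_integral trigo exp realfun function_spaces
  measurable_realfun numfun.
From mathcomp Require Import ring lra zify.
Set Implicit Arguments.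
Unset Strict Implicit.
Unset Printing Implicit Defensive.
Import Order.TTheory GRing.Theory Num.Theory.
Import numFieldNormedType.Exports.
Local Open Scope classical_set_scope.
Local Open Scope ring_scope.
Local Notation edist := Defs.edist.

Section bicombing.
Context {R : realType} {T : Type} (d : T -> T -> R).

(** * Conical geodesic bicombings *)

(** The obstacle is the area created by squeezing a collar of width [eta]. The squeezing parameter
    varies at rate [3 / eta], so components of diameter [Lc] in a collar of area [w] leave about
    [Lc * w / eta] of new area. A coarea count makes both [Lc] and the density [w / eta] at most a
    constant times [b / l], where [b] is the area in the ball of radius [rho + l]. With [l] a large
    multiple of [sqrt b] the product is a small fraction of [b]. It is charged to the area inside
    the collar, which must therefore be comparable with [b]; this is what excluding quadratic growth
    provides. The margin [tau] keeps [b] positive at centres near which there is no area, and its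
    total over one round is at most the area bound.

    Hausdorff measure of images loses multiplicities, and the multiplicity integral is hard to
    follow through a deformation. Coverings of the domain are estimated one small set at a time,
    from distances alone. Two one-sided comparisons suffice, based on [4 <= 2 * omega_ 2] and
    [omega_ 3 <= 8]; they affect only the final constant. *)

Definition conical (G : T -> T -> R -> T) : Prop :=
  [/\ forall x q, G x q 0 = x,
      forall x q, G x q 1 = q,
      forall x q t t', 0 <= t <= 1 -> 0 <= t' <= 1 ->
        d (G x q t) (G x q t') = `|t - t'| * d x q &
      forall x y q t, 0 <= t <= 1 ->
        d (G x q t) (G y q t) <= (1 - t) * d x y].

(** The law of cosines gives the abscissa of the third vertex; Heron's factorisation turns the
    triangle inequalities into the sign of its squared height. *)
Lemma comparison_triangle (a b c : R) :
  0 <= a -> 0 <= b -> 0 <= c -> a <= b + c -> b <= a + c -> c <= a + b ->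
  exists P Q S : R * R,
    [/\ edist2 P Q = a, edist2 Q S = b & edist2 S P = c].
Proof.
move=> a0 b0 c0 abc bac cab.
have [az|anz] := eqVneq a 0.
  have bc : b = c by lra.
  exists (0, 0), (0, 0), (b, 0); rewrite /edist2 /=; split.
  - by rewrite !subrr expr0n addr0 sqrtr0 az.
  - by rewrite subrr sub0r sqrrN expr0n addr0 sqrtr_sqr ger0_norm.
  - by rewrite subrr subr0 expr0n addr0 sqrtr_sqr ger0_norm // -bc.
have ap : 0 < a by lra.
pose x := (a ^+ 2 + c ^+ 2 - b ^+ 2) / (2 * a).
have xE : 2 * a * x = a ^+ 2 + c ^+ 2 - b ^+ 2.
  by rewrite /x mulrC divfK// mulf_neq0.
have x2 : x ^+ 2 <= c ^+ 2.
  suff : (2 * a * x) ^+ 2 <= (2 * a * c) ^+ 2.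
    rewrite !exprMn ler_pM2l //; first by rewrite mulr_gt0 // exprn_gt0.
  rewrite xE -subr_ge0.
  have -> : (2 * a * c) ^+ 2 - (a ^+ 2 + c ^+ 2 - b ^+ 2) ^+ 2 =
    ((b + c - a) * (a + c + b)) * ((a + b - c) * (a + c - b)) by ring.
  by apply: mulr_ge0; apply: mulr_ge0; lra.
pose y := Num.sqrt (c ^+ 2 - x ^+ 2).
have yE : y ^+ 2 = c ^+ 2 - x ^+ 2 by rewrite sqr_sqrtr // subr_ge0.
exists (0, 0), (a, 0), (x, y); rewrite /edist2 /=; split.
- by rewrite subrr sub0r sqrrN expr0n addr0 sqrtr_sqr ger0_norm.
- rewrite sub0r sqrrN yE.
  have -> : (a - x) ^+ 2 + (c ^+ 2 - x ^+ 2) = b ^+ 2.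
    have -> : (a - x) ^+ 2 + (c ^+ 2 - x ^+ 2) = a ^+ 2 + c ^+ 2 - 2 * a * x by ring.
    by rewrite xE; ring.
  by rewrite sqrtr_sqr ger0_norm.
- rewrite !subr0 yE.
  have -> : x ^+ 2 + (c ^+ 2 - x ^+ 2) = c ^+ 2 by ring.
  by rewrite sqrtr_sqr ger0_norm.
Qed.

Lemma edist2_scale (k : R) (P Q : R * R) : 0 <= k ->
  edist2 (k * P.1, k * P.2) (k * Q.1, k * Q.2) = k * edist2 P Q.
Proof.
move=> k0; rewrite /edist2 /=.
have -> : (k * P.1 - k * Q.1) ^+ 2 + (k * P.2 - k * Q.2) ^+ 2 =
  k ^+ 2 * ((P.1 - Q.1) ^+ 2 + (P.2 - Q.2) ^+ 2) by ring.
by rewrite sqrtrM ?sqr_ge0 // sqrtr_sqr ger0_norm.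
Qed.

(** Comparison points at fraction [t] on the two sides ending at [q] cut off a triangle similar to
    the comparison triangle, with ratio [1 - t]. *)
Lemma CAT0_conical : CAT0 d -> exists G, conical G.
Proof.
move=> [[d0 d00 dC dtri] _ geod cat0].
have /choice[g gP] : forall ab : T * T, exists g, geodesic_segment d g ab.1 ab.2.
  by move=> ab; exact: geod.
exists (fun x q t => g (x, q) (t * d x q)); split.
- by move=> x q; rewrite mul0r; case: (gP (x, q)).
- by move=> x q; rewrite mul1r; case: (gP (x, q)).
- move=> x q t t' /andP[t0 t1] /andP[t0' t1'].
  case: (gP (x, q)) => /= _ _ ->; first by rewrite -mulrBl normrM (ger0_norm (d0 _ _)).
  + by rewrite mulr_ge0 // ler_piMl.
  + by rewrite mulr_ge0 // ler_piMl.
move=> x y q t /andP[t0 t1].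
have tri1 : d x q <= d q y + d y x.
  by have := dtri x y q; rewrite (dC x y) (dC y q) addrC.
have tri2 : d q y <= d x q + d y x.
  by have := dtri q x y; rewrite (dC q x) (dC x y).
have tri3 : d y x <= d x q + d q y.
  by have := dtri x q y; rewrite (dC x y).
have [P [Q [S [PQ QS SP]]]] :=
  comparison_triangle (d0 x q) (d0 q y) (d0 y x) tri1 tri2 tri3.
(* The triangle is traversed cyclically through [x], [q], [y], so the chosen geodesic from [y] to
   [q] is run backwards on the second side. *)
pose a (i : 'I_3) := match val i with 0%N => x | 1%N => q | _ => y end.
pose h (i : 'I_3) := match val i with
  0%N => g (x, q) | 1%N => (fun s => g (y, q) (d y q - s)) | _ => g (y, x) end.
pose E (i : 'I_3) := match val i with 0%N => P | 1%N => Q | _ => S end.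
have hgeo i : geodesic_segment d (h i) (a i) (a (ordS i)).
  case: i => -[|[|[|//]]] ilt; [exact: gP (x, q)| |exact: gP (y, x)].
  rewrite /h /a /=; case: (gP (y, q)) => /= g0 g1 gd.
  rewrite /geodesic_segment (dC q y); split; rewrite ?subr0 ?subrr //.
  move=> s t' /andP[s0 s1] /andP[t'0 t'1]; rewrite gd; try by apply/andP; split; lra.
  by rewrite distrC; congr (`|_|); ring.
have Eedge i : edist2 (E i) (E (ordS i)) = d (a i) (a (ordS i)).
  by case: i => -[|[|[|//]]] ilt.
have s01 : 0 <= t * d x q <= d x q by rewrite mulr_ge0 //= ler_piMl.
have s01' : 0 <= (1 - t) * d q y <= d q y.
  by rewrite mulr_ge0 ?subr_ge0 //= ler_piMl // gerBl.
have := cat0 a h E hgeo Eedge (@Ordinal 3 0 isT) (@Ordinal 3 1 isT) _ _ s01 s01'.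
rewrite /h /a /E /=.
have -> : d y q - (1 - t) * d q y = t * d y q by rewrite (dC q y); ring.
move=> /le_trans; apply.
rewrite /eseg /=.
have D0 (A B : R * R) : edist2 A B = 0 -> B.1 - A.1 = 0 /\ B.2 - A.2 = 0.
  rewrite /edist2 => /eqP; rewrite sqrtr_eq0 => AB.
  have /andP[/eqP A1 /eqP B1] : ((A.1 - B.1) ^+ 2 == 0) && ((A.2 - B.2) ^+ 2 == 0).
    by rewrite -paddr_eq0 ?sqr_ge0 // eq_le AB addr_ge0 ?sqr_ge0.
  by move/eqP: A1; move/eqP: B1; rewrite !sqrf_eq0 => /eqP ? /eqP ?; split; lra.
(* A side of length 0 makes [eseg] divide by 0; its end points then coincide, so the affine formula
   still holds. *)
have seg (l k : R) (A B : R * R) : edist2 A B = l ->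
    (A.1 + k * l / l * (B.1 - A.1), A.2 + k * l / l * (B.2 - A.2)) =
    (A.1 + k * (B.1 - A.1), A.2 + k * (B.2 - A.2)).
  move=> AB; have [l0|l0] := eqVneq l 0; last by rewrite mulfK.
  by move: AB; rewrite l0 => /D0[-> ->]; rewrite !mulr0.
rewrite !seg //.
have -> : edist2 (P.1 + t * (Q.1 - P.1), P.2 + t * (Q.2 - P.2))
    (Q.1 + (1 - t) * (S.1 - Q.1), Q.2 + (1 - t) * (S.2 - Q.2)) =
  edist2 ((1 - t) * P.1, (1 - t) * P.2) ((1 - t) * S.1, (1 - t) * S.2).
  by rewrite /edist2 /=; congr (Num.sqrt (_ ^+ 2 + _ ^+ 2)); ring.
rewrite edist2_scale ?subr_ge0 // (dC x y) -SP.
suff -> : edist2 P S = edist2 S P by [].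
by rewrite /edist2 -sqrrN opprB -[in X in _ + X]sqrrN opprB.
Qed.

End bicombing.

(** * Covering measures of maps *)

(** Both terms grow as the mesh shrinks, so two meshes can be replaced by a common finer one. This
    yields additivity on separated sets, for [nu] and for Hausdorff measure alike. *)
Lemma ereal_sup_mesh_add {R : realType} (phi psi chi : R -> \bar R) (h0 : R) :
  (forall h, 0 <= phi h)%E -> (forall h, 0 <= psi h)%E ->
  (forall h h', h <= h' -> (phi h' <= phi h)%E) ->
  (forall h h', h <= h' -> (psi h' <= psi h)%E) ->
  0 < h0 -> (forall h, 0 < h -> h <= h0 -> (phi h + psi h <= chi h)%E) ->
  (ereal_sup [set phi h | h in [set h : R | (0 < h)%R]] +
   ereal_sup [set psi h | h in [set h : R | (0 < h)%R]] <=
   ereal_sup [set chi h | h in [set h : R | (0 < h)%R]])%E.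
Proof.
move=> phi0 psi0 dphi dpsi h00 H.
set S := ereal_sup [set chi h | h in _].
have key h1 h2 : 0 < h1 -> 0 < h2 -> (phi h1 + psi h2 <= S)%E.
  move=> h10 h20; pose h := Num.min h0 (Num.min h1 h2).
  have hp : 0 < h by rewrite !lt_min h00 h10 h20.
  apply: (@le_trans _ _ (phi h + psi h)%E).
    by apply: leeD; [apply: dphi|apply: dpsi]; rewrite !ge_min lexx ?orbT.
  apply: le_trans (H _ hp _) _; first by rewrite ge_min lexx.
  by apply: ereal_sup_ubound; exists h.
have [->|Soo] := eqVneq S +oo%E; first by rewrite leey.
have lt_oo (x y : \bar R) : (0 <= y -> x + y <= S -> x < +oo)%E.
  move=> y0 xy; apply: le_lt_trans (_ : S < +oo)%E; last by rewrite ltey.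
  by apply: le_trans xy; rewrite leeDl.
have psifin h : 0 < h -> psi h \is a fin_num.
  move=> hp; rewrite ge0_fin_numE //; apply: (lt_oo _ (phi h)) => //.
  by rewrite addeC; exact: key.
have supfin : ereal_sup [set phi h | h in [set h : R | (0 < h)%R]] \is a fin_num.
  rewrite ge0_fin_numE; last first.
    by apply: le_trans (phi0 1) _; apply: ereal_sup_ubound; exists 1 => /=.
  apply: (lt_oo _ (psi 1)) => //.
  rewrite -leeBrDr ?psifin //; apply: ge_ereal_sup => _ [h hp <-].
  by rewrite leeBrDr ?psifin //; exact: key.
rewrite addeC -leeBrDr //; apply: ge_ereal_sup => _ [h hp <-].
rewrite leeBrDr // addeC -leeBrDr ?psifin //.
apply: ge_ereal_sup => _ [h' hp' <-].
by rewrite leeBrDr ?psifin //; exact: key.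
Qed.

Section covering_measure.
Context {R : realType} {T : Type} (d : T -> T -> R) {n : nat}.
Local Notation V := 'rV[R]_n.
Implicit Types (f g : V -> T) (E A B : set V) (k : nat).

Definition image_diam_le f A (r : R) : Prop :=
  forall x y, A x -> A y -> d (f x) (f y) <= r.

Local Open Scope ereal_scope.

(* [nu f k E] covers [E] by subsets of the domain of vanishing size, each charged with
   the k-th power of the diameter of its image: coverings live upstairs, so [nu f k E]
   counts the image with multiplicity. An unbounded image costs +oo. *)
Definition gauge f k A : \bar R :=
  ereal_inf [set (r ^+ k)%:E | r in [set r : R | (0 <= r)%R /\ image_diam_le f A r]].

(** The semiring of sets of Euclidean diameter at most [h], taken on the domain instead of the
    target; with it [mu_ext] ranges over coverings of mesh [h]. *)
Definition mesh_space (h : R) : semiRingOfSetsType default_measure_display :=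
  Defs_smallT__canonical__measurable_structure_SemiRingOfSets (@edist R n) h.

Definition nu_mesh f k (h : R) E : \bar R :=
  mu_ext (gauge f k : set (mesh_space h) -> \bar R) E.

Definition nu f k E : \bar R :=
  ereal_sup [set nu_mesh f k h E | h in [set h : R | (0 < h)%R]].

Lemma gauge_ge0 f k A : 0 <= gauge f k A.
Proof.
by apply: le_ereal_inf_tmp => _ [r [r0 _] <-]; rewrite lee_fin exprn_ge0.
Qed.

Lemma gauge_le f k A (r : R) : (0 <= r)%R -> image_diam_le f A r ->
  gauge f k A <= (r ^+ k)%:E.
Proof. by move=> r0 Ar; apply: ereal_inf_lbound; exists r. Qed.

Lemma gauge0 f k : (0 < k)%N -> gauge f k set0 = 0.
Proof.
move=> k0; apply/eqP; rewrite eq_le gauge_ge0 andbT.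
have -> : (0 : \bar R) = ((0 : R) ^+ k)%:E by rewrite expr0n; case: k k0.
exact: gauge_le.
Qed.

Lemma le_gauge f k A B : A `<=` B -> gauge f k A <= gauge f k B.
Proof.
move=> AB; apply: ereal_inf_le_tmp => _ [r [r0 Br] <-]; exists r => //.
by split => // x y /AB Bx /AB; exact: Br.
Qed.

Lemma nu_mesh_ge0 f k h E : 0 <= nu_mesh f k h E.
Proof. by apply: mu_ext_ge0 => A; exact: gauge_ge0. Qed.

Lemma nu_mesh0 f k h : (0 < k)%N -> nu_mesh f k h set0 = 0.
Proof.
by move=> k0; apply: mu_ext0; [exact: gauge0|move=> A; exact: gauge_ge0].
Qed.

Lemma le_nu_mesh f k h A B : A `<=` B -> nu_mesh f k h A <= nu_mesh f k h B.
Proof. exact: (@le_mu_ext _ (mesh_space h) R (gauge f k)). Qed.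

Lemma nu_mesh_bigcup f k h (F : (set V)^nat) :
  nu_mesh f k h (\bigcup_i F i) <= \sum_(i <oo) nu_mesh f k h (F i).
Proof.
exact: (@mu_ext_sigma_subadditive _ (mesh_space h) R (gauge f k)
  (gauge_ge0 f k) F).
Qed.

Lemma nu_mesh_cover f k h E (F : (set V)^nat) : E `<=` \bigcup_i F i ->
  nu_mesh f k h E <= \sum_(i <oo) nu_mesh f k h (F i).
Proof. by move=> EF; apply: le_trans (le_nu_mesh f k h EF) (nu_mesh_bigcup _ _ _ _). Qed.

Lemma nu_mesh_bigcup_ord f k h m (F : (set V)^nat) E : (0 < k)%N ->
  (forall x, E x -> exists2 i, (i < m)%N & F i x) ->
  nu_mesh f k h E <= \sum_(i < m) nu_mesh f k h (F i).
Proof.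
move=> k0 EF.
pose F' i := if (i < m)%N then F i else set0.
apply: (@le_trans _ _ (\sum_(i <oo) nu_mesh f k h (F' i))).
  apply: nu_mesh_cover => x /EF[i im Fx].
  by exists i => //; rewrite /F' im.
rewrite (@nneseries_split _ _ 0 m); last by move=> *; exact: nu_mesh_ge0.
rewrite add0n eseries0 ?adde0; last first.
  by move=> i mi _; rewrite /F' ltnNge mi nu_mesh0.
rewrite big_mkord; apply: lee_sum => i _.
by rewrite /F' ltn_ord.
Qed.

Lemma nu_mesh_setU f k h A B : (0 < k)%N ->
  nu_mesh f k h (A `|` B) <= nu_mesh f k h A + nu_mesh f k h B.
Proof.
move=> k0.
have := @nu_mesh_bigcup_ord f k h 2 (fun i => if i == 0%N then A else B) (A `|` B) k0.
rewrite !big_ord_recl big_ord0 /= adde0; apply.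
by move=> x [Ax|Bx]; [exists 0%N|exists 1%N].
Qed.

Lemma nu_mesh_small f k h A (r : R) : (0 < k)%N -> (0 <= r)%R ->
  small edist h A -> image_diam_le f A r -> nu_mesh f k h A <= (r ^+ k)%:E.
Proof.
move=> k0 r0 hA Ar; apply: le_trans (gauge_le k r0 Ar).
pose F i := if i == 0%N then A else set0.
apply: ereal_inf_lbound; exists F.
  split; first by rewrite /F => -[|i] //=; exact: small0.
  by move=> x Ax; exists 0%N.
rewrite (@nneseries_split _ _ 0 1); last by move=> *; exact: gauge_ge0.
rewrite add0n eseries0 ?adde0; last by move=> [|i] //= _ _; rewrite gauge0.
by rewrite big_nat1.
Qed.

Lemma nu_mesh_le_nu f k h E : (0 < h)%R -> nu_mesh f k h E <= nu f k E.
Proof. by move=> h0; apply: ereal_sup_ubound; exists h. Qed.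

Lemma nu_ge0 f k E : 0 <= nu f k E.
Proof. exact: le_trans (nu_mesh_ge0 f k 1 E) (nu_mesh_le_nu f k E ltr01). Qed.

Lemma nu_le f k E b : (forall h, (0 < h)%R -> nu_mesh f k h E <= b) -> nu f k E <= b.
Proof. by move=> H; apply: ge_ereal_sup => _ [h h0 <-]; exact: H. Qed.

Lemma nu0 f k : (0 < k)%N -> nu f k set0 = 0.
Proof.
move=> k0; apply/eqP; rewrite eq_le nu_ge0 andbT.
by apply: nu_le => h h0; rewrite nu_mesh0.
Qed.

Lemma le_nu f k A B : A `<=` B -> nu f k A <= nu f k B.
Proof.
move=> AB; apply: nu_le => h h0.
exact: le_trans (le_nu_mesh _ _ _ AB) (nu_mesh_le_nu _ _ _ h0).
Qed.

Lemma nu_cover f k E (F : (set V)^nat) : E `<=` \bigcup_i F i ->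
  nu f k E <= \sum_(i <oo) nu f k (F i).
Proof.
move=> EF; apply: nu_le => h h0.
apply: le_trans (nu_mesh_cover _ _ _ EF) _.
by apply: lee_nneseries => *; [exact: nu_mesh_ge0|exact: nu_mesh_le_nu].
Qed.

Lemma nu_setU f k A B : (0 < k)%N -> nu f k (A `|` B) <= nu f k A + nu f k B.
Proof.
move=> k0; apply: nu_le => h h0; apply: le_trans (nu_mesh_setU _ _ _ _ k0) _.
by apply: leeD; exact: nu_mesh_le_nu.
Qed.

(** A nearly optimal covering is turned into explicit sizes. They are made positive, since later
    arguments divide by them, and the covering sets are cut down to [E]. *)
Lemma nu_mesh_cover_exists f k E (h b : R) : (0 < k)%N ->
  nu_mesh f k h E < b%:E ->
  exists (F : (set V)^nat) (r : R^nat),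
    [/\ forall i, [/\ small edist h (F i), F i `<=` E, (0 < r i)%R &
          image_diam_le f (F i) (r i)],
        E `<=` \bigcup_i F i & \sum_(i <oo) (r i ^+ k)%:E <= b%:E].
Proof.
move=> k0 /ereal_inf_lt[_ [F [Fh EF] <-] Fb].
set S := \sum_(i <oo) _ in Fb.
have S0 : 0 <= S by apply: nneseries_ge0 => *; exact: gauge_ge0.
have Sfin : S \is a fin_num by rewrite ge0_fin_numE // (lt_trans Fb) // ltry.
pose c := ((b - fine S) / 2)%R.
have c0 : (0 < c)%R.
  by rewrite divr_gt0 // subr_gt0 -lte_fin fineK.
have e0 i : (0 < c / (2 ^ i.+1)%:R)%R by rewrite divr_gt0 // ltr0n expn_gt0.
have gfin i : gauge f k (F i) \is a fin_num.
  rewrite ge0_fin_numE ?gauge_ge0 //; apply: le_lt_trans (lt_trans Fb (ltry b)).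
  rewrite /S (@nneseriesD1 _ _ i) //; last by move=> *; exact: gauge_ge0.
  by rewrite leeDl //; apply: nneseries_ge0 => *; exact: gauge_ge0.
have H i : exists r : R, [/\ (0 < r)%R, image_diam_le f (F i) r &
   (r ^+ k)%:E <= gauge f k (F i) + (c / (2 ^ i.+1)%:R)%:E + (c / (2 ^ i.+1)%:R)%:E].
  have : gauge f k (F i) < gauge f k (F i) + (c / (2 ^ i.+1)%:R)%:E.
    by rewrite lteDl // ?lte_fin //.
  move/ereal_inf_lt => [_ [r [r0 Fr] <-] rlt].
  pose q := Num.min 1%R (c / (2 ^ i.+1)%:R)%R.
  have q0 : (0 < q)%R by rewrite lt_min ltr01 e0.
  exists (Num.max r q); split.
  - by rewrite lt_max q0 orbT.
  - by move=> x y Fx Fy; rewrite le_max Fr.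
  - have : ((Num.max r q) ^+ k <= r ^+ k + q ^+ k)%R.
      have [rq|qr] := leP r q.
        by rewrite lerDr exprn_ge0.
      by rewrite lerDl exprn_ge0 // ltW.
    rewrite -lee_fin => /le_trans; apply; rewrite EFinD; apply: leeD; first exact: ltW.
    rewrite lee_fin; apply: (@le_trans _ _ q); last by rewrite ge_min lexx orbT.
    rewrite -[leRHS]expr1; apply: ler_wiXn2l => //; first exact: ltW.
    by rewrite ge_min lexx.
move/choice: H => [r rP].
exists (fun i => F i `&` E), r; split.
- move=> i; case: (rP i) => r0 Fr _; split => //.
    by move=> x y [Fx _] [Fy _]; exact: (Fh i).
  by move=> x y [Fx _] [Fy _]; exact: Fr.
- by move=> x Ex; case: (EF _ Ex) => i _ Fx; exists i.
- apply: (@le_trans _ _ (\sum_(i <oo) (gauge f k (F i) + (c / (2 ^ i.+1)%:R)%:E +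
     (c / (2 ^ i.+1)%:R)%:E))).
    apply: lee_nneseries => i _; last by case: (rP i).
    by rewrite lee_fin exprn_ge0 // ltW //; case: (rP i).
  apply: le_trans.
    apply: epsilon_trick => [i|]; last exact: ltW.
    by rewrite adde_ge0 ?gauge_ge0 // lee_fin ltW.
  apply: (@le_trans _ _ (S + c%:E + c%:E)).
    rewrite leeD2r //; apply: epsilon_trick => [i|]; last exact: ltW.
    exact: gauge_ge0.
  rewrite -(fineK Sfin) -!EFinD lee_fin /c; lra.
Qed.

Lemma nu_cover_exists f k E (h r0 b : R) : (0 < k)%N -> (0 < h)%R -> (0 < r0)%R ->
  (forall x y, E x -> E y -> (edist x y <= h)%R -> (d (f x) (f y) <= r0)%R) ->
  nu f k E < b%:E ->
  exists (F : (set V)^nat) (r : R^nat),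
    [/\ forall i, [/\ small edist h (F i), F i `<=` E, (0 < r i <= r0)%R &
          image_diam_le f (F i) (r i)],
        E `<=` \bigcup_i F i & \sum_(i <oo) (r i ^+ k)%:E <= b%:E].
Proof.
move=> k0 h0 r00 Er /(le_lt_trans (nu_mesh_le_nu f k E h0)).
move=> /(nu_mesh_cover_exists k0)[F [r [FP EF Sr]]].
exists F, (fun i => Num.min (r i) r0); split => //.
- move=> i; case: (FP i) => Fh FE ri Fr; split => //.
    by rewrite lt_min ri r00 ge_min lexx orbT.
  by move=> x y Fx Fy; rewrite le_min Fr //= Er //; [exact: FE|exact: FE|exact: Fh].
- apply: le_trans Sr; apply: lee_nneseries => i _.
    by rewrite lee_fin exprn_ge0 // le_min !ltW //; case: (FP i).
  rewrite lee_fin; apply: lerXn2r; rewrite ?nnegrE ?ge_min ?lexx //.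
    by rewrite le_min !ltW //; case: (FP i).
  by rewrite ltW //; case: (FP i).
Qed.

(** [phi] does not shrink distances, so preimages of small sets are small and coverings of [A] pull
    back without loss. *)
Lemma nu_reparam f g k E A (phi : V -> V) : (0 < k)%N ->
  (forall x, E x -> A (phi x)) ->
  (forall x y, E x -> E y -> (edist x y <= edist (phi x) (phi y))%R) ->
  (forall x, E x -> f x = g (phi x)) ->
  nu f k E <= nu g k A.
Proof.
move=> k0 EA Ephi fg; apply: nu_le => h h0.
apply: le_trans (nu_mesh_le_nu _ _ _ h0).
apply: le_ereal_inf_tmp => _ [F [Fh AF] <-].
apply: (@le_trans _ _ (\sum_(i <oo) nu_mesh f k h (E `&` phi @^-1` (F i)))).
  by apply: nu_mesh_cover => x Ex; have [i _ Fx] := AF _ (EA _ Ex); exists i.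
apply: lee_nneseries => [i _ _|i _]; first exact: nu_mesh_ge0.
apply: le_ereal_inf_tmp => _ [r [r0 Fr] <-].
apply: nu_mesh_small => //.
  move=> x y [Ex Fx] [Ey Fy]; apply: le_trans (Ephi _ _ Ex Ey) _; exact: (Fh i).
by move=> x y [Ex Fx] [Ey Fy]; rewrite !fg //; exact: Fr.
Qed.

Lemma eq_nu f g k E : (0 < k)%N -> (forall x, E x -> f x = g x) -> nu f k E = nu g k E.
Proof.
move=> k0 fg; apply/eqP; rewrite eq_le; apply/andP; split.
  exact: (@nu_reparam f g k E E id).
by apply: (@nu_reparam g f k E E id) => // x /fg ->.
Qed.

(** A covering set smaller than the gap meets at most one of the two sets, so its gauge is spent on
    one side only. *)
Lemma nu_mesh_separated f k (h : R) A B : (0 < k)%N ->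
  (forall x y, A x -> B y -> (h < edist x y)%R) ->
  nu_mesh f k h A + nu_mesh f k h B <= nu_mesh f k h (A `|` B).
Proof.
move=> k0 AB; apply: le_ereal_inf_tmp => _ [F [Fh ABF] <-].
apply: (@le_trans _ _ (\sum_(i <oo) (gauge f k (F i `&` A) + gauge f k (F i `&` B)))).
  rewrite nneseriesD; [|by move=> *; exact: gauge_ge0..].
  apply: leeD; apply: ereal_inf_lbound.
  - exists (fun i => F i `&` A) => //; split.
      by move=> i x y [Fx _] [Fy _]; exact: (Fh i).
    by move=> x Ax; have [|i _ Fx] := ABF x; [left|exists i].
  - exists (fun i => F i `&` B) => //; split.
      by move=> i x y [Fx _] [Fy _]; exact: (Fh i).
    by move=> x Bx; have [|i _ Fx] := ABF x; [right|exists i].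
apply: lee_nneseries => [i _ _|i _]; first by rewrite adde_ge0 ?gauge_ge0.
have [FA|FA] := pselect (F i `&` A = set0).
  by rewrite FA gauge0 // add0e; apply: le_gauge => x [].
suff -> : F i `&` B = set0.
  by rewrite gauge0 // adde0; apply: le_gauge => x [].
apply/seteqP; split => // y [Fy By]; apply: FA.
apply/seteqP; split => // x [Fx Ax] /=.
by have := AB _ _ Ax By; rewrite ltNge (Fh i x y Fx Fy).
Qed.

Lemma le_nu_mesh_mesh f k (h h' : R) E : (h <= h')%R -> nu_mesh f k h' E <= nu_mesh f k h E.
Proof.
move=> hh'; apply: le_ereal_inf_tmp => _ [F [Fh EF] <-].
apply: ereal_inf_lbound; exists F => //; split => // i x y Fx Fy.
exact: le_trans (Fh i x y Fx Fy) hh'.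
Qed.

Lemma nu_separated f k (h : R) A B : (0 < k)%N -> (0 < h)%R ->
  (forall x y, A x -> B y -> (h < edist x y)%R) ->
  nu f k A + nu f k B <= nu f k (A `|` B).
Proof.
move=> k0 h0 AB.
apply: (@ereal_sup_mesh_add _ _ _ _ h) => //.
- by move=> h'; exact: nu_mesh_ge0.
- by move=> h'; exact: nu_mesh_ge0.
- by move=> h1 h2; exact: le_nu_mesh_mesh.
- by move=> h1 h2; exact: le_nu_mesh_mesh.
- move=> h' _ h'h; apply: nu_mesh_separated => // x y Ax By.
  exact: le_lt_trans (AB _ _ Ax By).
Qed.

End covering_measure.

(** * Additivity across level sets of Lipschitz functions *)

Section caratheodory_criterion.
Local Open Scope ereal_scope.
Context {R : realType} {T : Type} (mu : set T -> \bar R).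
Hypothesis mu0 : mu set0 = 0.
Hypothesis mu_ge0 : forall A, 0 <= mu A.
Hypothesis le_mu : forall A B, A `<=` B -> mu A <= mu B.
Hypothesis mu_bigcup : forall F : (set T)^nat, mu (\bigcup_i F i) <= \sum_(i <oo) mu (F i).
Variables (u : T -> R) (X : set T).
Hypothesis mu_sep : forall (a b : R) (A B : set T), (a < b)%R -> A `<=` X -> B `<=` X ->
  (forall x, A x -> (u x <= a)%R) -> (forall x, B x -> (b <= u x)%R) ->
  mu A + mu B <= mu (A `|` B).

(** Carathéodory's argument along one function: the part [u <= e N] lies a positive gap below
    [r <= u], and the shells between the levels [e N] and [r] have small total measure. *)
Lemma caratheodory_split (r : R) :
  mu (X `&` [set x | (u x < r)%R]) + mu (X `&` [set x | (r <= u x)%R]) <= mu X.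
Proof.
have [->|Xoo] := eqVneq (mu X) +oo; first exact: leey.
have Xlt : mu X < +oo by rewrite ltey.
pose e (k : nat) : R := (r - k.+1%:R^-1)%R.
have e_lt k : (e k < r)%R by rewrite /e ltrBlDr ltrDl invr_gt0.
have e_mono j k : (j < k)%N -> (e j < e k)%R.
  by move=> jk; rewrite /e ltrD2l ltrN2 ltf_pV2 ?posrE ?ltr0n // ltr_nat.
pose V k := X `&` [set x | (u x <= e k)%R].
(* The shells Q k and Q (k + 2) are separated, so the sum of the mu (Q k) converges. *)
pose Q k := X `&` [set x | (e k < u x <= e k.+1)%R].
have VX k : V k `<=` X by move=> x [].
have QX k : Q k `<=` X by move=> x [].
(* [b] selects the parity. Shells of equal parity are separated by a whole shell, so their measures
   add up to at most that of their union. *)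
have alt b m : \sum_(k < m) mu (Q (2 * k + b)%N) <=
    mu (\bigcup_(k < m) Q (2 * k + b)%N).
  elim: m => [|m IH]; first by rewrite big_ord0.
  rewrite big_ord_recr /=.
  apply: le_trans (leeD2r _ IH) _.
  apply: (@le_trans _ _ (mu ((\bigcup_(k < m) Q (2 * k + b)%N) `|` Q (2 * m + b)%N))).
    case: m {IH} => [|m].
      by rewrite bigcup_mkord big_ord0 mu0 add0e set0U.
    apply: (@mu_sep (e (2 * m + b).+1%N) (e (2 * m.+1 + b)%N)).
    - by apply: e_mono; lia.
    - by move=> x [k _ /QX].
    - exact: QX.
    - move=> x [k /= km [_ /andP[_ xk]]]; apply: le_trans xk _.
      have [->//|kn] := eqVneq k m; apply/ltW/e_mono; lia.
    - by move=> x [_ /andP[xk _]]; exact: ltW.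
  apply: le_mu => x [[k /= km Qx]|Qx]; first by exists k => //=; lia.
  by exists m => /=.
have Qsum m : \sum_(0 <= k < m) mu (Q k) <= mu X + mu X.
  apply: (@le_trans _ _ (\sum_(0 <= k < m.*2) mu (Q k))).
    rewrite (@big_cat_nat _ _ _ m 0 m.*2) //=; last lia.
    by rewrite leeDl // sume_ge0.
  have -> : \sum_(0 <= k < m.*2) mu (Q k) =
      \sum_(k < m) mu (Q (2 * k + 0)%N) + \sum_(k < m) mu (Q (2 * k + 1)%N).
    elim: m => [|m IH]; first by rewrite big_geq // !big_ord0 adde0.
    rewrite doubleS !big_nat_recr //= IH !big_ord_recr /=.
    have -> : (2 * m + 0 = m.*2)%N by lia.
    have -> : (2 * m + 1 = m.*2.+1)%N by lia.
    by rewrite -!addeA; congr (_ + _); rewrite addeCA.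
  apply: leeD; apply: le_trans (alt _ _) _; apply: le_mu => x [k _ /QX] //.
have Qfin : \sum_(k <oo) mu (Q k) < +oo.
  apply: le_lt_trans (_ : mu X + mu X < +oo); last by rewrite lte_add_pinfty.
  apply: lime_le; first exact: is_cvg_nneseries.
  by near=> m; exact: Qsum.
have tail := nneseries_tail_cvg Qfin (fun k _ => mu_ge0 (Q k)).
apply/lee_addgt0Pr => eps eps0.
have [N HN] : exists N, \sum_(N <= k <oo) mu (Q k) <= eps%:E.
  move: tail => /fine_cvgP[+ /cvgrPdist_le /(_ eps eps0)] => -[N1 _ H1] [N2 _ H2].
  exists (maxn N1 N2).
  have fn := H1 (maxn N1 N2) (leq_maxl _ _).
  rewrite -(fineK fn) lee_fin.
  have := H2 (maxn N1 N2) (leq_maxr _ _) => /=.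
  by rewrite sub0r normrN; apply: le_trans; exact: ler_norm.
have VQ : X `&` [set x | (u x < r)%R] `<=` V N `|` \bigcup_k (Q (k + N)%N).
  move=> x [Xx /= xr].
  have [xN|Nx] := leP (u x) (e N); first by left.
  right.
  (* The least such index is positive because [x] lies above level [e N]; its predecessor names the
     shell that contains [x]. *)
  have /ex_minnP[k] : exists k, (u x <= e k)%R.
    have rx0 : (0 < r - u x)%R by rewrite subr_gt0.
    exists (Num.bound (r - u x)^-1); rewrite /e lerBrDr addrC -lerBrDr.
    rewrite -[leRHS]invrK lef_pV2 ?posrE ?invr_gt0 //.
    apply: ltW; apply: lt_trans (archi_boundP _) _; last by rewrite ltr_nat.
    by rewrite invr_ge0 ltW.
  move=> xk kmin; case: k => [|k] in xk kmin *.
    exfalso; have := lt_le_trans Nx xk.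
    by case: N {HN} Nx => [|N] Nx; rewrite ?ltxx // ltNge ltW // e_mono.
  have Nk : (N <= k)%N.
    rewrite leqNgt; apply/negP => kN; have := lt_le_trans Nx xk.
    move: kN; rewrite leq_eqVlt => /predU1P[->|kN]; first by rewrite ltxx.
    by rewrite ltNge ltW // e_mono.
  exists (k - N)%N => //; rewrite subnK //; split => //=; rewrite xk andbT ltNge.
  by apply/negP => /kmin; rewrite ltnn.
apply: (@le_trans _ _ (mu (V N) + eps%:E + mu (X `&` [set x | (r <= u x)%R]))).
  rewrite leeD2r //; apply: le_trans (le_mu VQ) _.
  pose F k := if k is k'.+1 then Q (k' + N)%N else V N.
  have -> : V N `|` \bigcup_k (Q (k + N)%N) = \bigcup_k F k.
    apply/seteqP; split => [x [Vx|[k _ Qx]]|x [[|k] _ Fx]].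
    - by exists 0%N.
    - by exists k.+1.
    - by left.
    - by right; exists k.
  apply: le_trans (mu_bigcup _) _.
  rewrite (nneseries_split 0 1) // add0n big_nat1 leeD2l //.
  rewrite -(nneseries_addn (f := fun k => mu (F k)) 1) //=.
  under eq_eseriesr => i _ do rewrite addn1 /=.
  by rewrite (nneseries_addn (f := fun k => mu (Q k)) N).
rewrite addeAC leeD2r //.
apply: (@le_trans _ _ (mu (V N `|` (X `&` [set x | (r <= u x)%R])))).
  by apply: (@mu_sep (e N) r) => // x [].
by apply: le_mu => x [[]|[]].
Unshelve. all: by end_near. Qed.

End caratheodory_criterion.

Section split_instances.
Context {R : realType}.
Local Open Scope ereal_scope.

(** The Lipschitz bound turns a gap between values of [u] into a gap between sets, across which [nu]
    is additive. *)
Lemma nu_split {T : Type} (d : T -> T -> R) n (f : 'rV[R]_n -> T) k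
    (X : set 'rV[R]_n) (u : 'rV[R]_n -> R) (L r : R) : (0 < k)%N ->
  (forall x y, X x -> X y -> (u y - u x <= L * edist x y)%R) ->
  nu d f k (X `&` [set x | (u x < r)%R]) + nu d f k (X `&` [set x | (r <= u x)%R]) <=
  nu d f k X.
Proof.
move=> k0 uL; apply: caratheodory_split.
- exact: nu0.
- by move=> A; exact: nu_ge0.
- by move=> A B; exact: le_nu.
- by move=> F; exact: nu_cover.
move=> a b A B ab AX BX Aa Bb.
pose L' : R := (`|L| + 1)%R.
have L'0 : (0 < L')%R by rewrite ltr_wpDl.
apply: (@nu_separated _ _ _ _ _ _ ((b - a) / (2 * L'))%R) => //.
  by rewrite divr_gt0 ?subr_gt0 // mulr_gt0.
move=> x y Ax By; rewrite ltr_pdivrMr ?mulr_gt0 //.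
have e0 : (0 <= edist x y)%R by exact: sqrtr_ge0.
have := uL x y (AX _ Ax) (BX _ By); have := Aa _ Ax; have := Bb _ By.
have : (L * edist x y <= L' * edist x y)%R.
  by apply: ler_wpM2r => //; rewrite (le_trans (ler_norm L)) // lerDl.
nra.
Qed.

Section hausdorff_split.
Context {T : pointedType} (d : T -> T -> R).

Lemma diam_le (A : set T) (r : R) : (0 <= r)%R ->
  (forall x y, A x -> A y -> (d x y <= r)%R) -> (diam d A <= r)%R.
Proof.
move=> r0 Ar; apply: ge_sup; first by exists 0%R; left.
by move=> _ [->//|[x Ax [y Ay <-]]]; exact: Ar.
Qed.

Lemma dist_le_diam (A : set T) (r : R) x y :
  (forall x y, A x -> A y -> (d x y <= r)%R) -> A x -> A y -> (d x y <= diam d A)%R.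
Proof.
move=> Ar Ax Ay; apply: ub_le_sup; last by right; exists x => //; exists y.
exists (Num.max 0 r)%R => _ [->|[z Az [w Aw <-]]]; first by rewrite le_max lexx.
by rewrite le_max Ar ?orbT.
Qed.

Lemma hcost_le k (A : set T) (r : R) : (0 <= r)%R ->
  (forall x y, A x -> A y -> (d x y <= r)%R) ->
  hcost d k A <= (omega_ k * (r / 2) ^+ k)%:E.
Proof.
move=> r0 Ar; have w0 := @omega_ge0 R k; rewrite /hcost; case: ifPn => _.
  by rewrite lee_fin mulr_ge0 // exprn_ge0 // divr_ge0.
rewrite lee_fin ler_wpM2l // lerXn2r ?nnegrE ?divr_ge0 ?diam_ge0 //.
by rewrite ler_wpM2r ?invr_ge0 // diam_le.
Qed.

Lemma le_hcost k (A B : set T) (r : R) : A `<=` B ->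
  (forall x y, B x -> B y -> (d x y <= r)%R) -> hcost d k A <= hcost d k B.
Proof.
move=> AB Br; have [->|/set0P[a Aa]] := eqVneq A set0.
  by rewrite hcost0 hcost_ge0.
apply: (@le_trans _ _ (omega_ k * (diam d B / 2) ^+ k)%:E).
  apply: hcost_le; first exact: diam_ge0.
  by move=> x y Ax Ay; apply: dist_le_diam Br _ _; exact: AB.
rewrite /hcost; case: ifPn => // /asboolP B0.
by exfalso; move: (AB _ Aa); rewrite B0.
Qed.

Lemma hausdorff_delta_mono k (h h' : R) (A : set T) : (h <= h')%R ->
  hausdorff_delta d k h' A <= hausdorff_delta d k h A.
Proof.
move=> hh'; apply: le_ereal_inf_tmp => _ [F [Fh EF] <-].
apply: ereal_inf_lbound; exists F => //; split => // i x y Fx Fy.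
exact: le_trans (Fh i x y Fx Fy) hh'.
Qed.

Lemma hausdorff_separated k (h : R) (A B : set T) : (0 < h)%R ->
  (forall x y, A x -> B y -> (h < d x y)%R) ->
  hausdorff d k A + hausdorff d k B <= hausdorff d k (A `|` B).
Proof.
move=> h0 AB.
apply: (@ereal_sup_mesh_add _ _ _ _ h) => //.
- by move=> h'; exact: hausdorff_delta_ge0.
- by move=> h'; exact: hausdorff_delta_ge0.
- by move=> h1 h2; exact: hausdorff_delta_mono.
- by move=> h1 h2; exact: hausdorff_delta_mono.
move=> h' _ h'h; apply: le_ereal_inf_tmp => _ [F [Fh ABF] <-].
apply: (@le_trans _ _ (\sum_(i <oo) (hcost d k (F i `&` A) + hcost d k (F i `&` B)))).
  rewrite nneseriesD; [|by move=> *; exact: hcost_ge0..].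
  apply: leeD; apply: ereal_inf_lbound.
  - exists (fun i => F i `&` A) => //; split.
      by move=> i x y [Fx _] [Fy _]; exact: (Fh i).
    by move=> x Ax; have [|i _ Fx] := ABF x; [left|exists i].
  - exists (fun i => F i `&` B) => //; split.
      by move=> i x y [Fx _] [Fy _]; exact: (Fh i).
    by move=> x Bx; have [|i _ Fx] := ABF x; [right|exists i].
apply: lee_nneseries => [i _ _|i _]; first by rewrite adde_ge0 ?hcost_ge0.
have [FA|FA] := pselect (F i `&` A = set0).
  by rewrite FA hcost0 // add0e; apply: le_hcost (Fh i) => x [].
suff -> : F i `&` B = set0.
  by rewrite hcost0 // adde0; apply: le_hcost (Fh i) => x [].
apply/seteqP; split => // y [Fy By]; apply: FA.
apply/seteqP; split => // x [Fx Ax] /=.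
by have := AB _ _ Ax By; rewrite ltNge (le_trans (Fh i x y Fx Fy)).
Qed.

(** The same criterion in the target. It will be applied to the distance functions of compact
    images. *)
Lemma hausdorff_measurable k (u : T -> R) (r : R) :
  (forall x y, (u y - u x <= d x y)%R) ->
  caratheodory_measurable (hausdorff d k) [set x | (u x < r)%R].
Proof.
move=> uL; apply: le_caratheodory_measurable => X.
have -> : ~` [set x | (u x < r)%R] = [set x | (r <= u x)%R].
  by apply/seteqP; split => x /=; rewrite leNgt => /negP.
apply: caratheodory_split.
- exact: hausdorff0.
- by move=> A; exact: hausdorff_ge0.
- by move=> A B; exact: le_hausdorff.
- by move=> F; exact: hausdorff_sigma_subadditive.
move=> a b A B ab AX BX Aa Bb.
apply: (@hausdorff_separated k ((b - a) / 2)%R) => //.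
  by rewrite divr_gt0 ?subr_gt0.
move=> x y Ax By.
have := uL x y; have := Aa _ Ax; have := Bb _ By; lra.
Qed.

End hausdorff_split.
End split_instances.

(** * Euclidean space *)

Section euclidean.
Context {R : realType} {n : nat}.
Local Notation V := 'rV[R]_n.
Implicit Types x y z : V.

Lemma edist_ge0 x y : 0 <= edist x y. Proof. exact: sqrtr_ge0. Qed.

Lemma edistC x y : edist x y = edist y x.
Proof. by congr Num.sqrt; apply: eq_bigr => i _; rewrite -sqrrN opprB. Qed.

Lemma edistxx x : edist x x = 0.
Proof. by rewrite /Defs.edist big1 ?sqrtr0 // => i _; rewrite subrr expr0n. Qed.

Lemma edist_sqr x y : edist x y ^+ 2 = \sum_(i < n) (x ord0 i - y ord0 i) ^+ 2.
Proof. by rewrite sqr_sqrtr // sumr_ge0 // => i _; exact: sqr_ge0. Qed.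

Lemma coord_le_edist x y i : `|x ord0 i - y ord0 i| <= edist x y.
Proof.
rewrite -ler_sqr ?nnegrE ?edist_ge0 // edist_sqr real_normK ?num_real // (bigD1 i) //= lerDl.
by rewrite sumr_ge0 // => j _; exact: sqr_ge0.
Qed.

Lemma cauchy_schwarz (a b : 'I_n -> R) :
  \sum_i a i * b i <= Num.sqrt (\sum_i a i ^+ 2) * Num.sqrt (\sum_i b i ^+ 2).
Proof.
set A := \sum_i a i ^+ 2; set B := \sum_i b i ^+ 2; set C := \sum_i a i * b i.
have A0 : 0 <= A by apply: sumr_ge0 => i _; exact: sqr_ge0.
have B0 : 0 <= B by apply: sumr_ge0 => i _; exact: sqr_ge0.
rewrite -sqrtrM //; apply: (le_trans (ler_norm _)).
rewrite -sqrtr_sqr; apply: ler_wsqrtr.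
have [B00|Bn0] := eqVneq B 0.
  have b0 i : b i = 0.
    apply/eqP; rewrite -sqrf_eq0; apply/eqP.
    have /allP := etrans (esym (psumr_eq0 _ (fun i _ => sqr_ge0 (b i)))) (introT eqP B00).
    by move/(_ i (mem_index_enum i)) => /eqP.
  have -> : C = 0 by rewrite /C big1 // => i _; rewrite b0 mulr0.
  by rewrite expr0n mulr_ge0.
have Bp : 0 < B by rewrite lt_def Bn0.
rewrite -(ler_pM2r Bp) -subr_ge0.
have -> : A * B * B - C ^+ 2 * B = \sum_i (B * a i - C * b i) ^+ 2.
  transitivity (\sum_i (B ^+ 2 * a i ^+ 2 - (2 * B * C) * (a i * b i) + C ^+ 2 * b i ^+ 2)).
    by rewrite big_split /= sumrB -!mulr_sumr -/A -/B -/C; ring.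
  by apply: eq_bigr => i _; ring.
by apply: sumr_ge0 => i _; exact: sqr_ge0.
Qed.

Lemma edist_triangle y x z : edist x z <= edist x y + edist y z.
Proof.
rewrite -ler_sqr ?nnegrE ?addr_ge0 ?edist_ge0 // sqrrD !edist_sqr.
pose a i := x ord0 i - y ord0 i; pose b i := y ord0 i - z ord0 i.
have -> : \sum_i (x ord0 i - z ord0 i) ^+ 2 =
    \sum_i a i ^+ 2 + 2 * (\sum_i a i * b i) + \sum_i b i ^+ 2.
  rewrite mulr_sumr -!big_split /=.
  by apply: eq_bigr => i _; rewrite /a /b; ring.
rewrite lerD2r lerD2l mulr2n mulrDl mul1r.
by apply: lerD; exact: cauchy_schwarz.
Qed.

Lemma edistZ (a : R) x y : edist (a *: x) (a *: y) = `|a| * edist x y.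
Proof.
rewrite /Defs.edist -sqrtr_sqr -sqrtrM ?sqr_ge0 //; congr Num.sqrt.
by rewrite mulr_sumr; apply: eq_bigr => i _; rewrite !mxE; ring.
Qed.

Lemma edistZl (a b : R) x : edist (a *: x) (b *: x) = `|a - b| * edist x 0.
Proof.
rewrite /Defs.edist -sqrtr_sqr -sqrtrM ?sqr_ge0 //; congr Num.sqrt.
by rewrite mulr_sumr; apply: eq_bigr => i _; rewrite !mxE; ring.
Qed.

Lemma enorm_lipschitz x y : `|edist x 0 - edist y 0| <= edist x y.
Proof.
have := edist_triangle y x 0; have := edist_triangle x y 0.
by rewrite (edistC y x) ler_norml => ? ?; apply/andP; split; lra.
Qed.

Definition unit_dir x : V := (edist x 0)^-1 *: x.

Lemma unit_dirK x : edist x 0 != 0 -> edist x 0 *: unit_dir x = x.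
Proof. by move=> x0; rewrite scalerA mulfV // scale1r. Qed.

Lemma enorm_unit_dir x : edist x 0 != 0 -> edist (unit_dir x) 0 = 1.
Proof.
move=> x0; have := edistZ (edist x 0)^-1 x 0.
by rewrite scaler0 -/(unit_dir x) ger0_norm ?invr_ge0 ?edist_ge0 // mulVf.
Qed.

Lemma unit_dir_lipschitz x y : 2^-1 <= edist x 0 -> 2^-1 <= edist y 0 ->
  edist (unit_dir x) (unit_dir y) <= 4 * edist x y.
Proof.
set a := edist x 0; set b := edist y 0 => a2 b2.
have a0 : 0 < a by lra.
have b0 : 0 < b by lra.
have e0 := edist_ge0 x y.
apply: le_trans (edist_triangle (a^-1 *: y) _ _) _.
rewrite edistZ edistZl -/b.
have -> : `|a^-1 - b^-1| * b = `|a - b| / a.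
  have -> : a^-1 - b^-1 = (b - a) / (a * b) by field; rewrite !gt_eqF.
  rewrite normrM distrC (@ger0_norm _ (_^-1)) ?invr_ge0 ?mulr_ge0 ?ltW //.
  by field; rewrite !gt_eqF.
rewrite ger0_norm ?invr_ge0 ?(ltW a0) //.
have ai : a^-1 <= 2 by rewrite invf_ple ?posrE.
have ai0 : 0 <= a^-1 by rewrite invr_ge0 ltW.
have := enorm_lipschitz x y; rewrite -/a -/b => ab.
have h1 : `|a - b| * a^-1 <= edist x y * 2 by apply: ler_pM.
have h2 : a^-1 * edist x y <= 2 * edist x y by apply: ler_wpM2r.
apply: le_trans (lerD h2 h1) _; lra.
Qed.

Lemma edist_polar x y : edist x 0 <= 1 -> edist x 0 != 0 -> edist y 0 != 0 ->
  edist x y <= `|edist x 0 - edist y 0| + edist (unit_dir x) (unit_dir y).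
Proof.
move=> x1 x0 y0; rewrite -{1}(unit_dirK x0) -{1}(unit_dirK y0).
rewrite addrC; apply: le_trans (edist_triangle (edist x 0 *: unit_dir y) _ _) _.
rewrite edistZ edistZl enorm_unit_dir // mulr1 lerD2r.
by rewrite ger0_norm ?edist_ge0 // ler_piMl ?edist_ge0.
Qed.

(** Compactness in the form in which it is used: a finite subcover by Euclidean balls of prescribed
    radii, free of the topology on row vectors. *)
Definition ball_compact (K : set V) : Prop :=
  forall rho : V -> R, (forall x, K x -> 0 < rho x) ->
    exists2 xs : seq V, (forall x, x \in xs -> K x) &
      forall y, K y -> exists2 x, x \in xs & edist x y < rho x.

Lemma edist_continuous x : continuous (fun y : V => edist x y).
Proof.
move=> y.
apply: (@continuous_comp _ _ _ (fun y : V => \sum_(i < n) (x ord0 i - y ord0 i) ^+ 2)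
  Num.sqrt); last exact: sqrt_continuous.
apply: cvg_big => [||i _]; [exact: add_continuous|exact: nbhs_filter|].
apply: (@continuous_comp _ _ _ (fun y : V => x ord0 i - y ord0 i) (@GRing.exp R ^~ 2%N));
  last exact: exprn_continuous.
apply: continuousB; first exact: cst_continuous.
exact: coord_continuous.
Qed.

Lemma compact_ball_compact (K : set V) : compact K -> ball_compact K.
Proof.
rewrite compact_cover => cK rho rho0.
have [||D DK KD] := cK V K (fun x => [set y | edist x y < rho x]).
- move=> x Kx; apply: (@open_comp _ _ (fun y => edist x y) [set r | r < rho x]).
    by move=> ? _; exact: edist_continuous.
  exact: open_lt.
- by move=> x Kx; exists x => //=; rewrite edistxx rho0.
exists (finmap.enum_fset D).
  by move=> x xD; have := DK _ xD; rewrite inE.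
by move=> y Ky; have [x xD xy] := KD _ Ky; exists x.
Qed.

(** Centres outside [C] receive radii so small that their balls miss [C]; the remaining balls cover
    it. *)
Lemma ball_compact_closed (K C : set V) : ball_compact K -> C `<=` K ->
  (forall x, K x -> ~ C x -> exists2 e, 0 < e & forall y, C y -> e <= edist x y) ->
  ball_compact C.
Proof.
move=> cK CK sepC rho rho0.
have /choice[r rP] : forall x, exists e, (C x -> e = rho x) /\
    (K x -> ~ C x -> 0 < e /\ forall y, C y -> e <= edist x y).
  move=> x; have [Cx|nCx] := pselect (C x); first by exists (rho x); split.
  have [Kx|nKx] := pselect (K x); last by exists 0; split.
  by have [e e0 He] := sepC x Kx nCx; exists e; split.
have [|xs xsK xsP] := cK r.
  move=> x Kx; case: (rP x) => r1 r2.
  have [Cx|nCx] := pselect (C x); first by rewrite r1 // rho0.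
  by case: (r2 Kx nCx).
exists [seq x <- xs | `[< C x >]].
  by move=> x; rewrite mem_filter => /andP[/asboolP].
move=> y Cy; have [x xxs xy] := xsP y (CK _ Cy).
case: (rP x) => r1 r2; have [Cx|nCx] := pselect (C x).
  by exists x; [rewrite mem_filter xxs andbT; apply/asboolP|rewrite -r1].
by have [_ /(_ _ Cy)] := r2 (xsK _ xxs) nCx; rewrite leNgt xy.
Qed.

Lemma ball_compact_le (K : set V) (u : V -> R) (L r : R) : ball_compact K ->
  (forall x y, K x -> K y -> `|u x - u y| <= L * edist x y) ->
  ball_compact (K `&` [set x | u x <= r]).
Proof.
move=> cK uL; apply: (ball_compact_closed cK); first by move=> x [].
move=> x Kx nx; have ux : r < u x by rewrite ltNge; apply/negP => ?; apply: nx.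
have L0 : 0 < `|L| + 1 by rewrite ltr_wpDl.
exists ((u x - r) / (`|L| + 1)); first by rewrite divr_gt0 // subr_gt0.
move=> y [Ky /= uy]; rewrite ler_pdivrMr // mulrC.
have := uL x y Kx Ky; have := ler_norm (u x - u y).
have : L * edist x y <= (`|L| + 1) * edist x y.
  by rewrite ler_wpM2r ?edist_ge0 // (le_trans (ler_norm L)) // lerDl.
lra.
Qed.

Lemma ball_compact_bounded (T : Type) (d : T -> T -> R) (f : V -> T) (K : set V) (L : R) o :
  is_metric d -> ball_compact K ->
  (forall x y, K x -> K y -> d (f x) (f y) <= L * edist x y) ->
  exists2 D, 0 <= D & forall x, K x -> d o (f x) <= D.
Proof.
move=> [d0 _ _ dtri] cK fL.
have [|xs xsK xsP] := cK (fun=> 1) => //.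
exists (\sum_(x <- xs) d o (f x) + (`|L| + 1)).
  by rewrite addr_ge0 ?sumr_ge0 // addr_ge0.
move=> y Ky; have [x xxs xy] := xsP y Ky.
apply: le_trans (dtri _ (f x) _) _; apply: lerD.
  rewrite (big_rem x) //= lerDl sumr_ge0 //.
apply: le_trans (fL _ _ (xsK _ xxs) Ky) _.
apply: (@le_trans _ _ (`|L| * edist x y)).
  by rewrite ler_wpM2r ?edist_ge0 // ler_norm.
have : `|L| * edist x y <= `|L| * 1 by rewrite ler_wpM2l // ltW.
lra.
Qed.

End euclidean.

Section unit_ball.
Context {R : realType}.
Local Notation V := 'rV[R]_3.

Lemma enorm_sqr (x : V) : edist x 0 ^+ 2 = \sum_(i < 3) x ord0 i ^+ 2.
Proof. by rewrite edist_sqr; apply: eq_bigr => i _; rewrite mxE subr0. Qed.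

Lemma sphere2E (x : V) : sphere2 x <-> edist x 0 = 1.
Proof.
rewrite /sphere2 /= -enorm_sqr; split => [/eqP|->]; last by rewrite expr1n.
by rewrite sqrp_eq1 ?edist_ge0 // => /eqP.
Qed.

Lemma ball3E (x : V) : ball3 x <-> edist x 0 <= 1.
Proof. by rewrite /ball3 /= -enorm_sqr expr_le1 // edist_ge0. Qed.

Lemma ball_compact_ball3 : ball_compact (@ball3 R).
Proof.
have cube : ball_compact [set v : V | forall i, `[(-1 : R), 1]%classic (v ord0 i)].
  apply/compact_ball_compact/(@rV_compact _ _ (fun=> `[(-1 : R), 1]%classic)) => i.
  exact: segment_compact.
have -> : @ball3 R = [set v : V | forall i, `[(-1 : R), 1]%classic (v ord0 i)] `&`
    [set x | edist x 0 <= 1].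
  apply/seteqP; split => [x /ball3E x1|x [_ /ball3E]//]; split => // i.
  by rewrite /= in_itv /= -ler_norml; have := coord_le_edist x 0 i;
    rewrite mxE subr0 => /le_trans; apply.
apply: (@ball_compact_le _ _ _ _ 1) => // x y _ _.
by rewrite mul1r enorm_lipschitz.
Qed.

Lemma sphere2_ball3 : @sphere2 R `<=` ball3.
Proof. by move=> x /sphere2E x1; apply/ball3E; rewrite x1. Qed.

Lemma ball_compact_sphere2 : ball_compact (@sphere2 R).
Proof.
have -> : @sphere2 R = ball3 `&` [set x | - edist x 0 <= -1].
  apply/seteqP; split => [x Sx|x [/ball3E x1 /= x1']].
    by split; [exact: sphere2_ball3|rewrite /= (sphere2E x).1].
  by apply/sphere2E/eqP; rewrite eq_le x1 -lerN2.
apply: (@ball_compact_le _ _ _ _ 1 _ ball_compact_ball3) => // x y _ _.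
by rewrite mul1r -opprD normrN enorm_lipschitz.
Qed.

End unit_ball.

(** * Comparison of volumes with covering measures *)

Section image_measure.
Local Open Scope ereal_scope.
Context {R : realType} {T : pointedType} (d : T -> T -> R) {n : nat}.
Hypothesis md : is_metric d.
Local Notation V := 'rV[R]_n.
Variables (k : nat) (g : V -> T) (K : set V) (L : R).
Hypothesis k0 : (0 < k)%N.
Hypothesis gL : forall x y, K x -> K y -> (d (g x) (g y) <= L * edist x y)%R.
Local Notation M := (caratheodory_type (hausdorff d k)).

(** A compact image is closed, hence the intersection of the sublevel sets of its distance function,
    which is 1-Lipschitz. *)
Lemma image_ball_compact_measurable (C : set V) : C `<=` K -> ball_compact C ->
  measurable (g @` C : set M).
Proof.
case: md => d0 d00 dC dtri CK cC.
have [->|/set0P[c Cc]] := eqVneq C set0; first by rewrite image_set0; exact: measurable0.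
pose u (y : T) : R := inf [set d y (g x) | x in C].
have hinf y : has_inf [set d y (g x) | x in C].
  split; first by exists (d y (g c)); exists c.
  by exists 0%R => _ [x _ <-].
have u_le y x : C x -> (u y <= d y (g x))%R.
  by move=> Cx; apply: ge_inf; [case: (hinf y)|exists x].
have uL x y : (u y - u x <= d x y)%R.
  rewrite lerBlDr addrC -lerBlDr; apply: lb_le_inf; first by case: (hinf x).
  move=> _ [z Cz <-]; rewrite lerBlDr; apply: le_trans (u_le y z Cz) _.
  by rewrite addrC (dC x y).
have -> : g @` C = \bigcap_(m : nat) [set y | (u y < m.+1%:R^-1)%R].
  apply/seteqP; split => [_ [x Cx <-] m _ /=|y Hy].
    by apply: le_lt_trans (u_le _ _ Cx) _; rewrite (d00 _ _).2 // invr_gt0.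
  apply: contrapT => ny.
  have dpos x : C x -> (0 < d y (g x))%R.
    move=> Cx; rewrite lt_def d0 andbT; apply/eqP => /d00 yg.
    by apply: ny; exists x.
  have L0 : (0 < 2 * (`|L| + 1))%R by rewrite mulr_gt0 // ltr_wpDl.
  (* The radii are proportional to the distance from [y]: on each ball the image stays at least half
     as far from [y] as at the centre. *)
  have [x Cx|xs xsC xsP] := cC (fun x => d y (g x) / (2 * (`|L| + 1)))%R.
    by rewrite divr_gt0 // dpos.
  have [m m0 mP] : exists2 m : R, (0 < m)%R & forall x, x \in xs -> (m <= d y (g x) / 2)%R.
    elim: xs xsC {xsP} => [|x xs IH] xsC; first by exists 1%R.
    have [z zxs|m m0 mP] := IH; first by apply: xsC; rewrite inE zxs orbT.
    have x0 : (0 < d y (g x) / 2)%R.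
      by rewrite divr_gt0 // dpos //; apply: xsC; rewrite inE eqxx.
    exists (Num.min m (d y (g x) / 2))%R; first by rewrite lt_min m0.
    by move=> z; rewrite inE ge_min => /predU1P[->|/mP ->//]; rewrite lexx orbT.
  have um : (m <= u y)%R.
    apply: lb_le_inf; first by case: (hinf y).
    move=> _ [z Cz <-]; have [x xxs xz] := xsP z Cz.
    have Cx := xsC _ xxs.
    apply: le_trans (mP _ xxs) _.
    have := dtri y (g z) (g x); have := gL (CK _ Cz) (CK _ Cx).
    move: xz; rewrite ltr_pdivlMr // edistC.
    have := edist_ge0 z x; have := ler_norm L.
    move=> lL e0 xz gzx tri.
    have : (L * edist z x <= `|L| * edist z x)%R by apply: ler_wpM2r.
    nra.
  have := Hy (Num.bound m^-1) Logic.I; rewrite /= ltNge; apply/negP/negPn.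
  apply: le_trans um; rewrite -[leRHS]invrK lef_pV2 ?posrE ?invr_gt0 //.
  apply: ltW; apply: lt_trans (archi_boundP _) _; last by rewrite ltr_nat.
  by rewrite invr_ge0 ltW.
by apply: bigcapT_measurable => m; exact: hausdorff_measurable.
Qed.

(* The cuts [v m < r m] refine K into finitely many pieces; the number of pieces whose
   image contains y increases to the multiplicity of y once the cuts separate points. *)
Variables (v : nat -> V -> R) (r : nat -> R).
Hypothesis vL : forall m x y, (`|v m x - v m y| <= edist x y)%R.
Hypothesis cK : ball_compact K.

Fixpoint atoms (m : nat) : seq (set V) :=
  if m is m'.+1 then
    flatten [seq [:: A `&` [set x | (v m' x < r m')%R]; A `&` [set x | (r m' <= v m' x)%R]]
            | A <- atoms m']
  else [:: K].

Lemma sum_atomsS m (F : set V -> \bar R) :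
  \sum_(A <- atoms m.+1) F A =
  \sum_(A <- atoms m) (F (A `&` [set x | (v m x < r m)%R]) +
                       F (A `&` [set x | (r m <= v m x)%R])).
Proof.
by rewrite /= big_flatten big_map; apply: eq_bigr => A _; rewrite !big_cons big_nil Monoid.mulm1.
Qed.

Lemma atoms_ind (P : nat -> set V -> Prop) : P 0%N K ->
  (forall m A, P m A -> P m.+1 (A `&` [set x | (v m x < r m)%R])) ->
  (forall m A, P m A -> P m.+1 (A `&` [set x | (r m <= v m x)%R])) ->
  forall m A, A \in atoms m -> P m A.
Proof.
move=> P0 P1 P2; elim=> [|m IH] A; first by rewrite inE => /eqP ->.
move=> /flatten_mapP[B Bm]; rewrite !inE => /orP[/eqP ->|/eqP ->].
  exact: P1 (IH _ Bm).
exact: P2 (IH _ Bm).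
Qed.

Lemma atoms_sub m A : A \in atoms m -> A `<=` K.
Proof.
apply: (@atoms_ind (fun _ A => A `<=` K)) => // {m}m {}A AK x [/AK].
  by [].
by [].
Qed.

Lemma atoms_cover m x : K x -> exists2 A, A \in atoms m & A x.
Proof.
move=> Kx; elim: m => [|m [A Am Ax]]; first by exists K; rewrite ?inE.
have [xr|rx] := ltP (v m x) (r m).
  exists (A `&` [set x | (v m x < r m)%R]) => //.
  by apply/flatten_mapP; exists A => //; rewrite !inE eqxx.
exists (A `&` [set x | (r m <= v m x)%R]) => //.
by apply/flatten_mapP; exists A => //; rewrite !inE eqxx orbT.
Qed.

Lemma atoms_side m A x y i : A \in atoms m -> A x -> A y -> (i < m)%N ->
  (v i x < r i)%R = (v i y < r i)%R.
Proof.
move=> Am Ax Ay im.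
apply: (@atoms_ind (fun m A => forall x y i, A x -> A y -> (i < m)%N ->
  (v i x < r i)%R = (v i y < r i)%R)) Am _ _ _ Ax Ay im => // {}m {}A IH x' y' j.
  move=> [Ax' /= xr] [Ay' /= yr]; rewrite ltnS leq_eqVlt => /predU1P[->|]; last exact: IH.
  by rewrite xr yr.
move=> [Ax' /= xr] [Ay' /= yr]; rewrite ltnS leq_eqVlt => /predU1P[->|]; last exact: IH.
by rewrite !ltNge xr yr.
Qed.

(** An atom need not be compact, so the induction intersects it with an arbitrary compact [C]. A cut
    [r <= v] merely shrinks [C]; a cut [v < r] is a countable union of cuts that do. *)
Lemma atoms_measurable m A : A \in atoms m -> measurable (g @` A : set M).
Proof.
move=> Am; suff H : forall C, ball_compact C -> C `<=` K -> measurable (g @` (A `&` C) : set M).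
  by have := H K cK (@subset_refl _ K); rewrite (setIidl (atoms_sub Am)).
apply: (@atoms_ind (fun _ A => forall C, ball_compact C -> C `<=` K ->
  measurable (g @` (A `&` C) : set M))) Am => {m A}.
- by move=> C cC CK; rewrite (setIidr CK); exact: image_ball_compact_measurable.
- move=> m A IH C cC CK.
  have -> : A `&` [set x | (v m x < r m)%R] `&` C =
      \bigcup_(j : nat) (A `&` (C `&` [set x | (v m x <= r m - j.+1%:R^-1)%R])).
    apply/seteqP; split => [x [[Ax /= xr] Cx]|x [j _ [Ax [Cx /= xr]]]]; last first.
      split => //; split => //=; apply: le_lt_trans xr _.
      by rewrite ltrBlDr ltrDl invr_gt0.
    have rx0 : (0 < r m - v m x)%R by rewrite subr_gt0.
    exists (Num.bound (r m - v m x)^-1) => //; split => //; split => //=.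
    rewrite lerBrDr addrC -lerBrDr.
    rewrite -[leRHS]invrK lef_pV2 ?posrE ?invr_gt0 //.
    apply: ltW; apply: lt_trans (archi_boundP _) _; last by rewrite ltr_nat.
    by rewrite invr_ge0 ltW.
  rewrite image_bigcup; apply: bigcup_measurable => j _; apply: IH.
    by apply: (@ball_compact_le _ _ _ _ 1) => // x y _ _; rewrite mul1r.
  by move=> x [/CK].
- move=> m A IH C cC CK.
  have -> : A `&` [set x | (r m <= v m x)%R] `&` C =
      A `&` (C `&` [set x | (- v m x <= - r m)%R]).
    by apply/seteqP; split => [x [[Ax /= xr] Cx]|x [Ax [Cx /= xr]]];
      [split => //; split => //=; rewrite lerN2|split => //; split => //=; rewrite -lerN2].
  apply: IH; last by move=> x [/CK].
  apply: (@ball_compact_le _ _ _ _ 1) => // x y _ _.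
  by rewrite mul1r -opprD normrN.
Qed.

Lemma atoms_nu m : \sum_(A <- atoms m) nu d g k A <= nu d g k K.
Proof.
elim: m => [|m IH]; first by rewrite /= big_seq1.
rewrite sum_atomsS; apply: le_trans IH; apply: lee_sum => A _.
apply: (@nu_split _ _ _ _ _ _ _ _ 1%R) => // x y _ _.
by rewrite mul1r edistC (le_trans (ler_norm _)).
Qed.

Lemma multiplicity_ge0 (A : set V) y : 0 <= multiplicity A g y.
Proof. exact: esum_ge0. Qed.

Lemma atoms_multiplicity m y : \sum_(A <- atoms m) multiplicity A g y = multiplicity K g y.
Proof.
elim: m => [|m IH]; first by rewrite /= big_seq1.
rewrite sum_atomsS -IH; apply: eq_bigr => A _; apply/esym.
rewrite /multiplicity (esumID [set x | (v m x < r m)%R]) //.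
by congr (_ + _); congr esum; apply/seteqP; split => x /=;
  rewrite ?leNgt; [case=> -[]|case=> -[]|case=> -[? ?] /negP|case=> -[? /negP]].
Qed.

Lemma indic_image_le_multiplicity (A : set V) y :
  (\1_(g @` A) y)%:E <= multiplicity A g y.
Proof.
rewrite indicE; case: (boolP (y \in _)) => [|_]; last exact: multiplicity_ge0.
rewrite inE => -[x Ax gx]; apply: esum_ge; exists [set x].
  by split; [exact: finite_set1|move=> _ ->].
by rewrite fsbig_set1.
Qed.

Definition image_count m (y : T) : \bar R := \sum_(A <- atoms m) (\1_(g @` A) y)%:E.

Lemma image_count_le m y : image_count m y <= multiplicity K g y.
Proof.
rewrite -(atoms_multiplicity m); apply: lee_sum => A _.
exact: indic_image_le_multiplicity.
Qed.

Lemma image_count_ge0 m y : 0 <= image_count m y.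
Proof. by apply: sume_ge0 => A _; rewrite lee_fin indicE. Qed.

Lemma image_count_measurable m : measurable_fun setT (image_count m : M -> \bar R).
Proof.
(* Measurability of a sum is asked of every summand, hence the membership test inside it. *)
rewrite (_ : image_count m = (fun y => \sum_(A <- atoms m)
   (if A \in atoms m then (\1_(g @` A) y)%:E else 0))); last first.
  by apply/funext => y; rewrite /image_count big_seq [in RHS]big_seq;
    apply: eq_bigr => A ->.
apply: emeasurable_sum => A; case: (boolP (A \in atoms m)) => Am; last exact: measurable_cst.
by apply/measurable_EFinP; apply: measurable_indic; exact: atoms_measurable Am.
Qed.

Lemma integral_image_count m :
  \int[@Hmeasure R T d k]_(y in [set: M]) image_count m y =
  \sum_(A <- atoms m) hausdorff d k (g @` A).
Proof.
transitivity (\int[@Hmeasure R T d k]_(y in [set: M]) (\sum_(A <- atoms m)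
   (if A \in atoms m then (\1_(g @` A) y)%:E else 0))).
  apply: eq_integral => y _; rewrite /image_count big_seq [in RHS]big_seq.
  by apply: eq_bigr => A ->.
pose h A (y : M) : \bar R := if A \in atoms m then (\1_(g @` A) y)%:E else 0.
have mh A : measurable_fun [set: M] (h A).
  rewrite /h; case: (boolP (A \in atoms m)) => Am; last exact: measurable_cst.
  by apply/measurable_EFinP; apply: measurable_indic; exact: atoms_measurable Am.
have h0 A (y : M) : [set: M] y -> 0 <= h A y.
  by rewrite /h; case: ifPn => // _ _; rewrite lee_fin indicE.
rewrite (@ge0_integral_sum _ M R (@Hmeasure R T d k) [set: M] measurableT _ h mh h0).
rewrite big_seq [RHS]big_seq; apply: eq_bigr => A Am; rewrite /h Am.
rewrite integral_indic; [by rewrite setIT| |exact: atoms_measurable Am].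
exact: measurableT.
Qed.

Lemma image_count_mono y : nondecreasing_seq (image_count ^~ y).
Proof.
apply/nondecreasing_seqP => m; rewrite /image_count sum_atomsS; apply: lee_sum => A _.
rewrite -EFinD lee_fin !indicE.
case: (boolP (y \in g @` A)) => [|_]; last by rewrite addr_ge0.
rewrite inE => -[x Ax gx].
have [xr|rx] := ltP (v m x) (r m).
  have -> : y \in g @` (A `&` [set x | (v m x < r m)%R]) by rewrite inE; exists x.
  by rewrite lerDl.
have -> : y \in g @` (A `&` [set x | (r m <= v m x)%R]) by rewrite inE; exists x.
by rewrite lerDr.
Qed.

End image_measure.

Section area_comparison.
Local Open Scope ereal_scope.
Context {R : realType} {T : pointedType} (d : T -> T -> R) {n : nat}.
Hypothesis md : is_metric d.
Local Notation V := 'rV[R]_n.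
Variables (k : nat) (g : V -> T) (K : set V) (L : R).
Hypothesis k0 : (0 < k)%N.
Hypothesis gL : forall x y, K x -> K y -> (d (g x) (g y) <= L * edist x y)%R.
Hypothesis cK : ball_compact K.
Local Notation M := (caratheodory_type (hausdorff d k)).

(** A fine covering of [A] has fine images since [g] is Lipschitz, and [omega_ k / 2 ^+ k <= 1]
    compares the costs set by set. *)
Lemma hausdorff_image_le_nu (A : set V) : (omega_ k <= (2 : R) ^+ k)%R ->
  A `<=` K -> hausdorff d k (g @` A) <= nu d g k A.
Proof.
move=> wk AK; apply: ge_ereal_sup => _ [delta /= delta0 <-].
pose h : R := (delta / (`|L| + 1))%R.
have L0 : (0 < `|L| + 1)%R by rewrite ltr_wpDl.
have h0 : (0 < h)%R by rewrite divr_gt0.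
apply: le_trans (nu_mesh_le_nu _ _ _ _ h0).
apply: le_ereal_inf_tmp => _ [F [Fh AF] <-].
apply: (@le_trans _ _ (\sum_(i <oo) hcost d k (g @` (F i `&` A)))).
  apply: ereal_inf_lbound; exists (fun i => g @` (F i `&` A)) => //; split.
    move=> i _ _ [x [Fx Ax] <-] [y [Fy Ay] <-].
    apply: le_trans (gL (AK _ Ax) (AK _ Ay)) _.
    apply: (@le_trans _ _ ((`|L| + 1) * edist x y)%R).
      by rewrite ler_wpM2r ?edist_ge0 // (le_trans (ler_norm L)) // lerDl.
    by rewrite mulrC -ler_pdivlMr //; exact: (Fh i).
  move=> _ [x Ax <-]; have [i _ Fx] := AF _ Ax.
  by exists i => //; exists x.
apply: lee_nneseries => [i _ _|i _]; first exact: hcost_ge0.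
apply: le_ereal_inf_tmp => _ [r [r0 Fr] <-].
apply: (@le_trans _ _ (omega_ k * (r / 2) ^+ k)%:E).
  by apply: hcost_le => // _ _ [x [Fx _] <-] [y [Fy _] <-]; exact: Fr.
rewrite lee_fin expr_div_n mulrCA ler_piMr ?exprn_ge0 //.
by rewrite ler_pdivrMr ?exprn_gt0 // mul1r.
Qed.

(** Preimages of a fine covering of the image need not be small. Intersecting them with a set [A]
    that is already small removes this difficulty, so coverings downstairs of any mesh, here 1, will
    do. *)
Lemma nu_mesh_le_hausdorff (A : set V) (c h : R) : (0 <= c)%R ->
  (2 ^+ k <= c * omega_ k)%R -> small edist h A -> A `<=` K ->
  nu_mesh d g k h A <= c%:E * hausdorff d k (g @` A).
Proof.
move=> c0 ck Ah AK.
apply: (@le_trans _ _ (c%:E * hausdorff_delta d k 1 (g @` A))); last first.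
  by apply: lee_wpmul2l; [rewrite lee_fin|exact: hausdorff_delta_le_hausdorff].
have cp : (0 < c)%R.
  rewrite lt_def c0 andbT; apply/eqP => cz; move: ck; rewrite cz mul0r.
  by rewrite leNgt exprn_gt0.
rewrite -lee_pdivrMl //.
apply: le_ereal_inf_tmp => _ [G [Gs AG] <-].
rewrite lee_pdivrMl // -nneseriesZl; last by move=> *; exact: hcost_ge0.
apply: (@le_trans _ _ (\sum_(i <oo) nu_mesh d g k h (A `&` g @^-1` (G i)))).
  apply: nu_mesh_cover => x Ax; have [|i _ Gx] := AG (g x); first by exists x.
  by exists i.
apply: lee_nneseries => [i _ _|i _]; first exact: nu_mesh_ge0.
have [->|/set0P[a [Aa Ga]]] := eqVneq (A `&` g @^-1` G i) set0.
  by rewrite nu_mesh0 // mule_ge0 // hcost_ge0.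
apply: (@le_trans _ _ ((diam d (G i)) ^+ k)%:E).
  apply: nu_mesh_small => //; first exact: diam_ge0.
    by move=> x y [Ax _] [Ay _]; exact: Ah.
  by move=> x y [_ Gx] [_ Gy]; exact: (dist_le_diam (Gs i)).
rewrite /hcost; case: ifPn => [/asboolP Gi0|_]; first by move: Ga; rewrite /= Gi0.
rewrite -EFinM lee_fin expr_div_n mulrA mulrCA ler_peMr ?exprn_ge0 ?diam_ge0 //.
by rewrite ler_pdivlMr ?exprn_gt0 // mul1r.
Qed.

Lemma multiplicity_limit : exists (v : nat -> V -> R) (r : nat -> R),
  (forall m x y, (`|v m x - v m y| <= edist x y)%R) /\
  forall y, image_count g K v r m y @[m --> \oo] --> multiplicity K g y.
Proof.
(* The cuts are all half spaces with a rational threshold in one coordinate. An index that decodes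
   to nothing yields the void cut [0 < 0]. *)
pose c (m : nat) : option ('I_n * rat) := unpickle m.
pose v m (x : V) : R := if c m is Some (j, q) then x ord0 j else 0%R.
pose r m : R := if c m is Some (j, q) then ratr q else 0%R.
have vL m x y : (`|v m x - v m y| <= edist x y)%R.
  rewrite /v; case: (c m) => [[j _]|]; first exact: coord_le_edist.
  by rewrite subrr normr0 edist_ge0.
have sep (x y : V) : x <> y -> exists m, (v m x < r m)%R <> (v m y < r m)%R.
  move=> xy; have [j xyj] : exists j, x ord0 j != y ord0 j.
    apply: contrapT => H; apply: xy; apply/rowP => j; apply/eqP.
    by apply: contrapT => /negP ?; apply: H; exists j.
  have [q qxy] : exists q : rat, (x ord0 j < ratr q <= y ord0 j)%R \/
      (y ord0 j < ratr q <= x ord0 j)%R.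
    move: xyj; rewrite neq_lt => /orP[] /rat_in_itvoo[q]; rewrite in_itv /= => /andP[q1 q2].
      by exists q; left; rewrite q1 ltW.
    by exists q; right; rewrite q1 ltW.
  exists (pickle (j, q)); rewrite /v /r /c pickleK.
  by case: qxy => /andP[-> q2]; rewrite ltNge q2.
exists v, r; split => // y.
have -> : multiplicity K g y = ereal_sup (range (image_count g K v r ^~ y)); last first.
  by apply: ereal_nondecreasing_cvgn; exact: image_count_mono.
apply/eqP; rewrite eq_le; apply/andP; split; last first.
  by apply: ge_ereal_sup => _ [m _ <-]; exact: image_count_le.
apply: ge_ereal_sup => _ [F [finF FK] <-].
rewrite fsbig_finite //=; set s := finmap.enum_fset (fset_set F).
have us : uniq s by exact: finmap.fset_uniq.
have sK x : x \in s -> K x /\ g x = y.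
  by move=> xs; apply: FK; move: xs; rewrite /s in_fset_set // inE.
(* [s] is a finite part of the fibre over [y]. After [m] cuts its points lie in different atoms, and
   the image of each of these atoms contains [y]. *)
have [m mP] : exists m, forall x z, x \in s -> z \in s -> x <> z ->
    exists2 i, (i < m)%N & (v i x < r i)%R <> (v i z < r i)%R.
  have /choice[N NP] : forall xz : V * V, exists m, xz.1 <> xz.2 ->
      (v m xz.1 < r m)%R <> (v m xz.2 < r m)%R.
    move=> [x z] /=; have [->|xz] := pselect (x = z); first by exists 0%N.
    by have [m mP] := sep _ _ xz; exists m.
  exists (\max_(x <- s) \max_(z <- s) N (x, z)).+1 => x z xs zs xz.
  exists (N (x, z)); last exact: (NP (x, z)).
  rewrite ltnS (big_rem x) //= leq_max; apply/orP; left.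
  by rewrite (big_rem z) //= leq_max leqnn.
apply: (@le_trans _ _ (image_count g K v r m y)); last first.
  by apply: ereal_sup_ubound; exists m.
apply: (@le_trans _ _ (\sum_(A <- atoms K v r m) \sum_(x <- s) (\1_A x)%:E)).
  rewrite exchange_big /= big_seq [leRHS]big_seq; apply: lee_sum => x /sK[Kx _].
  have [A Am Ax] := atoms_cover v r m Kx.
  rewrite (big_rem A) //= indicE mem_set // leeDl //.
  by apply: sume_ge0 => B _; rewrite lee_fin indicE.
rewrite big_seq /image_count [leRHS]big_seq; apply: lee_sum => A Am.
have [[x xs Ax]|noA] := pselect (exists2 x, x \in s & A x); last first.
  rewrite big_seq big1 ?lee_fin ?indicE // => x xs.
  by rewrite indicE memNset // => Ax; apply: noA; exists x.
rewrite (bigD1_seq x) //= big_seq_cond big1 ?adde0; last first.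
  move=> z /andP[zs zx]; rewrite indicE memNset // => Az.
  have [i im] := mP x z xs zs (fun e => negP zx (introT eqP (esym e))).
  by apply; exact: atoms_side Am Ax Az im.
rewrite !indicE (mem_set Ax) mem_set //.
by exists x => //; case: (sK _ xs).
Qed.

Lemma multiplicity_measurable :
  measurable_fun [set: M] (multiplicity K g : M -> \bar R).
Proof.
have [v [r [vL mlim]]] := multiplicity_limit.
have mf m : measurable_fun [set: M] (image_count g K v r m : M -> \bar R).
  exact: (image_count_measurable md gL r vL cK m).
exact: (@emeasurable_fun_cvg _ M R [set: M] _ (multiplicity K g : M -> \bar R) mf
  (fun y _ => mlim y)).
Qed.

(** By monotone convergence the volume is the limit of sums of Hausdorff measures of images of
    atoms; the values of [nu] on the atoms add up to at most that on [K]. *)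
Lemma vol_le_nu : (omega_ k <= (2 : R) ^+ k)%R -> vol d k K g <= nu d g k K.
Proof.
move=> wk; have [v [r [vL mlim]]] := multiplicity_limit.
pose N m : M -> \bar R := image_count g K v r m.
have mN m : measurable_fun [set: M] (N m) by exact: (image_count_measurable md gL r vL cK m).
have N0 m (y : M) : [set: M] y -> 0 <= N m y by move=> _; exact: image_count_ge0.
have NN (y : M) : [set: M] y -> {homo N ^~ y : m m' / (m <= m')%N >-> m <= m'}.
  by move=> _; exact: image_count_mono.
have volE : vol d k K g = limn (fun m => \int[@Hmeasure R T d k]_(y in [set: M]) N m y).
  rewrite -(@monotone_convergence _ M R (@Hmeasure R T d k) [set: M] measurableT N mN N0 NN).
  apply: eq_integral => y _.
  exact: esym (cvg_lim _ (mlim y)).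
rewrite volE; apply: lime_le.
  apply: ereal_nondecreasing_is_cvgn => m m' mm'.
  apply: (@ge0_le_integral _ M R (@Hmeasure R T d k) [set: M] measurableT _ _
    (N0 m) (mN m) (mN m')) => y _.
  exact: NN.
near=> m; rewrite (integral_image_count md k gL r vL cK).
apply: le_trans (atoms_nu d g K k0 r vL m).
rewrite big_seq [leRHS]big_seq; apply: lee_sum => A /atoms_sub AK.
exact: hausdorff_image_le_nu.
Unshelve. all: by end_near. Qed.

Lemma nu_le_vol (c : R) : (0 <= c)%R -> (2 ^+ k <= c * omega_ k)%R ->
  nu d g k K <= c%:E * vol d k K g.
Proof.
move=> c0 ck; apply: nu_le => h h0.
have [_ _|xs xsK xsP] := @cK (fun=> (h / 2)%R); first by rewrite divr_gt0.
(* Cutting by the distance to each point of an [h / 2]-net makes all atoms of size at most [h] after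
   finitely many cuts. *)
pose v m (x : V) := edist (nth 0%R xs m) x; pose r (m : nat) := (h / 2)%R.
have vL m x y : (`|v m x - v m y| <= edist x y)%R.
  rewrite /v; have := edist_triangle y (nth 0%R xs m) x.
  have := edist_triangle x (nth 0%R xs m) y; rewrite (edistC y x) ler_norml => ? ?.
  by apply/andP; split; lra.
set m := size xs; set s := atoms K v r m.
have small_atoms A : A \in s -> small edist h A.
  move=> As x y Ax Ay; have [z zxs zx] := xsP x (atoms_sub As Ax).
  have im : (index z xs < m)%N by rewrite index_mem.
  have := atoms_side As Ax Ay im; rewrite /v /r nth_index // zx => /esym zy.
  have := edist_triangle z x y; rewrite (edistC x z); lra.
apply: (@le_trans _ _ (\sum_(A <- s) nu_mesh d g k h A)).
  rewrite (big_nth set0) big_mkord; apply: nu_mesh_bigcup_ord => // x Kx.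
  have [A As Ax] := atoms_cover v r m Kx.
  by exists (index A s); rewrite ?index_mem // nth_index.
apply: (@le_trans _ _ (\sum_(A <- s) c%:E * hausdorff d k (g @` A))).
  rewrite big_seq [leRHS]big_seq; apply: lee_sum => A As.
  by apply: nu_mesh_le_hausdorff => //; [exact: small_atoms|exact: atoms_sub As].
rewrite -ge0_sume_distrr; last by move=> A _; exact: hausdorff_ge0.
apply: lee_wpmul2l; first by rewrite lee_fin.
rewrite -(integral_image_count md k gL r vL cK).
have mN : measurable_fun [set: M] (image_count g K v r m : M -> \bar R).
  exact: (image_count_measurable md gL r vL cK m).
apply: (@ge0_le_integral _ M R (@Hmeasure R T d k) [set: M] measurableT
  (image_count g K v r m) (multiplicity K g) _ mN multiplicity_measurable).
  by move=> y _; exact: image_count_ge0.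
by move=> y _; exact: image_count_le.
Qed.

End area_comparison.

(** * Pushing a map along geodesics *)

Section transfer.
Local Open Scope ereal_scope.
Context {R : realType} {T : Type} (d : T -> T -> R).

(* A set of image size delta, stretched by B in the single direction tau of width w, is
   cut into about B * w / delta pieces of image size 2 * delta. *)
Lemma nu_mesh_subdivide n (g : 'rV[R]_n -> T) k (h delta B a w : R) (A : set 'rV[R]_n)
    (tau : 'rV[R]_n -> R) :
  (0 < k)%N -> (0 < delta)%R -> (0 <= B)%R -> (0 <= w)%R -> small edist h A ->
  (forall x, A x -> (a <= tau x <= a + w)%R) ->
  (forall x y, A x -> A y -> (d (g x) (g y) <= delta + B * `|tau x - tau y|)%R) ->
  nu_mesh d g k h A <= ((B * w / delta + 1) * (2 * delta) ^+ k)%:E.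
Proof.
move=> k0 d0 B0 w0 Ah tauA gA.
pose idx x := Num.trunc ((tau x - a) * B / delta)%R.
pose J := (Num.trunc (B * w / delta)%R).+1.
have arg0 x : A x -> (0 <= (tau x - a) * B / delta)%R.
  move=> /tauA /andP[ax _].
  by rewrite mulr_ge0 ?invr_ge0 ?(ltW d0) // mulr_ge0 // subr_ge0.
have Bw0 : (0 <= B * w / delta)%R.
  by rewrite mulr_ge0 ?invr_ge0 ?(ltW d0) // mulr_ge0.
apply: (@le_trans _ _ (\sum_(j < J) nu_mesh d g k h (A `&` [set x | idx x = j]))).
  apply: (@nu_mesh_bigcup_ord _ _ _ _ _ _ _ J (fun j => A `&` [set x | idx x = j])) => //.
  move=> x Ax; exists (idx x) => //.
  rewrite ltnS; apply: Num.Theory.le_truncn.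
  rewrite ler_pM2r ?invr_gt0 // mulrC ler_wpM2l //.
  by have /andP[_] := tauA x Ax; rewrite lerBlDr addrC.
apply: (@le_trans _ _ (\sum_(j < J) ((2 * delta) ^+ k)%:E)).
  apply: lee_sum => j _; apply: nu_mesh_small => //.
  - by rewrite mulr_ge0 // ltW.
  - by move=> x y [Ax _] [Ay _]; exact: Ah.
  - move=> x y [Ax /= xj] [Ay /= yj]; apply: le_trans (gA _ _ Ax Ay) _.
    rewrite mulrDl mul1r lerD2l.
    have /andP[x1 x2] := Num.Theory.truncn_itv (arg0 _ Ax).
    have /andP[y1 y2] := Num.Theory.truncn_itv (arg0 _ Ay).
    rewrite -/(idx x) -/(idx y) in x1 x2 y1 y2.
    have xy : (`|(tau x - a) * B / delta - (tau y - a) * B / delta| <= 1)%R.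
      rewrite xj in x1 x2; rewrite yj in y1 y2.
      rewrite ler_norml; apply/andP; split.
        by move: x1 y2; rewrite -natr1; lra.
      by move: x2 y1; rewrite -natr1; lra.
    move: xy; have -> : ((tau x - a) * B / delta - (tau y - a) * B / delta =
      (B * (tau x - tau y)) / delta)%R by ring.
    rewrite normrM normrM (ger0_norm B0) normfV (gtr0_norm d0).
    by rewrite ler_pdivrMr // mul1r.
rewrite sumEFin lee_fin sumr_const card_ord -[leLHS]mulr_natl.
rewrite ler_wpM2r ?exprn_ge0 ?mulr_ge0 ?(ltW d0) //.
by rewrite -natr1 lerD2r; have /andP[] := Num.Theory.truncn_itv Bw0.
Qed.

(** Reduces an estimate of [nu] to one small set at a time. The error [e] absorbs terms of lower
    order and vanishes in the limit because the total [b] is finite; the change of exponent from [k]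
    to [k'] serves the shell. *)
Lemma nu_transfer n m (f : 'rV[R]_n -> T) (g : 'rV[R]_m -> T) (phi : 'rV[R]_m -> 'rV[R]_n)
    (E : set 'rV[R]_n) (E' : set 'rV[R]_m) (k k' : nat) (L b C : R) :
  (0 < k)%N -> (0 <= C)%R ->
  (forall x y, E x -> E y -> (d (f x) (f y) <= L * edist x y)%R) ->
  (forall x, E' x -> E (phi x)) ->
  (forall h e : R, (0 < h)%R -> (0 < e)%R -> exists h' r0 : R,
    [/\ (0 < h')%R, (0 < r0)%R & forall F (r : R), F `<=` E -> small edist h' F ->
      (0 < r <= r0)%R -> image_diam_le d f F r ->
      nu_mesh d g k' h (E' `&` phi @^-1` F) <= ((C + e) * r ^+ k)%:E]) ->
  nu d f k E <= b%:E -> nu d g k' E' <= (C * b)%:E.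
Proof.
move=> k0 C0 fL phiE H fb; apply: nu_le => h h0.
have b0 : (0 <= b)%R by rewrite -lee_fin; exact: le_trans (nu_ge0 _ _ _ _) fb.
have key e : (0 < e)%R -> nu_mesh d g k' h E' <= ((C + e) * (b + e))%:E.
  move=> e0; have [h' [r0 [h'0 r00 HF]]] := H h e h0 e0.
  pose h1 := Num.min h' (r0 / (`|L| + 1))%R.
  have L0 : (0 < `|L| + 1)%R by rewrite ltr_wpDl.
  have h10 : (0 < h1)%R by rewrite lt_min h'0 divr_gt0.
  have fr x y : E x -> E y -> (edist x y <= h1)%R -> (d (f x) (f y) <= r0)%R.
    move=> Ex Ey; rewrite le_min => /andP[_].
    rewrite ler_pdivlMr // => xy; apply: le_trans (fL _ _ Ex Ey) _.
    apply: le_trans xy; rewrite mulrC ler_wpM2l ?edist_ge0 //.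
    by rewrite (le_trans (ler_norm L)) // lerDl.
  have flt : nu d f k E < (b + e)%:E by apply: le_lt_trans fb _; rewrite lte_fin ltrDl.
  have [F [r [FP EF Sr]]] := nu_cover_exists k0 h10 r00 fr flt.
  apply: (@le_trans _ _ (\sum_(i <oo) nu_mesh d g k' h (E' `&` phi @^-1` (F i)))).
    apply: nu_mesh_cover => x E'x; have [i _ Fx] := EF _ (phiE _ E'x).
    by exists i.
  apply: (@le_trans _ _ (\sum_(i <oo) (C + e)%:E * (r i ^+ k)%:E)).
    apply: lee_nneseries => [i _ _|i _]; first exact: nu_mesh_ge0.
    case: (FP i) => Fh FE ri Fr; rewrite -EFinM; apply: HF => //.
    by move=> x y Fx Fy; apply: le_trans (Fh x y Fx Fy) _; rewrite ge_min lexx.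
  rewrite nneseriesZl; last first.
    by move=> i _; case: (FP i) => _ _ /andP[ri _] _; rewrite lee_fin exprn_ge0 // ltW.
  rewrite EFinM; apply: lee_wpmul2l => //.
  by rewrite lee_fin addr_ge0 // ltW.
apply/lee_addgt0Pr => e e0.
(* Chosen so that [(C + e1) * (b + e1)] exceeds [C * b] by at most [e1 * (C + b + 1) <= e]. *)
pose e1 := Num.min 1%R (e / (C + b + 1))%R.
have s0 : (0 < C + b + 1)%R by rewrite ltr_wpDl // addr_ge0.
have e10 : (0 < e1)%R by rewrite lt_min ltr01 divr_gt0.
apply: le_trans (key _ e10) _; rewrite -EFinD lee_fin.
have e11 : (e1 <= 1)%R by rewrite ge_min lexx.
have e1e : (e1 * (C + b + 1) <= e)%R by rewrite -ler_pdivlMr // ge_min lexx orbT.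
nra.
Qed.

(** Compactness needs only finitely many pieces of size [h'], so a null bound on each small piece is
    enough. *)
Lemma nu_locally0 n (g : 'rV[R]_n -> T) k (S E : set 'rV[R]_n) : (0 < k)%N ->
  ball_compact S -> E `<=` S ->
  (forall h : R, (0 < h)%R -> exists2 h' : R, (0 < h')%R & forall F, F `<=` E -> small edist h' F ->
     nu_mesh d g k h F <= 0) ->
  nu d g k E = 0.
Proof.
move=> k0 cS ES H; apply/eqP; rewrite eq_le nu_ge0 andbT.
apply: nu_le => h h0; have [h' h'0 HF] := H h h0.
have [_ _|xs xsS xsP] := cS (fun=> h' / 2)%R; first by rewrite divr_gt0.
apply: (@le_trans _ _ (\sum_(i < size xs)
    nu_mesh d g k h (E `&` [set y | (edist (nth 0%R xs i) y < h' / 2)%R]))).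
  apply: (@nu_mesh_bigcup_ord _ _ _ _ _ _ _ (size xs)
    (fun i => E `&` [set y | (edist (nth 0%R xs i) y < h' / 2)%R])) => // y Ey.
  have [x xxs xy] := xsP y (ES _ Ey).
  by exists (index x xs); rewrite ?index_mem // nth_index.
apply: sume_le0 => i _; apply: HF => [x []//|x y [_ /= x1] [_ /= y1]].
have := edist_triangle (nth 0%R xs i) x y; rewrite (edistC x (nth _ _ _)); lra.
Qed.

End transfer.

Section move.
Context {R : realType} {T : Type} (d : T -> T -> R) (G : T -> T -> R -> T) {n : nat}.
Hypothesis md : is_metric d.
Hypothesis cG : conical d G.
Local Notation V := 'rV[R]_n.

Definition move (f P : V -> T) (lam : V -> R) (t : R) (y : V) : T :=
  G (f y) (P y) (t * lam y).

Lemma conical_lipschitz (x y q : T) (s t : R) : 0 <= s <= 1 -> 0 <= t <= 1 ->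
  d (G x q s) (G y q t) <= d x y + `|s - t| * d x q.
Proof.
case: md => d0 _ dC dtri; case: cG => _ _ G1 G2 s01 t01.
apply: le_trans (dtri _ (G x q t) _) _; rewrite addrC; apply: lerD; last by rewrite G1.
apply: le_trans (G2 _ _ _ _ t01) _; rewrite ler_piMl // gerBl.
by case/andP: t01.
Qed.

Variables (S : set V) (f P : V -> T) (lam : V -> R) (L Llam kap0 : R).
Hypothesis fL : forall x y, S x -> S y -> d (f x) (f y) <= L * edist x y.
Hypothesis lam01 : forall x, S x -> 0 <= lam x <= 1.
Hypothesis lamL : forall x y, S x -> S y -> `|lam x - lam y| <= Llam * edist x y.
Hypothesis kap00 : 0 < kap0.
(* The target P is locally constant where lam does not vanish; elsewhere it is irrelevant. *)
Hypothesis PC : forall x y, S x -> S y -> edist x y < kap0 ->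
  [\/ P x = P y, lam x = 0 | lam y = 0].

Lemma move_local (D s t : R) x y : S x -> S y -> edist x y < kap0 ->
  0 <= s <= 1 -> 0 <= t <= 1 ->
  (lam x != 0 -> d (f x) (P x) <= D) -> (lam y != 0 -> d (f y) (P y) <= D) ->
  d (move f P lam s x) (move f P lam t y) <=
  d (f x) (f y) + D * `|s * lam x - t * lam y|.
Proof.
case: md => d0 d00 dC dtri; case: (cG) => G0 _ _ _.
move=> Sx Sy xy s01 t01 Dx Dy.
have m01 r z : S z -> 0 <= r <= 1 -> 0 <= r * lam z <= 1.
  move=> /lam01 /andP[z0 z1] /andP[r0 r1].
  by rewrite mulr_ge0 //= mulr_ile1.
have sx := m01 _ _ Sx s01; have ty := m01 _ _ Sy t01.
have one z w q r r' : 0 <= r <= 1 -> 0 <= r' <= 1 -> d z q <= D ->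
    d (G z q r) (G w q r') <= d z w + D * `|r - r'|.
  move=> r01 r'01 zq; apply: le_trans (conical_lipschitz _ _ _ r01 r'01) _.
  by rewrite lerD2l mulrC ler_wpM2r.
have two z w q r r' : 0 <= r <= 1 -> 0 <= r' <= 1 -> d w q <= D ->
    d (G z q r) (G w q r') <= d z w + D * `|r - r'|.
  by move=> r01 r'01 wq; rewrite dC (dC z) distrC; exact: one.
rewrite /move.
(* A point at which [lam] vanishes does not move, so its target may be replaced by that of the other
   point. *)
have [lx|lx] := eqVneq (lam x) 0; have [ly|ly] := eqVneq (lam y) 0.
- by rewrite lx ly !mulr0 !G0 subrr normr0 mulr0 addr0.
- rewrite lx mulr0 G0 -(G0 (f x) (P y)); have := two (f x) (f y) (P y) 0 (t * lam y).
  by rewrite !G0; apply => //; [rewrite lexx ler01|exact: Dy].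
- rewrite ly mulr0 G0 -(G0 (f y) (P x)); have := one (f x) (f y) (P x) (s * lam x) 0.
  by rewrite !G0; apply => //; [rewrite lexx ler01|exact: Dx].
case: (PC Sx Sy xy) => [Pxy|/eqP|/eqP]; [|by rewrite (negbTE lx)|by rewrite (negbTE ly)].
by rewrite -Pxy; apply: one => //; exact: Dx.
Qed.

Variable D0 : R.
Hypothesis D00 : 0 <= D0.
Hypothesis fD0 : forall x, S x -> lam x != 0 -> d (f x) (P x) <= D0.

Lemma move_dist (t : R) x : S x -> 0 <= t <= 1 -> d (f x) (move f P lam t x) <= D0.
Proof.
case: md => d0 d00 dC dtri; case: (cG) => G0 _ G1 _ Sx /andP[t0 t1].
have /andP[l0 l1] := lam01 Sx; rewrite /move.
have [->|lx] := eqVneq (lam x) 0; first by rewrite mulr0 G0 (d00 _ _).2.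
have -> : d (f x) (G (f x) (P x) (t * lam x)) = t * lam x * d (f x) (P x).
  rewrite -{1}(G0 (f x) (P x)) G1 ?lexx ?ler01 //; last by rewrite mulr_ge0 //= mulr_ile1.
  by rewrite sub0r normrN ger0_norm // mulr_ge0.
apply: (@le_trans _ _ (d (f x) (P x))); last exact: fD0.
by rewrite ler_piMl // mulr_ile1.
Qed.

(** Points closer than [kap0] can be compared through a common target; for the others twice the
    displacement, [2 * D0], is at most [2 * D0 / kap0] times their distance. *)
Lemma move_lipschitz : exists2 L' : R, 0 <= L' & forall s t x y,
  S x -> S y -> 0 <= s <= 1 -> 0 <= t <= 1 ->
  d (move f P lam s x) (move f P lam t y) <= L' * (edist x y + `|s - t|).
Proof.
case: (md) => d0 d00 dC dtri.
exists (`|L| + D0 * `|Llam| + D0 + 2 * D0 / kap0).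
  by rewrite !addr_ge0 ?mulr_ge0 ?invr_ge0 // ltW.
move=> s t x y Sx Sy s01 t01.
have e0 := edist_ge0 x y.
have st0 := normr_ge0 (s - t).
have Le : L * edist x y <= `|L| * edist x y by rewrite ler_wpM2r // ler_norm.
have fxy := fL Sx Sy.
have DL0 : 0 <= D0 * `|Llam| by rewrite mulr_ge0.
have Dk0 : 0 <= 2 * D0 / kap0 by rewrite !mulr_ge0 ?invr_ge0 // ltW.
have Lx0 := normr_ge0 L.
have [xy|xy] := ltP (edist x y) kap0.
  apply: le_trans (move_local Sx Sy xy s01 t01 (fD0 Sx) (fD0 Sy)) _.
  have /andP[lx0 lx1] := lam01 Sx.
  have : `|s * lam x - t * lam y| <= `|s - t| + `|Llam| * edist x y.
    have -> : s * lam x - t * lam y = (s - t) * lam x + t * (lam x - lam y) by ring.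
    apply: le_trans (ler_normD _ _) _; rewrite !normrM; apply: lerD.
      by rewrite ler_piMr // ger0_norm.
    case/andP: t01 => t0 t1; apply: (@le_trans _ _ `|lam x - lam y|).
      by rewrite ler_piMl // ger0_norm.
    by apply: le_trans (lamL Sx Sy) _; rewrite ler_wpM2r // ler_norm.
  move=> H; have : D0 * `|s * lam x - t * lam y| <= D0 * (`|s - t| + `|Llam| * edist x y).
    by rewrite ler_wpM2l.
  have : 0 <= (`|L| + D0 * `|Llam| + 2 * D0 / kap0) * `|s - t| by rewrite mulr_ge0 // !addr_ge0.
  have : 0 <= (D0 + 2 * D0 / kap0) * edist x y by rewrite mulr_ge0 // addr_ge0.
  nra.
apply: le_trans (dtri _ (f x) _) _; rewrite (dC _ (f x)).
apply: le_trans (lerD (move_dist Sx s01) (dtri _ (f y) _)) _.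
have := move_dist Sy t01.
have : 2 * D0 <= 2 * D0 / kap0 * edist x y.
  by rewrite mulrAC ler_pdivlMr // ler_wpM2l // mulr_ge0.
have : 0 <= (`|L| + D0 * `|Llam| + D0 + 2 * D0 / kap0) * `|s - t|.
  by rewrite mulr_ge0 // !addr_ge0.
have : 0 <= (D0 * `|Llam| + D0) * edist x y by rewrite mulr_ge0 // addr_ge0.
nra.
Qed.

(** On a set of image diameter [r] the parameter [lam] stays in an interval of width [2 * kap * r].
    About [2 * kap * D + 1] pieces then have moved images of diameter at most [2 * r], whence also
    the factor [2 ^+ k]. *)
Lemma nu_move k (E : set V) (kap D b : R) : (0 < k)%N -> E `<=` S -> 0 <= kap -> 0 <= D ->
  (forall x, E x -> lam x != 0 -> d (f x) (P x) <= D) ->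
  (forall x y, E x -> E y -> `|lam x - lam y| <= kap * d (f x) (f y)) ->
  (nu d f k E <= b%:E)%E ->
  (nu d (move f P lam 1) k E <= (2 ^+ k * (2 * kap * D + 1) * b)%:E)%E.
Proof.
move=> k0 ES kap_0 D_0 ED Elam.
apply: (@nu_transfer _ _ _ _ _ _ _ id E E k k L b) => //.
- by rewrite mulr_ge0 ?exprn_ge0 // addr_ge0 // !mulr_ge0.
- by move=> x y Ex Ey; apply: fL; exact: ES.
move=> h e h0 e0; pose h' := Num.min h (kap0 / 2).
have h'0 : 0 < h' by rewrite lt_min h0 divr_gt0.
exists h', 1; split => // F r FE Fh /andP[r0 _] Fr.
have -> : E `&` id @^-1` F = F by apply/seteqP; split => [x []//|x Fx]; split => //; exact: FE.
have [->|/set0P[x0 Fx0]] := eqVneq F set0.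
  by rewrite nu_mesh0 // lee_fin mulr_ge0 // ?exprn_ge0 ?(ltW r0) // addr_ge0 ?(ltW e0) //
    mulr_ge0 ?exprn_ge0 // addr_ge0 // !mulr_ge0.
apply: (@le_trans _ _ ((D * (2 * kap * r) / r + 1) * (2 * r) ^+ k)%:E).
  apply: (@nu_mesh_subdivide _ _ _ _ _ _ _ _ _ (lam x0 - kap * r) _ _ lam) => //.
  - by rewrite !mulr_ge0 // ltW.
  - by move=> x y Fx Fy; apply: le_trans (Fh x y Fx Fy) _; rewrite ge_min lexx.
  - move=> x Fx; have := Elam _ _ (FE _ Fx) (FE _ Fx0).
    have : kap * d (f x) (f x0) <= kap * r by rewrite ler_wpM2l //; exact: Fr.
    by rewrite ler_norml => ? /andP[? ?]; apply/andP; split; lra.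
  - move=> x y Fx Fy; rewrite -[in leRHS](mul1r (lam x)) -[in leRHS](mul1r (lam y)).
    have xy : edist x y < kap0.
      apply: le_lt_trans (Fh x y Fx Fy) _; rewrite gt_min (_ : kap0 / 2 < kap0) ?orbT //.
      by rewrite ltr_pdivrMr // mulr_natr mulr2n ltrDr.
    have i1 : 0 <= (1 : R) <= 1 by rewrite lexx ler01.
    have Ex := FE _ Fx; have Ey := FE _ Fy.
    apply: le_trans (move_local (ES _ Ex) (ES _ Ey) xy i1 i1 (ED _ Ex) (ED _ Ey)) _.
    by rewrite lerD2r; exact: Fr.
rewrite lee_fin exprMn.
have -> : D * (2 * kap * r) / r = 2 * kap * D by field; rewrite gt_eqF.
rewrite mulrA; apply: ler_wpM2r; first by rewrite exprn_ge0 // ltW.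
by rewrite mulrC lerDl ltW.
Qed.

(** A small set has a single image point and is spread along one geodesic. About [D0 / r] pieces of
    size [2 * r] cost a multiple of [r ^+ (k - 1)], with [r] as small as desired. *)
Lemma nu_move_const k (E : set V) : (1 < k)%N -> ball_compact S -> E `<=` S ->
  (forall x y, E x -> E y -> edist x y < kap0 -> f x = f y) ->
  (nu d (move f P lam 1) k E = 0)%E.
Proof.
move=> k1 cS ES Ef; have k0 : (0 < k)%N by exact: ltnW.
apply: (@nu_locally0 _ _ _ _ _ _ S) => // h h0.
pose h' := Num.min h (kap0 / 2).
exists h'; first by rewrite lt_min h0 divr_gt0.
move=> F FE Fh; apply/lee_addgt0Pr => e e0; rewrite add0e.
pose r := Num.min 1 (e / (4 ^+ k * (D0 + 1))).
have c0 : 0 < 4 ^+ k * (D0 + 1) :> R by rewrite mulr_gt0 ?exprn_gt0 // ltr_wpDl.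
have r0 : 0 < r by rewrite lt_min ltr01 divr_gt0.
have r1 : r <= 1 by rewrite ge_min lexx.
apply: (@le_trans _ _ ((D0 * 1 / r + 1) * (2 * r) ^+ k)%:E).
  apply: (@nu_mesh_subdivide _ _ _ _ _ _ _ _ _ 0 _ _ lam) => //.
  - by move=> x y Fx Fy; apply: le_trans (Fh x y Fx Fy) _; rewrite ge_min lexx.
  - by move=> x Fx; rewrite add0r lam01 //; exact: ES (FE _ Fx).
  - move=> x y Fx Fy; rewrite -[in leRHS](mul1r (lam x)) -[in leRHS](mul1r (lam y)).
    have xy : edist x y < kap0.
      apply: le_lt_trans (Fh x y Fx Fy) _; rewrite gt_min (_ : kap0 / 2 < kap0) ?orbT //.
      by rewrite ltr_pdivrMr // mulr_natr mulr2n ltrDr.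
    have i1 : 0 <= (1 : R) <= 1 by rewrite lexx ler01.
    have Sx := ES _ (FE _ Fx); have Sy := ES _ (FE _ Fy).
    apply: le_trans (move_local Sx Sy xy i1 i1 (fD0 Sx) (fD0 Sy)) _.
    rewrite lerD2r (Ef _ _ (FE _ Fx) (FE _ Fy) xy).
    by case: md => _ d00 _ _; rewrite (d00 _ _).2 // ltW.
rewrite lee_fin mulr1 exprMn.
case: k k1 k0 @r c0 r0 r1 => [//|k] k1 _ r c0 r0 r1; rewrite exprS.
have : r * (4 ^+ k.+1 * (D0 + 1)) <= e by rewrite -ler_pdivlMr // ge_min lexx orbT.
apply: le_trans.
have -> : (D0 / r + 1) * (2 * 2 ^+ k * r ^+ k.+1) = (D0 + r) * (2 ^+ k.+1 * r ^+ k).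
  by rewrite !exprS; field; rewrite gt_eqF.
have rk : r ^+ k <= r.
  by rewrite -[leRHS]expr1; apply: ler_wiXn2l => //; exact: ltW.
have p2 : (2 : R) ^+ k.+1 <= 4 ^+ k.+1 by apply: lerXn2r; rewrite ?nnegrE //; lra.
have -> : r * (4 ^+ k.+1 * (D0 + 1)) = (D0 + 1) * (4 ^+ k.+1 * r) by ring.
apply: ler_pM.
- by rewrite addr_ge0 // ltW.
- by rewrite mulr_ge0 ?exprn_ge0 // ltW.
- by rewrite lerD2l.
- by apply: ler_pM => //; rewrite ?exprn_ge0 // ltW.
Qed.

End move.

(** * Extending a homotopy over a shell *)

Section shell.
Context {R : realType} {T : pointedType} (d : T -> T -> R) (G : T -> T -> R -> T).
Hypothesis md : is_metric d.
Hypothesis cG : conical d G.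
Local Notation V := 'rV[R]_3.

(* The homotopy [move] from time 0 to time 1 is run inwards on the shell 1/2 <= |x| <= 1;
   a rescaled filling of its end map occupies the ball |x| <= 1/2. *)
Definition shell : set V := [set x | 2^-1 <= edist x 0 <= 1].

Definition shell_time (x : V) : R := 2 * (1 - edist x 0).

Lemma shell_time01 x : shell x -> 0 <= shell_time x <= 1.
Proof. by rewrite /shell /shell_time /= => /andP[? ?]; apply/andP; split; lra. Qed.

Lemma shell_sphere x : shell x -> sphere2 (unit_dir x).
Proof.
rewrite /shell /= => /andP[x2 _]; apply/sphere2E/enorm_unit_dir.
by rewrite gt_eqF // (lt_le_trans _ x2).
Qed.

Definition shell_move (f P : V -> T) (lam : V -> R) (x : V) : T :=
  move G f P lam (shell_time x) (unit_dir x).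

Section moving.
Variables (f P : V -> T) (lam : V -> R) (L Llam kap0 : R).
Hypothesis fL : forall x y, sphere2 x -> sphere2 y -> d (f x) (f y) <= L * edist x y.
Hypothesis lam01 : forall x, sphere2 x -> 0 <= lam x <= 1.
Hypothesis lamL : forall x y, sphere2 x -> sphere2 y -> `|lam x - lam y| <= Llam * edist x y.
Hypothesis kap00 : 0 < kap0.
Hypothesis PC : forall x y, sphere2 x -> sphere2 y -> edist x y < kap0 ->
  [\/ P x = P y, lam x = 0 | lam y = 0].

(** A set of image diameter [r] sweeps out a tube. Each of [N] time layers splits into about
    [2 * D / (N * r) + 1] pieces of size [2 * r], for a total of [16 * D * r ^+ 2 + 8 * N * r ^+ 3];
    thus 16 is [2 * 2 ^+ 3]. *)
Lemma nu_shell_move (E : set V) (D b : R) : E `<=` sphere2 -> 0 <= D ->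
  (forall x, E x -> lam x != 0 -> d (f x) (P x) <= D) ->
  (nu d f 2 E <= b%:E)%E ->
  (nu d (shell_move f P lam) 3 [set x | shell x /\ E (unit_dir x)] <= (16 * D * b)%:E)%E.
Proof.
move=> ES D_0 ED.
apply: (@nu_transfer _ _ _ _ _ _ _ (@unit_dir R 3) E _ 2 3 L b) => //.
- by rewrite mulr_ge0.
- by move=> x y Ex Ey; apply: fL; exact: ES.
- by move=> x [].
move=> h e h0 e0.
pose N := (Num.bound h^-1).+1; pose iN : R := N%:R^-1.
have N0 : 0 < N%:R :> R by rewrite ltr0n.
have iN0 : 0 < iN by rewrite invr_gt0.
have iNh : iN <= h.
  rewrite -[leRHS]invrK lef_pV2 ?posrE ?invr_gt0 //.
  apply: ltW; apply: lt_trans (archi_boundP _) _; last by rewrite ltr_nat.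
  by rewrite invr_ge0 ltW.
have NiN : N%:R * iN = 1 by rewrite mulfV // gt_eqF.
have Ll0 : 0 < 2 * (`|Llam| + 1) by rewrite mulr_gt0 // ltr_wpDl.
(* The three bounds leave half of the mesh to the radial direction, keep pairs within [kap0], and
   let [lam] vary by at most [iN / 2]. *)
pose h' := Num.min (h / 2) (Num.min (kap0 / 2) (iN / (2 * (`|Llam| + 1)))).
have h'0 : 0 < h' by rewrite !lt_min !divr_gt0.
have h'h : h' <= h / 2 by rewrite ge_min lexx.
have h'k : h' < kap0.
  apply: (@le_lt_trans _ _ (kap0 / 2)); first by rewrite !ge_min lexx !orbT.
  by rewrite ltr_pdivrMr // mulr_natr mulr2n ltrDr.
have h'l : `|Llam| * h' <= iN / 2.
  have : h' <= iN / (2 * (`|Llam| + 1)) by rewrite !ge_min lexx !orbT.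
  rewrite ler_pdivlMr // => H.
  have : 0 <= h' by exact: ltW.
  lra.
(* Under this cap the term [8 * N * r ^+ 3] is at most [e * r ^+ 2]. *)
pose r0 := e / (8 * N%:R).
exists h', r0; split => //; first by rewrite divr_gt0 // mulr_gt0.
move=> F r FE Fh /andP[rp rr0] Fr.
have [->|/set0P[x0 Fx0]] := eqVneq F set0.
  rewrite preimage_set0 setI0 nu_mesh0 // lee_fin mulr_ge0 // ?exprn_ge0 ?(ltW rp) //.
  by rewrite addr_ge0 ?(ltW e0) // mulr_ge0.
set Q := _ `&` _.
pose A (i : nat) := Q `&` [set x | i%:R * iN <= shell_time x <= i.+1%:R * iN].
apply: (@le_trans _ _ (\sum_(i < N) nu_mesh d (shell_move f P lam) 3 h (A i))%E).
  apply: nu_mesh_bigcup_ord => // x Qx.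
  have /andP[t0 t1] : 0 <= shell_time x <= 1 by case: Qx => -[/shell_time01].
  have tN0 : 0 <= shell_time x * N%:R by rewrite mulr_ge0.
  have [tN|tN] := ltP (shell_time x * N%:R) N%:R.
    have /andP[k1 k2] := Num.Theory.truncn_itv tN0.
    exists (Num.trunc (shell_time x * N%:R)).
      by rewrite -(ltr_nat R) (le_lt_trans k1).
    by split => //=; rewrite /iN ler_pdivrMr // ler_pdivlMr // k1 ltW.
  exists N.-1 => //; split => //=.
  have -> : shell_time x = 1.
    by apply/eqP; rewrite eq_le t1 -(ler_pM2r N0) mul1r.
  rewrite NiN lexx andbT; apply: (@le_trans _ _ (N%:R * iN)); last by rewrite NiN.
  by rewrite ler_wpM2r ?(ltW iN0) // ler_nat.
apply: (@le_trans _ _ (\sum_(i < N) ((D * (2 * iN) / r + 1) * (2 * r) ^+ 3)%:E)%E).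
  apply: lee_sum => i _.
  have Asub x : A i x -> [/\ shell x, E (unit_dir x), F (unit_dir x) &
      i%:R * iN <= shell_time x <= i.+1%:R * iN].
    by move=> [[[? ?] ?] ?].
  apply: (@nu_mesh_subdivide _ _ _ _ _ _ _ _ _ (i%:R * iN * lam x0 - iN / 2) _ _
    (fun x => shell_time x * lam (unit_dir x))) => //.
  - by rewrite mulr_ge0 // ltW.
  - move=> x y /Asub[Sx Ex Fx tx] /Asub[Sy Ey Fy ty].
    have /andP[x2 x1] := Sx; have /andP[y2 y1] := Sy.
    have xp : edist x 0 != 0 by rewrite gt_eqF // (lt_le_trans _ x2).
    have yp : edist y 0 != 0 by rewrite gt_eqF // (lt_le_trans _ y2).
    apply: le_trans (edist_polar x1 xp yp) _.
    have : edist (unit_dir x) (unit_dir y) <= h / 2 by apply: le_trans h'h; exact: Fh.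
    suff : `|edist x 0 - edist y 0| <= h / 2 by lra.
    move: tx ty; rewrite /shell_time -[i.+1%:R]natr1 mulrDl mul1r => /andP[? ?] /andP[? ?].
    by rewrite ler_norml; apply/andP; split; lra.
  - move=> x /Asub[Sx Ex Fx /andP[tx tx']].
    have /andP[t0 t1] := shell_time01 Sx.
    have /andP[l0 l1] := lam01 (ES _ (FE _ Fx0)).
    have lx : `|lam (unit_dir x) - lam x0| <= iN / 2.
      apply: le_trans (lamL (ES _ Ex) (ES _ (FE _ Fx0))) _; apply: le_trans h'l.
      apply: (@le_trans _ _ (`|Llam| * edist (unit_dir x) x0)).
        by rewrite ler_wpM2r ?edist_ge0 // ler_norm.
      by rewrite ler_wpM2l //; exact: Fh.
    have tl : `|shell_time x * (lam (unit_dir x) - lam x0)| <= iN / 2.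
      by rewrite normrM ger0_norm // (le_trans _ lx) // ler_piMl.
    have tE : shell_time x * lam (unit_dir x) =
      shell_time x * lam x0 + shell_time x * (lam (unit_dir x) - lam x0) by ring.
    have t1l : i%:R * iN * lam x0 <= shell_time x * lam x0 by rewrite ler_wpM2r.
    have t2l : shell_time x * lam x0 <= (i%:R * iN + iN) * lam x0.
      by rewrite ler_wpM2r // (le_trans tx') // -[i.+1%:R]natr1 mulrDl mul1r.
    have iNl : iN * lam x0 <= iN by rewrite ler_piMr // ltW.
    move: tl; rewrite tE ler_norml => /andP[? ?]; apply/andP; split; lra.
  - move=> x y /Asub[Sx Ex Fx _] /Asub[Sy Ey Fy _].
    have xy : edist (unit_dir x) (unit_dir y) < kap0.
      by apply: le_lt_trans h'k; exact: Fh.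
    apply: le_trans (move_local md cG lam01 PC (ES _ Ex) (ES _ Ey) xy
      (shell_time01 Sx) (shell_time01 Sy) (ED _ Ex) (ED _ Ey)) _.
    by rewrite lerD2r; exact: Fr.
rewrite sumEFin lee_fin sumr_const card_ord -[leLHS]mulr_natl.
have -> : N%:R * ((D * (2 * iN) / r + 1) * (2 * r) ^+ 3) =
    16 * D * r ^+ 2 * (N%:R * iN) + 8 * N%:R * r * r ^+ 2.
  by field; rewrite gt_eqF.
rewrite NiN mulr1 -mulrDl ler_wpM2r ?exprn_ge0 ?(ltW rp) // lerD2l.
by move: rr0; rewrite /r0 ler_pdivlMr ?mulr_gt0 // mulrC.
Qed.

(** No Lipschitz constant is recorded: it deteriorates with every move, and only the volume bound
    has to survive the iteration. *)
Definition fills (g : V -> T) (w : R) : Prop :=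
  exists gbar : V -> T,
    [/\ lipschitz_map_on d ball3 gbar, (forall x, sphere2 x -> gbar x = g x) &
        (nu d gbar 3 ball3 <= w%:E)%E].

(** The volume claim is conditional on finite area, so that the construction also yields a Lipschitz
    extension when the area is infinite. *)
Lemma extend_move (gbar : V -> T) (D0 : R) : 0 <= D0 ->
  (forall x, sphere2 x -> lam x != 0 -> d (f x) (P x) <= D0) ->
  lipschitz_map_on d ball3 gbar -> (forall x, sphere2 x -> gbar x = move G f P lam 1 x) ->
  exists fbar : V -> T,
    [/\ lipschitz_map_on d ball3 fbar, (forall x, sphere2 x -> fbar x = f x) &
      forall (E : set V) (D b c w : R), E `<=` sphere2 -> 0 <= D ->
        (forall x, E x -> lam x != 0 -> d (f x) (P x) <= D) ->
        (forall x, sphere2 x -> ~ E x -> lam x = 0) ->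
        (nu d f 2 E <= b%:E)%E -> (nu d f 2 sphere2 <= c%:E)%E ->
        (nu d gbar 3 ball3 <= w%:E)%E -> (nu d fbar 3 ball3 <= (w + 16 * D * b)%:E)%E].
Proof.
move=> D00 fD0 [Lg gbarL] gbarS.
case: (md) => d0 d00 dC dtri.
pose fbar x := if edist x 0 <= 2^-1 then gbar (2 *: x) else shell_move f P lam x.
have bar_shell x : shell x -> fbar x = shell_move f P lam x.
  move=> /andP[x2 x1]; rewrite /fbar; case: ifPn => // x2'.
  have xE : edist x 0 = 2^-1 by apply/eqP; rewrite eq_le x2 x2'.
  have -> : 2 *: x = unit_dir x by rewrite /unit_dir xE invrK.
  rewrite gbarS /shell_move; last by apply: shell_sphere; rewrite /shell /= x1 x2.
  by rewrite /shell_time xE; congr (move _ _ _ _ _ _); field.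
have n2 x : edist (2 *: x) 0 = 2 * edist x 0.
  by have := edistZ 2 x 0; rewrite scaler0 ger0_norm.
have [L' L'0 mL] := move_lipschitz md cG fL lam01 lamL kap00 PC D00 fD0.
have inL x y : edist x 0 <= 2^-1 -> edist y 0 <= 2^-1 ->
    d (fbar x) (fbar y) <= 2 * `|Lg| * edist x y.
  move=> x2 y2; rewrite /fbar x2 y2.
  apply: (@le_trans _ _ (Lg * edist (2 *: x) (2 *: y))).
    by apply: gbarL; apply/ball3E; rewrite n2; lra.
  rewrite edistZ ger0_norm // mulrA (mulrC Lg) ler_wpM2r ?edist_ge0 //.
  by rewrite ler_wpM2l // ler_norm.
have outL x y : shell x -> shell y -> d (fbar x) (fbar y) <= 6 * L' * edist x y.
  move=> Sx Sy; rewrite !bar_shell //.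
  apply: le_trans (mL _ _ _ _ (shell_sphere Sx) (shell_sphere Sy)
    (shell_time01 Sx) (shell_time01 Sy)) _.
  rewrite (mulrC 6) -mulrA; apply: ler_wpM2l => //.
  have /andP[x2 _] := Sx; have /andP[y2 _] := Sy.
  have := unit_dir_lipschitz x2 y2; have := enorm_lipschitz x y.
  have -> : shell_time x - shell_time y = 2 * (edist y 0 - edist x 0).
    by rewrite /shell_time; ring.
  by rewrite normrM ger0_norm // (distrC (edist y 0)); lra.
pose L'' := 2 * `|Lg| + 6 * L'.
have L''0 : 0 <= L'' by rewrite addr_ge0 ?mulr_ge0.
have inS x : edist x 0 <= 2^-1 \/ shell x \/ 1 < edist x 0.
  have [|x2] := leP (edist x 0) 2^-1; first by left.
  have [|x1] := leP (edist x 0) 1; last by right; right.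
  by move=> x1; right; left; rewrite /shell /= x1 ltW.
have mixL x y : edist x 0 <= 2^-1 -> shell y -> d (fbar x) (fbar y) <= 3 * L'' * edist x y.
  move=> x2 Sy; have /andP[y2 y1] := Sy.
  have y0 : edist y 0 != 0 by rewrite gt_eqF // (lt_le_trans _ y2).
  (* The ray of [y] crosses the interface at [z], which is no farther from [y] than [x] is. *)
  pose z : V := 2^-1 *: unit_dir y.
  have zn : edist z 0 = 2^-1.
    by have := edistZ 2^-1 (unit_dir y) 0; rewrite scaler0 enorm_unit_dir // mulr1 ger0_norm.
  have Sz : shell z by rewrite /shell /= zn lexx /=; lra.
  have yz : edist y z <= edist x y.
    rewrite -{1}(unit_dirK y0) /z edistZl enorm_unit_dir // mulr1 ger0_norm ?subr_ge0 //.
    by have := enorm_lipschitz x y; rewrite ler_norml => /andP[? ?]; lra.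
  have xz : edist x z <= 2 * edist x y.
    by have := edist_triangle y x z; lra.
  have e0 := edist_ge0 x y.
  apply: le_trans (dtri _ (fbar z) _) _.
  have h1 : d (fbar x) (fbar z) <= L'' * (2 * edist x y).
    apply: le_trans (inL _ _ x2 _) _; first by rewrite zn.
    by apply: ler_pM; rewrite ?mulr_ge0 ?edist_ge0 // /L'' lerDl mulr_ge0.
  have h2 : d (fbar z) (fbar y) <= L'' * edist x y.
    apply: le_trans (outL _ _ Sz Sy) _; rewrite edistC.
    by apply: ler_pM; rewrite ?mulr_ge0 ?edist_ge0 // /L'' lerDr mulr_ge0.
  by apply: le_trans (lerD h1 h2) _; rewrite -mulrDr; nra.
exists fbar; split.
- exists (3 * L'') => x y /ball3E x1 /ball3E y1.
  have e0 := edist_ge0 x y.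
  have Le : 0 <= L'' * edist x y by rewrite mulr_ge0.
  have Lg0 : 0 <= 2 * `|Lg| * edist x y by rewrite !mulr_ge0.
  have L'e0 : 0 <= 6 * L' * edist x y by rewrite !mulr_ge0.
  have [x2|[Sx|]] := inS x; last by rewrite ltNge x1.
    have [y2|[Sy|]] := inS y; last by rewrite ltNge y1.
      by apply: le_trans (inL _ _ x2 y2) _; rewrite /L''; lra.
    exact: mixL.
  have [y2|[Sy|]] := inS y; last by rewrite ltNge y1.
    by rewrite dC edistC; exact: mixL.
  by apply: le_trans (outL _ _ Sx Sy) _; rewrite /L''; lra.
- move=> x Sx; have x1 := (sphere2E x).1 Sx.
  rewrite bar_shell; last by rewrite /shell /= x1 lexx andbT; lra.
  rewrite /shell_move /shell_time /move x1 subrr mulr0 mul0r /unit_dir x1 invr1 scale1r.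
  by case: cG => ->.
move=> E D b c w ES D_0 ED nE fb fc gbarw.
have cov : @ball3 R `<=` [set x | edist x 0 <= 2^-1] `|`
    ([set x | shell x /\ E (unit_dir x)] `|` [set x | shell x /\ (sphere2 `\` E) (unit_dir x)]).
  move=> x /ball3E x1; have [|[Sx|]] := inS x; [by left| |by rewrite ltNge x1].
  right; have [Ex|nEx] := pselect (E (unit_dir x)); first by left.
  by right; split => //; split => //; exact: shell_sphere.
apply: le_trans (le_nu _ _ _ cov) _.
apply: le_trans (nu_setU _ _ _ _ _) _ => //.
rewrite EFinD; apply: leeD.
  apply: le_trans gbarw; apply: (@nu_reparam _ _ _ _ _ _ _ _ _ (fun x : V => 2 *: x)) => //.
  - by move=> x /= x2; apply/ball3E; rewrite n2; lra.
  - by move=> x y _ _; rewrite edistZ ger0_norm //; have := edist_ge0 x y; lra.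
  - by move=> x /= x2; rewrite /fbar x2.
apply: le_trans (nu_setU _ _ _ _ _) _ => //.
rewrite -[leRHS]adde0; apply: leeD.
  rewrite (eq_nu _ (g := shell_move f P lam)) //; last by move=> x [Sx _]; exact: bar_shell.
  exact: nu_shell_move.
rewrite (eq_nu _ (g := shell_move f P lam)) //; last by move=> x [Sx _]; exact: bar_shell.
have SE : sphere2 `\` E `<=` @sphere2 R by move=> x [].
have l0 x : (sphere2 `\` E) x -> lam x != 0 -> d (f x) (P x) <= 0.
  by move=> [Sx nEx]; rewrite (nE _ Sx nEx) eqxx.
(* Nothing moves outside [E]: displacement 0 against the finite area [c] gives volume 0. *)
have := nu_shell_move SE (lexx 0) l0 (le_trans (le_nu d f 2 SE) fc).
by rewrite mulr0 mul0r.
Qed.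

Lemma fills_move (E : set V) (D0 D b c w : R) : E `<=` sphere2 -> 0 <= D0 -> 0 <= D ->
  (forall x, sphere2 x -> lam x != 0 -> d (f x) (P x) <= D0) ->
  (forall x, E x -> lam x != 0 -> d (f x) (P x) <= D) ->
  (forall x, sphere2 x -> ~ E x -> lam x = 0) ->
  (nu d f 2 E <= b%:E)%E -> (nu d f 2 sphere2 <= c%:E)%E ->
  fills (move G f P lam 1) w -> fills f (w + 16 * D * b).
Proof.
move=> ES D00 D_0 fD0 ED nE fb fc [gbar [gbarL gbarS gbarw]].
have [fbar [fbarL fbarS fbarw]] := extend_move D00 fD0 gbarL gbarS.
by exists fbar; split => //; exact: fbarw ES D_0 ED nE fb fc gbarw.
Qed.

End moving.

Lemma fills_const (o : T) : fills (fun=> o) 0.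
Proof.
case: (md) => d0 d00 dC dtri.
exists (fun=> o); split => //.
  by exists 0 => x y _ _; rewrite mul0r (d00 _ _).2.
rewrite (nu_locally0 _ ball_compact_ball3) // => h h0; exists h => // F _ Fh.
have -> : (0 = ((0 : R) ^+ 3)%:E)%E by rewrite expr0n.
by apply: nu_mesh_small => // x y _ _; rewrite (d00 _ _).2.
Qed.

Lemma fills_eq (f g : V -> T) w : (forall x, sphere2 x -> f x = g x) -> fills f w -> fills g w.
Proof. by move=> fg [fb [? H ?]]; exists fb; split => // x Sx; rewrite H // fg. Qed.

Lemma fills_le (f : V -> T) v w : v <= w -> fills f v -> fills f w.
Proof. by move=> vw [fb [? ? H]]; exists fb; split => //; apply: le_trans H _; rewrite lee_fin. Qed.

End shell.

(** * Thin collars *)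

Section growth.
Context {R : realType}.

(* If the bound failed at rho, rho + c sqrt b, ..., then b would quadruple and the step
   double each time, so that the radii stay below s / 2 while b exceeds A + tau. *)
Lemma doubling_radius (a : R -> R) (A tau c s : R) :
  0 < tau -> 0 < c -> (forall r, 0 <= a r <= A) ->
  8 * c * Num.sqrt (A + tau) <= s ->
  exists rho, let b := a rho + tau in let l := c * Num.sqrt b in
    [/\ s / 4 <= rho, rho + l <= s / 2 & a (rho + l) + tau <= 4 * b].
Proof.
move=> tau0 c0 aA cs.
pose b r := a r + tau; pose nxt r := r + c * Num.sqrt (b r).
have b0 r : 0 < b r by rewrite ltr_wpDl //; case/andP: (aA r).
apply: contrapT => H.
(* As the steps double, the distance travelled so far is at most the next step. One more step
   therefore stays within [2 * c * sqrt (A + tau) <= s / 4] of the start. *)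
pose rho k := iter k nxt (s / 4).
have main k : [/\ s / 4 <= rho k, rho k <= s / 4 + c * Num.sqrt (b (rho k)) &
    4 ^+ k * tau <= b (rho k)].
  elim: k => [|k [k1 k2 k3]].
    rewrite /rho /=; split; first exact: lexx.
      by rewrite lerDl mulr_ge0 ?sqrtr_ge0 // ltW.
    by rewrite expr0 mul1r /b lerDr; case/andP: (aA (s / 4)).
  have rS : rho k.+1 = nxt (rho k) by [].
  have sq0 : 0 <= c * Num.sqrt (b (rho k)) by rewrite mulr_ge0 ?sqrtr_ge0 // ltW.
  have big : 4 * b (rho k) <= b (rho k.+1).
    rewrite leNgt; apply/negP => lt4; apply: H; exists (rho k); split => //=; last first.
      by apply: ltW; rewrite -/(b _); move: lt4; rewrite rS.
    have : Num.sqrt (b (rho k)) <= Num.sqrt (A + tau).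
      by apply: ler_wsqrtr; rewrite lerD2r; case/andP: (aA (rho k)).
    rewrite -/(b _) => sqA.
    have : c * Num.sqrt (b (rho k)) <= c * Num.sqrt (A + tau) by rewrite ler_pM2l.
    lra.
  have sq2 : 2 * Num.sqrt (b (rho k)) <= Num.sqrt (b (rho k.+1)).
    have -> : 2 * Num.sqrt (b (rho k)) = Num.sqrt (4 * b (rho k)).
      rewrite sqrtrM //; congr (_ * _).
      have -> : (4 : R) = 2 ^+ 2 by rewrite expr2; lra.
      by rewrite sqrtr_sqr ger0_norm.
    exact: ler_wsqrtr.
  split; rewrite ?rS.
  - by rewrite /nxt; lra.
  - rewrite -rS; have : c * (2 * Num.sqrt (b (rho k))) <= c * Num.sqrt (b (rho k.+1)).
      by rewrite ler_pM2l.
    by rewrite rS /nxt; lra.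
  - by rewrite -rS exprS; lra.
have [k kA] : exists k : nat, (A + tau) / tau < 4 ^+ k.
  exists (Num.bound ((A + tau) / tau)).
  apply: lt_le_trans (archi_boundP _) _.
    by rewrite divr_ge0 ?(ltW tau0) // addr_ge0 ?(ltW tau0) //; case/andP: (aA 0) => *; lra.
  elim: (Num.bound _) => [|k IH]; first by rewrite expr0.
  by rewrite exprS -natr1; have : 1 <= (4 : R) ^+ k by [rewrite exprn_ege1 //; lra]; lra.
case: (main k) => _ _; rewrite leNgt => /negP; apply.
apply: (@le_lt_trans _ _ (A + tau)).
  by rewrite lerD2r; case/andP: (aA (rho k)).
by rewrite -ltr_pdivrMr.
Qed.

(** Counted from the first window that is hit, the others lie within [delta / eta] further windows,
    up to rounding at both ends. *)
Lemma count_windows (U : nat -> set R) (rho eta delta : R) (N : nat) (Q : pred nat) :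
  0 < eta -> 0 <= delta ->
  (forall k, Q k -> exists2 x, U k x & rho + k%:R * eta <= x < rho + k.+1%:R * eta) ->
  (forall j k x y, U j x -> U k y -> `|x - y| <= delta) ->
  (count Q (iota 0 N))%:R <= delta / eta + 2.
Proof.
move=> eta0 delta0 QU Ud.
have de0 : 0 <= delta / eta by rewrite divr_ge0 // ltW.
have [/hasP[k0 _ Qk0]|/hasPn noQ] := boolP (has Q (iota 0 N)); last first.
  rewrite (_ : count Q (iota 0 N) = 0%N); first by rewrite addr_ge0.
  apply/eqP; rewrite -leqn0 leqNgt -has_count; apply/hasPn => x /noQ //.
have /ex_minnP[k1 Qk1 k1min] : exists k, Q k by exists k0.
have /andP[t1 t2] := Num.Theory.truncn_itv de0.
set w := Num.trunc (delta / eta) in t1 t2 *.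
apply: (@le_trans _ _ (w.+2)%:R); last first.
  by rewrite -addn2 natrD lerD2r.
rewrite ler_nat -size_filter -(size_iota k1 w.+2); apply: uniq_leq_size.
  by rewrite filter_uniq // iota_uniq.
move=> k; rewrite mem_filter !mem_iota => /andP[Qk _]; rewrite (k1min _ Qk) /=.
have [x Ux /andP[x1 x2]] := QU _ Qk1; have [y Uy /andP[y1 y2]] := QU _ Qk.
have := Ud _ _ _ _ Ux Uy; rewrite ler_norml => /andP[xy _].
have : k%:R * eta < (k1 + w.+2)%:R * eta.
  rewrite natrD -addn2 natrD -[k1.+1%:R]natr1 in x2 *.
  have : delta < (w%:R + 1) * eta.
    by rewrite -ltr_pdivrMr // natr1.
  nra.
by rewrite ltr_pM2r // ltr_nat.
Qed.

End growth.

Section chains.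
Context {R : realType} {T : Type} (d : T -> T -> R) {n : nat}.
Hypothesis md : is_metric d.
Local Notation V := 'rV[R]_n.

(** Chains replace connected components: points of [W] closer than [kap] lie in one component, which
    gives local constancy with an explicit scale. *)
Inductive chain (W : set V) (kap : R) : V -> V -> Prop :=
| chain_refl y : chain W kap y y
| chain_cons y y' z : W y' -> edist y y' < kap -> chain W kap y' z -> chain W kap y z.

(** Neighbours in [W] reach the same set of points, and [xget] depends on that set alone. The
    default 0 is harmless since chains are reflexive. *)
Definition chain_repr (W : set V) (kap : R) (y : V) : V :=
  xget 0 [set z | chain W kap y z].

Lemma chain_repr_chain W kap y : chain W kap y (chain_repr W kap y).
Proof.
rewrite /chain_repr; case: xgetP => [z -> //|H].
by exfalso; apply: (H y); exact: chain_refl.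
Qed.

Lemma chain_repr_eq (W : set V) kap y y' : W y -> W y' -> edist y y' < kap ->
  chain_repr W kap y = chain_repr W kap y'.
Proof.
move=> Wy Wy' yy'; congr xget; apply/seteqP; split => z /= H.
  by apply: chain_cons H => //; rewrite edistC.
exact: chain_cons H.
Qed.

(** A chain runs through successively overlapping sets [O m]. Removing loops from the path of
    indices lets each set count once, so the bound does not depend on the length of the chain. *)
Lemma chain_dist (f : V -> T) (W : set V) (kap : R) (N : nat) (O : 'I_N -> set V)
    (w : 'I_N -> R) :
  (forall m, 0 <= w m) -> (forall m, image_diam_le d f (O m) (w m)) ->
  0 < kap ->
  (forall y y', W y -> W y' -> edist y y' < kap -> exists m, O m y /\ O m y') ->
  forall y z, W y -> chain W kap y z ->
    d (f y) (f z) <= \sum_(m | `[< exists2 x, O m x & W x >]) w m.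
Proof.
case: (md) => d0 d00 dC dtri w0 Ow kap0 leb y z Wy.
pose M m := `[< exists2 x, O m x & W x >].
pose e : rel 'I_N := [rel m m' | M m && M m' && `[< exists x, O m x /\ O m' x >]].
move=> yz.
have reach m0 : O m0 y -> exists2 m, connect e m0 m & O m z.
  elim: yz Wy m0 => [x Wx m0 Om0|x x' {}z Wx' xx' _ IH Wx m0 Om0]; first by exists m0.
  have [m' [Omx Omx']] := leb _ _ Wx Wx' xx'.
  have [m m'm Omz] := IH Wx' m' Omx'.
  exists m => //; apply: connect_trans m'm; apply: connect1.
  by rewrite /e /=; apply/andP; split; [apply/andP; split|]; apply/asboolP; exists x.
have [m0 [Om0 _]] : exists m, O m y /\ O m y by apply: leb => //; rewrite edistxx.
have [m /connectP[p0 /shortenP[p pp up _] ->] {m}Omz] := reach _ Om0.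
have Mp : {subset m0 :: p <= M}.
  have M0 : M m0 by apply/asboolP; exists y.
  elim: p m0 pp M0 {up Omz Om0} => [|m p IH] m0 /=.
    by move=> _ M0 x; rewrite inE => /eqP ->.
  move=> /andP[/andP[/andP[_ Mm] _] pp] M0 x; rewrite inE => /predU1P[->//|].
  exact: IH.
apply: (@le_trans _ _ (\sum_(m <- m0 :: p) w m)).
  elim: p m0 y pp Om0 Omz {up Mp Wy yz reach} => [|m p IH] m0 y /=.
    by move=> _ Oy Oz; rewrite big_seq1; exact: Ow.
  move=> /andP[/andP[_ /asboolP[x [Ox Ox']]] pp] Oy Oz.
  rewrite big_cons; apply: le_trans (dtri _ (f x) _) _; apply: lerD.
    exact: Ow Oy Ox.
  exact: IH pp Ox' Oz.
rewrite big_uniq //= big_mkcond [leRHS]big_mkcond; apply: ler_sum => m _.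
case: (boolP (m \in m0 :: p)) => [/Mp|_]; last by case: ifP.
by rewrite unfold_in => ->.
Qed.

End chains.

Section windows.
Context {R : realType} {T : Type} (d : T -> T -> R) {n : nat}.
Hypothesis md : is_metric d.
Local Notation V := 'rV[R]_n.
Variables (S : set V) (f : V -> T) (L : R) (o : T).
Hypothesis cS : ball_compact S.
Hypothesis fL : forall x y, S x -> S y -> d (f x) (f y) <= L * edist x y.

Let u (y : V) := d o (f y).

Lemma dist_image_lipschitz x y : S x -> S y -> `|u x - u y| <= L * edist x y.
Proof.
case: md => d0 d00 dC dtri Sx Sy; have := fL Sx Sy.
have := dtri o (f x) (f y); have := dtri o (f y) (f x).
rewrite (dC (f y)) /u => ? ? ?; rewrite ler_norml; apply/andP; split; lra.
Qed.

(** The covering sets need not be open. Thickening the m-th one by [beta m] restores a finite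
    subfamily and a Lebesgue number. *)
Lemma lebesgue_number (C : set V) (F : nat -> set V) (beta : nat -> R) :
  ball_compact C -> (forall m, 0 < beta m) -> C `<=` \bigcup_m F m ->
  exists N kap, 0 < kap /\ forall y y', C y -> edist y y' < kap ->
    exists2 m, (m < N)%N & exists z, [/\ F m z, edist z y < beta m & edist z y' < beta m].
Proof.
move=> cC beta0 CF.
have /choice[mu muP] : forall y, exists m, C y -> F m y.
  by move=> y; have [/CF[m _ Fm]|nC] := pselect (C y); [exists m|exists 0%N].
have [x Cx|xs xsC xsP] := cC (fun x => beta (mu x) / 2); first by rewrite divr_gt0.
pose N := (\max_(x <- xs) mu x).+1.
have [kap kap0 kapP] : exists2 kap : R, 0 < kap & forall m, (m < N)%N -> kap <= beta m / 2.
  elim: N => [|N [kap kap0 IH]]; first by exists 1.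
  exists (Num.min kap (beta N / 2)); first by rewrite lt_min kap0 divr_gt0.
  move=> m; rewrite ltnS leq_eqVlt ge_min => /predU1P[->|/IH ->//].
  by rewrite lexx orbT.
exists N, kap; split => // y y' Cy yy'.
have [x xxs xy] := xsP y Cy.
have mN : (mu x < N)%N by rewrite ltnS (big_rem x) //= leq_maxl.
exists (mu x) => //; exists x; split.
- exact: muP (xsC _ xxs).
- by have := beta0 (mu x); lra.
- have := kapP _ mN; have := edist_triangle y x y'; lra.
Qed.

Definition window (r eta : R) : set V := S `&` [set y | r <= u y < r + eta].

Lemma sum_nu_windows (r eta : R) (N : nat) : 0 <= eta ->
  (\sum_(k < N) nu d f 2 (window (r + k%:R * eta) eta) <=
   nu d f 2 (S `&` [set y | (u y < r + N%:R * eta)%R]))%E.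
Proof.
move=> eta0; elim: N => [|N IH]; first by rewrite big_ord0 nu_ge0.
rewrite big_ord_recr /=.
apply: (@le_trans _ _ (nu d f 2 (S `&` [set y | (u y < r + N%:R * eta)%R]) +
    nu d f 2 (window (r + N%:R * eta) eta))%E); first by apply: leeD2r.
set X := S `&` [set y | u y < r + N.+1%:R * eta].
have XL x y : X x -> X y -> u y - u x <= L * edist x y.
  move=> [Sx _] [Sy _]; have := dist_image_lipschitz Sx Sy.
  by rewrite ler_norml => /andP[? _]; lra.
apply: le_trans (@nu_split _ _ d _ f 2 X u L (r + N%:R * eta) isT XL).
have NE : N.+1%:R * eta = N%:R * eta + eta by rewrite -natr1 mulrDl mul1r.
by apply: leeD; apply: le_nu => y [Sy /=]; rewrite /X NE => uy; split => //=;
  [split => //=; lra|case/andP: uy => *; split => //=; lra|case/andP: uy].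
Qed.

(* Coarea inequality by counting: a covering set of image size q meets at most
   2 q / eta + 2 of the windows of width eta, so some window meets covering sets of small
   total size, which bounds the diameter of its kap-chain components. *)
Lemma thin_window (rho l b eta0 : R) : 0 < l -> 0 < b -> 0 < eta0 ->
  (nu d f 2 (S `&` [set y | (u y < rho + l)%R]) <= b%:E)%E ->
  exists r eta Lc w kap,
    [/\ rho <= r /\ r + eta <= rho + l, 0 < eta <= eta0 /\ 0 < kap,
        0 <= Lc /\ (nu d f 2 (window r eta) <= w%:E)%E,
        0 <= w /\ Lc + w / eta <= 20 * b / l &
        forall y z, window r eta y -> chain (window r eta) kap y z -> d (f y) (f z) <= Lc].
Proof.
case: (md) => d0 d00 dC dtri l0 b0 eta00 nub.
pose An := S `&` [set y | rho <= u y < rho + l].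
have L1 : 0 < `|L| + 1 by rewrite ltr_wpDl.
have Anlt : (nu d f 2 An < (2 * b)%:E)%E.
  apply: le_lt_trans (_ : b%:E < _)%E; last by rewrite lte_fin; lra.
  by apply: le_trans nub; apply: le_nu => y [Sy /= /andP[]].
have Ar x y : An x -> An y -> edist x y <= 1 -> d (f x) (f y) <= `|L| + 1.
  move=> [Sx _] [Sy _] xy; apply: le_trans (fL Sx Sy) _.
  have := ler_norm L; have := edist_ge0 x y; have := normr_ge0 L; nra.
have [F [q [FP AnF Sq]]] := nu_cover_exists (ltn0Sn 1) ltr01 L1 Ar Anlt.
have q0 m : 0 < q m by case: (FP m) => _ _ /andP[].
(* Thickening by [beta m] adds at most [q m / 2] to the image on either side, so the sets [O m] have
   image diameter at most [2 * q m]. *)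
pose beta m := q m / (2 * (`|L| + 1)).
have beta0 m : 0 < beta m by rewrite divr_gt0 // mulr_gt0.
pose O m := S `&` [set y | exists2 z, F m z & edist z y < beta m].
have O_diam m : image_diam_le d f (O m) (2 * q m).
  move=> x y [Sx [z Fz zx]] [Sy [t Ft ty]].
  case: (FP m) => _ FA _ Fq; have [Sz _] := FA _ Fz; have [St _] := FA _ Ft.
  have step v w : S v -> S w -> edist v w < beta m -> d (f v) (f w) <= q m / 2.
    move=> Sv Sw vw; apply: le_trans (fL Sv Sw) _.
    move: vw; rewrite /beta ltr_pdivlMr ?mulr_gt0 // => vw.
    have := ler_norm L; have := edist_ge0 v w; nra.
  have h1 := step _ _ Sz Sx zx; have h2 := step _ _ St Sy ty; have h3 := Fq _ _ Fz Ft.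
  have := dtri (f x) (f z) (f y); have := dtri (f z) (f t) (f y).
  by rewrite (dC (f x) (f z)); lra.
(* The windows are laid only in the inner half of the annulus, inside a compact set that the [F m]
   still cover. *)
pose C := S `&` [set y | u y <= rho + l / 2] `&` [set y | - u y <= - rho].
have cC : ball_compact C.
  apply: (@ball_compact_le _ _ _ _ L).
    by apply: (@ball_compact_le _ _ _ _ L) => // x y; exact: dist_image_lipschitz.
  move=> x y [Sx _] [Sy _]; rewrite -opprD normrN; exact: dist_image_lipschitz.
have CAn : C `<=` An.
  by move=> y [[Sy /= y1] /= y2]; split => //=; apply/andP; split; lra.
have [N [kap [kap0 leb]]] := lebesgue_number cC beta0 (subset_trans CAn AnF).
pose Rs := \sum_(m < N) q m.
have Rs0 : 0 <= Rs by apply: sumr_ge0 => m _; exact: ltW.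
have Sq2 : \sum_(m < N) q m ^+ 2 <= 2 * b.
  rewrite -lee_fin -sumEFin; apply: le_trans Sq.
  rewrite -(big_mkord xpredT (fun m => (q m ^+ 2)%:E)).
  by apply: nneseries_lim_ge => m _ _; rewrite lee_fin sqr_ge0.
(* So small a width makes the rounding term [4 * Rs] of the count at most [b / eta]. *)
pose e1 := Num.min eta0 (b / (4 * Rs + 1)).
have e10 : 0 < e1 by rewrite lt_min eta00 divr_gt0 // ltr_wpDl // mulr_ge0.
pose M := (Num.bound (l / (2 * e1))).+1.
have M0 : 0 < M%:R :> R by rewrite ltr0n.
pose eta := l / 2 / M%:R.
have etap : 0 < eta by rewrite !divr_gt0.
have Meta : M%:R * eta = l / 2 by rewrite /eta mulrC divfK // gt_eqF.
have eta1 : eta <= e1.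
  rewrite /eta ler_pdivrMr // -ler_pdivrMl //.
  have -> : e1^-1 * (l / 2) = l / (2 * e1) by field; rewrite gt_eqF.
  apply: ltW; apply: lt_trans (archi_boundP _) _; last by rewrite ltr_nat.
  by rewrite divr_ge0 ?mulr_ge0 // ltW.
have eta_Rs : 4 * Rs <= b / eta.
  have : eta <= b / (4 * Rs + 1) by rewrite (le_trans eta1) // ge_min lexx orbT.
  rewrite ler_pdivlMr ?ltr_wpDl ?mulr_ge0 // ler_pdivlMr //; nra.
pose W (k : nat) := window (rho + k%:R * eta) eta.
have WC k : (k < M)%N -> W k `<=` C.
  move=> kM y [Sy /= /andP[y1 y2]].
  have k0 : 0 <= k%:R * eta by rewrite mulr_ge0 // ltW.
  have k1 : k.+1%:R * eta <= M%:R * eta by rewrite ler_wpM2r ?(ltW etap) // ler_nat.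
  rewrite -[k.+1%:R]natr1 mulrDl mul1r Meta in k1.
  by split => /=; [split => //=|]; lra.
pose hit k m := `[< exists2 x, O m x & W k x >].
pose Lc k := \sum_(m < N | hit k m) (2 * q m).
(* Of the factor 9, the squares [q m ^+ 2], of total at most [2 * b], contribute 8, and the rounding
   contributes 1. *)
have sumLc : \sum_(k < M) Lc k <= 9 * b / eta.
  rewrite /Lc (exchange_big_dep xpredT) //=.
  apply: (@le_trans _ _ (\sum_(m < N) (2 * q m) * (2 * q m / eta + 2))).
    apply: ler_sum => m _; rewrite sumr_const -[leLHS]mulr_natl mulrC.
    apply: ler_wpM2l; first by rewrite mulr_ge0 // ltW.
    rewrite (_ : #|_| = count (fun k => hit k m) (iota 0 M)); last first.
      have -> : iota 0 M = index_iota 0 M by rewrite /index_iota subn0.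
      by rewrite -sum1_card -sum1_count big_mkord.
    apply: (@count_windows _ (fun k => u @` (O m `&` W k)) rho) => //.
    - by rewrite mulr_ge0 // ltW.
    - move=> k /asboolP[x Ox Wx]; exists (u x); first by exists x.
      by case: Wx => _ /=; rewrite -[k.+1%:R]natr1 mulrDl mul1r addrA.
    - move=> j k _ _ [x [Ox _] <-] [y [Oy _] <-].
      apply: le_trans (O_diam m _ _ Ox Oy).
      have := dtri o (f x) (f y); have := dtri o (f y) (f x).
      rewrite (dC (f y)) /u => ? ?; rewrite ler_norml; apply/andP; split; lra.
  have -> : \sum_(m < N) 2 * q m * (2 * q m / eta + 2) =
      4 / eta * (\sum_(m < N) q m ^+ 2) + 4 * Rs.
    rewrite /Rs !mulr_sumr -big_split /=; apply: eq_bigr => m _; ring.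
  have : 4 / eta * (\sum_(m < N) q m ^+ 2) <= 4 / eta * (2 * b).
    by rewrite ler_wpM2l // divr_ge0 // ltW.
  have -> : 4 / eta * (2 * b) = 8 * (b / eta) by ring.
  have -> : 9 * b / eta = 9 * (b / eta) by ring.
  lra.
have nuWfin k : nu d f 2 (W k) \is a fin_num \/ (M <= k)%N.
  have [kM|] := ltnP k M; [left|by right].
  rewrite ge0_fin_numE ?nu_ge0 //.
  apply: le_lt_trans (le_nu _ _ _ (subset_trans (WC _ kM) CAn)) _.
  by apply: lt_trans Anlt _; exact: ltry.
pose w k := fine (nu d f 2 (W k)).
have w0 k : 0 <= w k by exact: fine_ge0 (nu_ge0 _ _ _ _).
have wE k : (k < M)%N -> nu d f 2 (W k) = (w k)%:E.
  by move=> kM; case: (nuWfin k) => [/fineK ->//|]; rewrite leqNgt kM.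
have sumw : \sum_(k < M) w k <= b.
  rewrite -lee_fin -sumEFin; under eq_bigr => k _ do rewrite -wE //.
  apply: le_trans (sum_nu_windows _ _ (ltW etap)) _; apply: le_trans nub.
  by apply: le_nu => y [Sy /= uy]; split => //=; move: uy; rewrite Meta; lra.
(* Diameters sum to [9 * b / eta] and densities to [b / eta]; since [M * eta = l / 2], the average
   over [M] windows is [20 * b / l]. *)
have [k kM kP] : exists2 k, (k < M)%N & Lc k + w k / eta <= 20 * b / l.
  apply: contrapT => H.
  have : \sum_(k < M) (20 * b / l) < \sum_(k < M) (Lc k + w k / eta).
    apply: ltr_sum; first by apply/hasP; exists ord0; rewrite ?mem_index_enum.
    move=> k _; rewrite ltNge; apply/negP => kP; apply: H; exists k => //.
  rewrite sumr_const card_ord -[ltLHS]mulr_natl big_split /= -mulr_suml.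
  have -> : M%:R * (20 * b / l) = 10 * (b / eta).
    have -> : b / eta = 2 * b * M%:R / l by rewrite /eta; field; rewrite !gt_eqF.
    ring.
  have : (\sum_(k < M) w k) / eta <= b / eta by rewrite ler_pM2r ?invr_gt0.
  have : 9 * b / eta = 9 * (b / eta) by ring.
  lra.
exists (rho + k%:R * eta), eta, (Lc k), (w k), kap.
have k0 : 0 <= k%:R * eta by rewrite mulr_ge0 // ltW.
have k1 : k.+1%:R * eta <= M%:R * eta by rewrite ler_wpM2r ?(ltW etap) // ler_nat.
rewrite -[k.+1%:R]natr1 mulrDl mul1r Meta in k1.
split.
- by split; lra.
- by split => //; rewrite etap (le_trans eta1) // ge_min lexx.
- split; first by apply: sumr_ge0 => m _; rewrite mulr_ge0 // ltW.
  by rewrite -/(W k) wE.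
- by split.
move=> y z Wy yz.
apply: (@chain_dist _ _ _ _ md f (W k) kap N (fun m => O m) (fun m => 2 * q m)) => //.
- by move=> m; rewrite mulr_ge0 // ltW.
- move=> x x' Wx Wx' xx'.
  have [m mN [t [Ft tx tx']]] := leb _ _ (WC _ kM _ Wx) xx'.
  have [Sx _] := Wx; have [Sx' _] := Wx'.
  by exists (Ordinal mN); split; split => //; exists t.
Qed.

End windows.

(** * Surgery on a ball *)

Section clamp.
Context {R : realType}.
Implicit Types z : R.

Definition clamp z : R := Num.max 0 (Num.min 1 z).

Lemma clamp01 z : 0 <= clamp z <= 1.
Proof.
by rewrite /clamp le_max lexx /= ge_max ler01 /= ge_min lexx.
Qed.

Lemma clamp_lipschitz z z' : `|clamp z - clamp z'| <= `|z - z'|.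
Proof.
rewrite /clamp; case: (leP 1 z) => z1; case: (leP 1 z') => z1'; rewrite ?(max_r ler01).
all: try (case: (leP 0 z) => z0); try (case: (leP 0 z') => z0'); rewrite ?subrr ?normr0 //.
all: rewrite !ler_norml; have := ler_norm (z - z'); have := ler_norm (- (z - z')); rewrite normrN => ? ?.
all: apply/andP; split; lra.
Qed.

Lemma clamp0 z : z <= 0 -> clamp z = 0.
Proof. by move=> z0; rewrite /clamp min_r ?max_l // (le_trans z0). Qed.

Lemma clamp1 z : 1 <= z -> clamp z = 1.
Proof. by move=> z1; rewrite /clamp min_l // max_r. Qed.

(** The thirds match those of [ramp], which varies only on [[1/3, 2/3]]: there [tent] is 1, so the
    second move interpolates only over components already squeezed. *)
Definition tent z : R := clamp (Num.min (3 * z) (3 * (1 - z))).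

Lemma tent_lipschitz z z' : `|tent z - tent z'| <= 3 * `|z - z'|.
Proof.
apply: le_trans (clamp_lipschitz _ _) _.
have := ler_norm (z - z'); have := ler_norm (- (z - z')); rewrite normrN => h1 h2.
by rewrite ler_norml; case: (leP (3 * z)) => ?; case: (leP (3 * z')) => ?; apply/andP; split; lra.
Qed.

Lemma tent01 z : 0 <= tent z <= 1. Proof. exact: clamp01. Qed.

Lemma tent0l z : z <= 0 -> tent z = 0.
Proof. by move=> z0; apply: clamp0; rewrite ge_min; apply/orP; left; lra. Qed.

Lemma tent0r z : 1 <= z -> tent z = 0.
Proof. by move=> z1; apply: clamp0; rewrite ge_min; apply/orP; right; lra. Qed.

Lemma tent1 z : 3^-1 <= z <= 2 / 3 -> tent z = 1.
Proof. by move=> /andP[z1 z2]; apply: clamp1; rewrite le_min; apply/andP; split; lra. Qed.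

Definition ramp z : R := clamp (2 - 3 * z).

Lemma ramp01 z : 0 <= ramp z <= 1. Proof. exact: clamp01. Qed.

Lemma ramp_lipschitz z z' : `|ramp z - ramp z'| <= 3 * `|z - z'|.
Proof.
apply: le_trans (clamp_lipschitz _ _) _.
have -> : 2 - 3 * z - (2 - 3 * z') = - (3 * (z - z')) by ring.
by rewrite normrN normrM ger0_norm.
Qed.

Lemma ramp1 z : z <= 3^-1 -> ramp z = 1.
Proof. by move=> z0; apply: clamp1; lra. Qed.

Lemma ramp0 z : 2 / 3 <= z -> ramp z = 0.
Proof. by move=> z1; apply: clamp0; lra. Qed.

End clamp.

Section surgery.
Context {R : realType} {T : pointedType} (d : T -> T -> R) (G : T -> T -> R -> T).
Hypothesis md : is_metric d.
Hypothesis cG : conical d G.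
Local Notation V := 'rV[R]_3.
Local Notation S := (@sphere2 R).

Lemma nu_const n k (g : 'rV[R]_n -> T) (E K : set 'rV[R]_n) (o : T) : (0 < k)%N ->
  ball_compact K -> E `<=` K -> (forall x, E x -> g x = o) -> nu d g k E = 0%E.
Proof.
case: md => d0 d00 _ _ k0 cK EK go.
rewrite (eq_nu _ (g := fun=> o)) //; apply: (nu_locally0 _ cK) => // h h0; exists h => // F _ Fh.
have -> : (0 = ((0 : R) ^+ k)%:E)%E by rewrite expr0n; case: k k0.
by apply: nu_mesh_small => // x y _ _; rewrite (d00 _ _).2.
Qed.

Section collar.
Variables (f : V -> T) (L : R) (o : T) (A r eta s Lc w kap a : R).
Hypothesis fL : forall x y, S x -> S y -> d (f x) (f y) <= L * edist x y.
Hypothesis fA : (nu d f 2 S <= A%:E)%E.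
Hypothesis eta0 : 0 < eta.
Hypothesis kap0 : 0 < kap.
Hypothesis Lc0 : 0 <= Lc.
Hypothesis w0 : 0 <= w.
Hypothesis s0 : 0 <= s.
Hypothesis rLs : r + eta + Lc <= s.

Let u y := d o (f y).
Let U : set V := S `&` [set y | u y < r].
Let W : set V := window d S f o r eta.
Let theta y := (u y - r) / eta.
Let P y := f (chain_repr W kap y).
Let lamA y := tent (theta y).
Let chi y := ramp (theta y).
(* First every component of the collar W is squeezed to the point P where theta is in
   [1/3, 2/3]; then all that lies within theta <= 1/3 is contracted to o, and an arc from
   o to P is left over on [1/3, 2/3]. *)
Let gA := move G f P lamA 1.
Definition collar_map : V -> T := move G gA (fun=> o) chi 1.
Local Notation g := collar_map.

Hypothesis fU : (nu d f 2 U <= a%:E)%E.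
Hypothesis fW : (nu d f 2 W <= w%:E)%E.
Hypothesis chainW : forall y z, W y -> chain W kap y z -> d (f y) (f z) <= Lc.

Let i1 : 0 <= (1 : R) <= 1. Proof. by rewrite lexx ler01. Qed.

Let WE y : W y <-> S y /\ 0 <= theta y < 1.
Proof.
rewrite /W /window /theta /=; split => -[Sy /andP[y1 y2]]; split => //; apply/andP; split.
- by rewrite divr_ge0 ?subr_ge0 ?(ltW eta0).
- by rewrite ltr_pdivrMr // mul1r ltrBlDl.
- by move: y1; rewrite pmulr_lge0 ?invr_gt0 // subr_ge0.
- by move: y2; rewrite ltr_pdivrMr // mul1r ltrBlDl.
Qed.

Let UE y : U y <-> S y /\ theta y < 0.
Proof. by rewrite /U /theta /=; split => -[Sy]; rewrite /= pmulr_llt0 ?invr_gt0 // subr_lt0. Qed.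

Let US : U `<=` S. Proof. by move=> y []. Qed.
Let WS : W `<=` S. Proof. by move=> y []. Qed.

Let outside y : S y -> ~ U y -> ~ W y -> 1 <= theta y.
Proof.
move=> Sy nU nW; rewrite leNgt; apply/negP => t1; apply: nW; apply/WE; split => //.
by rewrite t1 andbT leNgt; apply/negP => t0; apply: nU; apply/UE.
Qed.

Let theta_dist x y : `|theta x - theta y| <= d (f x) (f y) / eta.
Proof.
case: md => d0 d00 dC dtri.
have -> : theta x - theta y = (u x - u y) / eta by rewrite /theta; ring.
rewrite normrM normfV (gtr0_norm eta0) ler_pM2r ?invr_gt0 //.
have := dtri o (f x) (f y); have := dtri o (f y) (f x).
by rewrite (dC (f y)) /u => ? ?; rewrite ler_norml; apply/andP; split; lra.
Qed.

Let theta_lip (h : R -> R) x y : (forall z z', `|h z - h z'| <= 3 * `|z - z'|) ->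
  S x -> S y -> `|h (theta x) - h (theta y)| <= 3 * L / eta * edist x y.
Proof.
move=> hL Sx Sy; apply: le_trans (hL _ _) _.
have -> : 3 * L / eta * edist x y = 3 * ((L * edist x y) / eta) by ring.
rewrite ler_pM2l //; apply: le_trans (theta_dist _ _) _.
by rewrite ler_pM2r ?invr_gt0 // fL.
Qed.

Let lamA0 y : S y -> ~ W y -> lamA y = 0.
Proof.
move=> Sy nW; have [t0|t0] := leP (theta y) 0; first exact: tent0l.
have [t1|t1] := leP 1 (theta y); first exact: tent0r.
by exfalso; apply: nW; apply/WE; rewrite t1 ltW.
Qed.

Let lamA01 x : S x -> 0 <= lamA x <= 1. Proof. by move=> _; exact: tent01. Qed.

Let lamAL x y : S x -> S y -> `|lamA x - lamA y| <= 3 * L / eta * edist x y.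
Proof. exact: (theta_lip tent_lipschitz). Qed.

Let PCA x y : S x -> S y -> edist x y < kap -> [\/ P x = P y, lamA x = 0 | lamA y = 0].
Proof.
move=> Sx Sy xy; have [Wx|nW] := pselect (W x); last by constructor 2; exact: lamA0.
have [Wy|nW] := pselect (W y); last by constructor 3; exact: lamA0.
by constructor 1; rewrite /P (chain_repr_eq Wx Wy xy).
Qed.

Let WP x : W x -> d (f x) (P x) <= Lc.
Proof. by move=> Wx; apply: chainW => //; exact: chain_repr_chain. Qed.

Let fDA x : S x -> lamA x != 0 -> d (f x) (P x) <= Lc.
Proof.
move=> Sx lx; apply: WP; apply: contrapT => nW.
by move: lx; rewrite lamA0 // eqxx.
Qed.

Let gAf y : S y -> ~ W y -> gA y = f y.
Proof. by move=> Sy nW; rewrite /gA /move lamA0 // mulr0; case: cG. Qed.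

Let gAL : exists2 LA : R, 0 <= LA & forall x y, S x -> S y -> d (gA x) (gA y) <= LA * edist x y.
Proof.
have [LA LA0 LAP] := move_lipschitz md cG fL lamA01 lamAL kap0 PCA Lc0 fDA.
exists LA => // x y Sx Sy.
by have := LAP 1 1 x y Sx Sy i1 i1; rewrite subrr normr0 addr0.
Qed.

(** Area of the squeezed collar according to [nu_move], with rate [3 / eta] and displacement
    [Lc]. *)
Let cW := 4 * (6 * Lc / eta + 1) * w.

Let nu_gA_W : (nu d gA 2 W <= cW%:E)%E.
Proof.
have e30 : 0 <= 3 / eta by rewrite divr_ge0 // ltW.
apply: le_trans (nu_move md cG fL lamA01 kap0 PCA (ltn0Sn 1) WS e30 Lc0 _ _ fW) _.
- by move=> x Wx _; exact: WP.
- move=> x y Wx Wy; apply: le_trans (tent_lipschitz _ _) _.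
  rewrite -mulrA (mulrC (eta^-1)) ler_pM2l //.
have -> : 2 ^+ 2 * (2 * (3 / eta) * Lc + 1) * w = cW by rewrite /cW; ring.
exact: lexx.
Qed.

Let fills_A v : fills d gA v -> fills d f (v + 16 * Lc * w).
Proof.
have WPl x : W x -> lamA x != 0 -> d (f x) (P x) <= Lc by move=> Wx _; exact: WP.
exact: (fills_move md cG fL lamA01 lamAL kap0 PCA WS Lc0 Lc0 fDA WPl lamA0 fW fA).
Qed.

Let UWo y : U y \/ W y -> d (gA y) o <= s.
Proof.
case: md => d0 d00 dC dtri UW.
have Sy : S y by case: UW => [/US|/WS].
have uy : u y < r + eta.
  by case: UW => [[_ /= uy]|[_ /= /andP[_ //]]]; rewrite (lt_trans uy) // ltrDl.
rewrite dC; apply: le_trans (dtri _ (f y) _) _.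
apply: le_trans rLs; apply: lerD; first exact: ltW.
exact: (move_dist md cG lamA01 Lc0 fDA Sy i1).
Qed.

Let chi0 y : S y -> ~ (U `|` W) y -> chi y = 0.
Proof.
move=> Sy UW; apply: ramp0; apply: (@le_trans _ _ 1).
  by rewrite ler_pdivrMr // mul1r ler_nat.
by apply: outside => // H; apply: UW; [left|right].
Qed.

Let chi01 x : S x -> 0 <= chi x <= 1. Proof. by move=> _; exact: ramp01. Qed.

Let chiL x y : S x -> S y -> `|chi x - chi y| <= 3 * L / eta * edist x y.
Proof. exact: (theta_lip ramp_lipschitz). Qed.

Let PCB (x y : V) : S x -> S y -> edist x y < kap -> [\/ o = o, chi x = 0 | chi y = 0].
Proof. by constructor 1. Qed.

Let fDB x : S x -> chi x != 0 -> d (gA x) o <= s.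
Proof.
move=> Sx cx; apply: UWo; apply: contrapT => nUW.
by move: cx; rewrite chi0 // eqxx.
Qed.

Lemma collar_lipschitz : exists L', forall x y, S x -> S y -> d (g x) (g y) <= L' * edist x y.
Proof.
have [LA LA0 LAP] := gAL.
have [LB LB0 LBP] := move_lipschitz md cG LAP chi01 chiL kap0 PCB s0 fDB.
exists LB => x y Sx Sy.
by have := LBP 1 1 x y Sx Sy i1 i1; rewrite subrr normr0 addr0.
Qed.

Let nu_gA_U : (nu d gA 2 U <= a%:E)%E.
Proof.
apply: le_trans fU; rewrite (eq_nu d (g := f)) => [//|//|y /UE[Sy ty]].
by apply: gAf => // /WE[_ /andP[]]; rewrite leNgt ty.
Qed.

Let nu_gA_UW : (nu d gA 2 (U `|` W) <= (a + cW)%:E)%E.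
Proof.
apply: le_trans (nu_setU d gA U W (ltn0Sn 1)) _; rewrite EFinD.
exact: leeD nu_gA_U nu_gA_W.
Qed.

Let nu_gA_S : (nu d gA 2 S <= (a + cW + A)%:E)%E.
Proof.
have cov : S `<=` (U `|` W) `|` (S `\` (U `|` W)).
  by move=> y Sy; have [UW|UW] := pselect ((U `|` W) y); [left|right].
apply: le_trans (le_nu d gA 2 cov) _.
apply: le_trans (nu_setU d gA _ _ (ltn0Sn 1)) _.
rewrite EFinD; apply: leeD nu_gA_UW _.
rewrite (eq_nu d (g := f)) => [|//|y [Sy UW]]; last first.
  by apply: gAf => // Wy; apply: UW; right.
by apply: le_trans fA; apply: le_nu => y [].
Qed.

(** The filling of [g] is extended outwards through two shells: the contraction displaces area
    [a + cW] by at most [s], the squeeze displaces area [w] by at most [Lc]. *)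
Lemma collar_fills v : fills d g v -> fills d f (v + 16 * s * (a + cW) + 16 * Lc * w).
Proof.
move=> gv; apply: fills_A; move: gv.
have [LA LA0 LAP] := gAL.
have UWS : U `|` W `<=` S by move=> y [/US|/WS].
have UWl x : (U `|` W) x -> chi x != 0 -> d (gA x) o <= s by move=> UW _; exact: UWo.
exact: (fills_move md cG LAP chi01 chiL kap0 PCB UWS s0 s0 fDB UWl chi0 nu_gA_UW nu_gA_S).
Qed.

Lemma collar_out y : S y -> ~ U y -> ~ W y -> g y = f y.
Proof.
move=> Sy nU nW; rewrite /collar_map /move chi0 //; last by case.
by rewrite mulr0 -gAf //; case: cG.
Qed.

Lemma collar_in y : U y \/ W y -> d o (g y) <= 2 * s.
Proof.
case: md => d0 d00 dC dtri UW.
have Sy : S y by case: UW => [/US|/WS].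
have h1 := move_dist md cG chi01 s0 fDB Sy i1.
have h2 := UWo UW; rewrite dC in h2.
by apply: le_trans (dtri _ (gA y) _) _; apply: le_trans (lerD h2 h1) _; rewrite mulrDl mul1r.
Qed.

Let g_low y : theta y <= 3^-1 -> g y = o.
Proof. by move=> ty; rewrite /collar_map /move /chi ramp1 // mulr1; case: cG. Qed.

Lemma collar_nu_U : nu d g 2 U = 0%E.
Proof.
apply: (nu_const (K := S) (o := o)) => //; first exact: ball_compact_sphere2.
move=> y /UE[_ ty]; apply: g_low; apply: le_trans (ltW ty) _.
by rewrite invr_ge0.
Qed.

(** Only the part above 2/3 carries area, and there the contraction is inactive. In the middle third
    [gA] is locally constant, so [nu_move_const] applies. *)
Lemma collar_nu_W : (nu d g 2 W <= cW%:E)%E.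
Proof.
have cov : W `<=` (W `&` [set y | theta y <= 3^-1]) `|`
    ((W `&` [set y | 3^-1 <= theta y <= 2 / 3]) `|` (W `&` [set y | 2 / 3 <= theta y])).
  move=> y Wy; have [t1|t1] := leP (theta y) 3^-1; first by left.
  right; have [t2|t2] := leP (theta y) (2 / 3); first by left; split => //=; rewrite t2 ltW.
  by right; split => //=; exact: ltW.
have WSI X : W `&` X `<=` S by move=> y [/WS].
have low : nu d g 2 (W `&` [set y | theta y <= 3^-1]) = 0%E.
  apply: (nu_const (K := S) (o := o)) => //; first exact: ball_compact_sphere2.
  by move=> y [_ ty]; exact: g_low.
have middle : nu d g 2 (W `&` [set y | 3^-1 <= theta y <= 2 / 3]) = 0%E.
  apply: (nu_move_const md cG chi01 kap0 PCB s0 fDB (ltnSn 1) ball_compact_sphere2 (WSI _)).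
  move=> x y [Wx /= tx] [Wy /= ty] xy.
  case: cG => _ G1 _ _.
  by rewrite /gA /move /lamA !tent1 // !mulr1 !G1 /P (chain_repr_eq Wx Wy xy).
have high : (nu d g 2 (W `&` [set y | (2 / 3 <= theta y)%R]) <= cW%:E)%E.
  rewrite (eq_nu d (g := gA)) => [|//|y [_ /= ty]]; last first.
    by rewrite /collar_map /move /chi ramp0 // mulr0; case: cG.
  by apply: le_trans nu_gA_W; apply: le_nu => y [].
apply: le_trans (le_nu d g 2 cov) _.
apply: le_trans (nu_setU d g _ _ (ltn0Sn 1)) _; rewrite low add0e.
by apply: le_trans (nu_setU d g _ _ (ltn0Sn 1)) _; rewrite middle add0e.
Qed.

End collar.

(* 64 * 40 = 80 * 32, where thin_window bounds both the diameter of the pieces and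
   the density of the window by sqrt b / 32. *)
Lemma surgery (f : V -> T) (L : R) (o : T) (A tau s : R) :
  (forall x y, S x -> S y -> d (f x) (f y) <= L * edist x y) ->
  (nu d f 2 S <= A%:E)%E -> 0 < tau -> 8 * (64 * 40) * Num.sqrt (A + tau) <= s ->
  exists (g : V -> T) (a : R) (U W : set V),
    [/\ (exists L', forall x y, S x -> S y -> d (g x) (g y) <= L' * edist x y) /\
          (forall v, fills d g v -> fills d f (v + 40 * s * (a + tau))),
        [/\ U `<=` S, W `<=` S & forall y, S y -> d o (f y) < s / 4 -> U y],
        (forall y, S y -> ~ U y -> ~ W y -> g y = f y) /\
          (forall y, U y \/ W y -> d o (g y) <= 2 * s),
        [/\ (a%:E <= nu d f 2 U)%E, 0 <= a,
            (nu d g 2 U <= 0)%E & (nu d g 2 W <= ((a + tau) / 4)%:E)%E] &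
        forall X, X `<=` S -> (nu d f 2 (X `&` U) + nu d f 2 (X `\` U) <= nu d f 2 X)%E].
Proof.
move=> fL fA tau0 sA.
have cS := @ball_compact_sphere2 R.
pose u y := d o (f y).
pose B r := S `&` [set y | u y < r].
have Bfin r : nu d f 2 (B r) \is a fin_num.
  rewrite ge0_fin_numE ?nu_ge0 //; apply: le_lt_trans (ltry A).
  by apply: le_trans fA; apply: le_nu => y [].
pose a r := fine (nu d f 2 (B r)).
have aE r : nu d f 2 (B r) = (a r)%:E by rewrite /a fineK.
have aA r : 0 <= a r <= A.
  by rewrite fine_ge0 ?nu_ge0 //= -lee_fin -aE; apply: le_trans fA; apply: le_nu => y [].
have c0 : (0 : R) < 64 * 40 by rewrite mulr_gt0 // ltr0n.
have [rho [rho4 rhol rhob]] := doubling_radius tau0 c0 aA sA.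
set b := a rho + tau in rhol rhob; set l := 64 * 40 * Num.sqrt b in rhol rhob.
have b0 : 0 < b by rewrite ltr_wpDl //; case/andP: (aA rho).
have q0 : 0 < Num.sqrt b by rewrite sqrtr_gt0.
set q := Num.sqrt b in q0 l rhol rhob.
have q2 : q * q = b by rewrite -expr2 sqr_sqrtr // ltW.
have l0 : 0 < l by rewrite mulr_gt0.
have b40 : 0 < 4 * b by rewrite mulr_gt0.
have nub : (nu d f 2 (B (rho + l)%R) <= (4 * b)%:E)%E.
  by rewrite aE lee_fin; apply: le_trans rhob; rewrite lerDl ltW.
have [r [eta [Lc [w [kap [[r1 r2] [/andP[eta0 etaq] kap0] [Lc0 Ww] [w0 Lcw] chainL]]]]]] :=
  @thin_window _ _ d _ md S f L o cS fL rho l (4 * b) q l0 b40 q0 nub.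
have Lcw' : Lc + w / eta <= q / 32.
  apply: le_trans Lcw _; rewrite /l -q2.
  by rewrite le_eqVlt; apply/orP; left; apply/eqP; field; rewrite gt_eqF.
have we0 : 0 <= w / eta by rewrite divr_ge0 // ltW.
have LcQ : Lc <= q / 32 by apply: le_trans Lcw'; rewrite lerDl.
have weQ : w / eta <= q / 32 by apply: le_trans Lcw'; rewrite lerDr.
have wE : w = w / eta * eta by rewrite divfK // gt_eqF.
(* The window was required to have width at most [q], the square root of [b], for this: density
   times width bounds the area. *)
have wb : w <= b / 32.
  have -> : b / 32 = q / 32 * q by rewrite -q2; ring.
  by rewrite wE; apply: ler_pM => //; exact: ltW.
have ql : q / 32 <= l / 2 by clear -q0; rewrite /l; lra.
have Lcs : r + eta + Lc <= s by clear -r2 rhol LcQ ql l0 rho4; lra.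
have s0 : 0 <= s by clear -rhol rho4 l0; lra.
(* The product term is at most [24 * b / 1024], the linear one at most [b / 8]. *)
have cWb : 4 * (6 * Lc / eta + 1) * w <= b / 4.
  have -> : 4 * (6 * Lc / eta + 1) * w = 24 * (Lc * (w / eta)) + 4 * w by ring.
  have : Lc * (w / eta) <= q / 32 * (q / 32) by apply: ler_pM.
  have -> : q / 32 * (q / 32) = b / (32 * 32) by rewrite -q2; field.
  clear -wb b0; lra.
have rhor : b <= a r + tau.
  by rewrite lerD2r -lee_fin -!aE; apply: le_nu => y [Sy /= uy]; split => //=; exact: lt_le_trans r1.
have ar0 : 0 <= a r by case/andP: (aA r).
have fU : (nu d f 2 (B r) <= (a r)%:E)%E by rewrite aE.
have [L' gL'] := collar_lipschitz fL eta0 kap0 Lc0 s0 Lcs chainL.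
exists (collar_map f o r eta kap), (a r), (B r), (window d S f o r eta); split.
- split; first by exists L'; exact: gL'.
  move=> v gv; have := collar_fills fL fA eta0 kap0 Lc0 s0 Lcs fU Ww chainL gv.
  apply: fills_le; rewrite -addrA lerD2l.
  set cW := 4 * _ * w in cWb *.
  (* Contraction costs at most [20 * s * (a r + tau)] and squeezing at most [s * (a r + tau) / 2],
     well within the factor 40. *)
  have h1 : s * (a r + cW) <= s * (a r + (a r + tau) / 4).
    by rewrite ler_wpM2l // lerD2l; clear -cWb rhor; lra.
  have h2 : Lc * w <= s * (b / 32).
    apply: ler_pM => //; apply: le_trans LcQ _; apply: le_trans ql _.
    by clear -rhol rho4 l0 s0; lra.
  have h3 : s * b <= s * (a r + tau) by rewrite ler_wpM2l.
  have h4 : 0 <= s * a r by rewrite mulr_ge0.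
  have h5 : 0 <= s * tau by rewrite mulr_ge0 // ltW.
  clear -h1 h2 h3 h4 h5; rewrite -!mulrA; lra.
- split; [by move=> y []|by move=> y []|].
  move=> y Sy uy; split => //=; apply: lt_le_trans uy _; exact: le_trans r1.
- split => y.
    by move=> Sy nU nW; exact: collar_out.
  exact: (collar_in (Lc := Lc)).
- split; [by rewrite aE|exact: ar0|by rewrite collar_nu_U|].
  apply: le_trans (collar_nu_W fL eta0 kap0 Lc0 s0 Lcs Ww chainL) _.
  by rewrite lee_fin; clear -cWb rhor; lra.
- move=> X XS.
  have XL x y : X x -> X y -> u y - u x <= L * edist x y.
    move=> Xx Xy; have := dist_image_lipschitz md o fL (XS _ Xx) (XS _ Xy).
    by rewrite distrC; apply: le_trans; exact: ler_norm.
  apply: le_trans (@nu_split _ _ d _ f 2 X u L r isT XL).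
  apply: leeD; apply: le_nu => y.
    by move=> [Xy [_ ?]].
  move=> [Xy nU]; split => //=; rewrite leNgt; apply/negP => uy; apply: nU; split => //; exact: XS.
Qed.

End surgery.

(** * Rounds of surgeries *)

Section rounds.
Context {R : realType} {T : pointedType} (d : T -> T -> R) (G : T -> T -> R -> T).
Hypothesis md : is_metric d.
Hypothesis cG : conical d G.
Local Notation V := 'rV[R]_3.
Local Notation S := (@sphere2 R).
Variable K : R.
Hypothesis KE : K = 8 * (64 * 40).

Let K0 : 0 < K. Proof. by rewrite KE !mulr_gt0 ?ltr0n. Qed.

(* P collects the points processed so far, m0 bounds their area, m1 the area of the rest.
   The first inequality pays the volume v by the decrease of m0 + m1; the second one shows
   that at most a quarter of the processed area reappears. *)
Lemma surgery_round (f : V -> T) (L A tau s : R) (xs : seq V) :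
  (forall x y, S x -> S y -> d (f x) (f y) <= L * edist x y) ->
  (nu d f 2 S <= A%:E)%E -> 0 <= A -> 0 < tau -> 0 < s ->
  K * Num.sqrt (A + (size xs)%:R * tau) <= s -> (forall x, x \in xs -> S x) ->
  exists (g : V -> T) (P : set V) (m0 m1 v : R),
    [/\ (exists L', forall x y, S x -> S y -> d (g x) (g y) <= L' * edist x y) /\
          (forall w, fills d g w -> fills d f (w + v)),
        P `<=` S /\ (forall x y, x \in xs -> S y -> d (f x) (f y) < s / 4 -> P y),
        (forall y, S y -> ~ P y -> g y = f y) /\
          (forall y, S y -> g y = f y \/ exists2 x, x \in xs & d (f x) (g y) <= 2 * s),
        [/\ (nu d g 2 P <= m0%:E)%E, (nu d f 2 (S `\` P) <= m1%:E)%E, 0 <= m0, 0 <= m1 & 0 <= v] &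
        v + 80 * s * (m0 + m1) <= 80 * s * (A + (size xs)%:R * tau) /\
          4 * m0 + m1 <= A + (size xs)%:R * tau].
Proof.
move=> fL fA A0 tau0 s0.
elim: xs => [|x xs IH] sK xsS.
  exists f, set0, 0, A, 0; split.
  - by split; [exists L|move=> w; rewrite addr0].
  - by split.
  - by split => // y; left.
  - by split => //; [rewrite nu0|rewrite setD0].
  - by rewrite mul0r !addr0 add0r mulr0 add0r; split.
have sqK : K * Num.sqrt (A + (size xs)%:R * tau) <= s.
  apply: le_trans sK; rewrite ler_wpM2l ?(ltW K0) //.
  by rewrite ler_wsqrtr // lerD2l ler_wpM2r ?(ltW tau0) // ler_nat.
have [|g [P [m0 [m1 [v [[[Lg gL] gfill] [PS xsP] [gf grange] [gP fP m00 m10 v0] [I1 I2]]]]]]] := IH sqK.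
  by move=> y yxs; apply: xsS; rewrite inE yxs orbT.
have Sx : S x by apply: xsS; rewrite inE eqxx.
have gPc1 : (nu d g 2 (S `\` P) <= m1%:E)%E.
  by rewrite (eq_nu d (g := f)) // => y [Sy nP]; exact: gf.
have m01 : m0 + m1 <= A + (size xs)%:R * tau.
  rewrite -(ler_pM2l (_ : 0 < 80 * s)); first by apply: le_trans I1; rewrite lerDr.
  by rewrite mulr_gt0 ?ltr0n.
have gS : (nu d g 2 S <= (A + (size xs)%:R * tau)%:E)%E.
  apply: (@le_trans _ _ (m0 + m1)%:E); last by rewrite lee_fin.
  have cov : S `<=` P `|` (S `\` P).
    by move=> y Sy; have [Py|nP] := pselect (P y); [left|right].
  apply: le_trans (le_nu d g 2 cov) _.
  apply: le_trans (nu_setU d g _ _ (ltn0Sn 1)) _.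
  by rewrite EFinD; exact: leeD gP gPc1.
have sizeS : (size (x :: xs))%:R * tau = (size xs)%:R * tau + tau.
  by rewrite /= -natr1 mulrDl mul1r.
have sK' : K * Num.sqrt (A + (size xs)%:R * tau + tau) <= s by rewrite -addrA -sizeS.
(* The ball is centred at the image of [x] under the original [f], not under the current [g], so the
   diameter bound does not accumulate over the surgeries of a round. *)
have [g' [a [U [W [[[L' gL'] gfill'] [US WS xU] [gout gin] [gU a0 g'U g'W] gsplit]]]]] :=
  surgery md cG (f x) gL gS tau0
    (eq_ind K (fun c => c * Num.sqrt (A + (size xs)%:R * tau + tau) <= s) sK' _ KE).
have fin (E : set V) (m : R) : (nu d g 2 E <= m%:E)%E -> nu d g 2 E \is a fin_num.
  by move=> Em; rewrite ge0_fin_numE ?nu_ge0 //; exact: le_lt_trans Em (ltry m).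
have split_real (E : set V) (m : R) : E `<=` S -> (nu d g 2 E <= m%:E)%E ->
    exists e : R, [/\ (nu d g 2 (E `&` U) <= e%:E)%E, 0 <= e, e <= m &
      (nu d g 2 (E `\` U) <= (m - e)%:E)%E].
  move=> ES Em; have Ef : nu d g 2 (E `&` U) \is a fin_num.
    by apply: (fin _ m); apply: le_trans Em; apply: le_nu => y [].
  exists (fine (nu d g 2 (E `&` U))); split.
  - by rewrite fineK.
  - by rewrite fine_ge0 // nu_ge0.
  - by rewrite -lee_fin fineK //; apply: le_trans Em; apply: le_nu => y [].
  - rewrite EFinB fineK // leeBrDr // addeC.
    by apply: le_trans Em; exact: gsplit.
have [gp [gpE gp0 gpm gpc]] := split_real P m0 PS gP.
have [up [upE up0 upm upc]] := split_real (S `\` P) m1 (fun y H => proj1 H) gPc1.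
have agu : a <= gp + up.
  rewrite -lee_fin EFinD; apply: le_trans gU _; apply: le_trans (leeD gpE upE).
  apply: le_trans (nu_setU d g _ _ (ltn0Sn 1)); apply: le_nu => y Uy.
  by have [Py|nP] := pselect (P y); [left|right; split => //; split => //; exact: US].
(* The surgery removes [gp] from the processed area and [up] from the rest, and puts [(a + tau) / 4]
   back into the collar, which counts as processed. *)
exists g', (P `|` (U `|` W)), (m0 - gp + (a + tau) / 4), (m1 - up), (v + 40 * s * (a + tau)).
have at0 : 0 <= a + tau by rewrite addr_ge0 // ltW.
split.
- split; first by exists L'.
  move=> w /gfill'/gfill; apply: fills_le.
  by rewrite addrAC addrA.
- split; first by move=> y [/PS|[/US|/WS]].
  move=> z y; rewrite inE => /predU1P[->|zxs] Sy zy; last by left; exact: xsP zxs Sy zy.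
  have [Py|nP] := pselect (P y); first by left.
  by right; left; apply: xU => //; rewrite gf.
- split => y Sy.
    move=> nP; rewrite gout //; last 2 first.
    + by move=> Uy; apply: nP; right; left.
    + by move=> Wy; apply: nP; right; right.
    by apply: gf => // Py; apply: nP; left.
  have [Uy|nU] := pselect (U y).
    by right; exists x; [rewrite inE eqxx|apply: gin; left].
  have [Wy|nW] := pselect (W y).
    by right; exists x; [rewrite inE eqxx|apply: gin; right].
  rewrite gout //; have [->|[z zxs zy]] := grange y Sy; first by left.
  by right; exists z => //; rewrite inE zxs orbT.
- split.
  + have cov : P `|` (U `|` W) `<=` (P `\` (U `|` W)) `|` (U `|` W).
      by move=> y [Py|UW]; [have [UW|nUW] := pselect ((U `|` W) y); [right|left]|right].
    apply: le_trans (le_nu d g' 2 cov) _.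
    apply: le_trans (nu_setU d g' _ _ (ltn0Sn 1)) _.
    rewrite EFinD; apply: leeD.
      rewrite (eq_nu d (g := g)) => [|//|y [Py nUW]]; last first.
        by apply: gout => [|Uy|Wy]; [exact: PS|apply: nUW; left|apply: nUW; right].
      by apply: le_trans gpc; apply: le_nu => y [Py nUW]; split => // Uy; apply: nUW; left.
    by apply: le_trans (nu_setU d g' _ _ (ltn0Sn 1)) _; rewrite -[leRHS]add0e; exact: leeD.
  + apply: (@le_trans _ _ (nu d g 2 (S `\` P `\` U))).
      rewrite (eq_nu d (g := g)) => [|//|y [Sy nP]]; last first.
        by rewrite gf // => Py; apply: nP; left.
      apply: le_nu => y [Sy nP]; split; last by move=> Uy; apply: nP; right; left.
      by split => // Py; apply: nP; left.
    exact: upc.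
  + by rewrite addr_ge0 ?subr_ge0 // divr_ge0.
  + by rewrite subr_ge0.
  + by rewrite addr_ge0 // !mulr_ge0 // ltW.
rewrite sizeS; have h1 : s * a <= s * (gp + up) by rewrite ler_wpM2l // ltW.
have h2 : 0 <= s * tau by rewrite mulr_ge0 ?(ltW s0) ?(ltW tau0).
have h3 : 0 <= s * (gp + up) by rewrite mulr_ge0 ?(ltW s0) // addr_ge0.
(* In [4 * m0 + m1] the returned quarter weighs [a + tau], which is at most the removed [gp + up]
   plus [tau]. *)
split; last by clear -I2 agu gp0 tau0; lra.
(* The cost and the returned area together add [60 * s * (a + tau)], the removal subtracts
   [80 * s * (gp + up)]; as [a <= gp + up], the increase is at most [80 * s * tau]. *)
have -> : v + 40 * s * (a + tau) + 80 * s * (m0 - gp + (a + tau) / 4 + (m1 - up)) =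
  v + 80 * s * (m0 + m1) + 60 * (s * a) + 60 * (s * tau) - 80 * (s * (gp + up)) by field.
have -> : 80 * s * (A + ((size xs)%:R * tau + tau)) =
  80 * s * (A + (size xs)%:R * tau) + 80 * (s * tau) by ring.
clear -I1 h1 h2 h3; lra.
Qed.

Lemma halving_round (f : V -> T) (L A s D : R) (o : T) :
  (forall x y, S x -> S y -> d (f x) (f y) <= L * edist x y) ->
  (nu d f 2 S <= A%:E)%E -> 0 < A -> 0 < s -> K * Num.sqrt (2 * A) <= s ->
  (forall y, S y -> d o (f y) <= D) ->
  exists g : V -> T,
    [/\ exists L', forall x y, S x -> S y -> d (g x) (g y) <= L' * edist x y,
        (nu d g 2 S <= (A / 2)%:E)%E,
        forall y, S y -> d o (g y) <= D + 2 * s &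
        forall w, fills d g w -> fills d f (w + 160 * s * A)].
Proof.
move=> fL fA A0 s0 sK fD; case: (md) => d0 d00 dC dtri.
have L0 : 0 < 4 * (`|L| + 1) by rewrite mulr_gt0 ?ltr_wpDl // ltr0n.
have [_ _|xs xsS xsP] := @ball_compact_sphere2 R (fun=> s / (4 * (`|L| + 1))).
  by rewrite divr_gt0.
(* The margins of one round total at most [A], so the assumption on the square root of [2 * A]
   covers every surgery. *)
pose tau := A / (size xs).+1%:R.
have N0 : 0 < (size xs).+1%:R :> R by rewrite ltr0n.
have tau0 : 0 < tau by rewrite divr_gt0.
have ntau : (size xs)%:R * tau <= A.
  by rewrite /tau mulrA ler_pdivrMr // mulrC ler_pM2l // ler_nat.
have sK' : K * Num.sqrt (A + (size xs)%:R * tau) <= s.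
  apply: le_trans sK; rewrite ler_wpM2l ?(ltW K0) // ler_wsqrtr //.
  by rewrite mulrDl mul1r lerD2l.
have [g [P [m0 [m1 [v [[[Lg gL] gfill] [PS xsPP] [gf grange] [gP fP m00 m10 v0] [I1 I2]]]]]]] :=
  surgery_round fL fA (ltW A0) tau0 s0 sK' xsS.
have PE : S `<=` P.
  move=> y Sy; have [x xxs xy] := xsP y Sy; apply: (xsPP x) => //.
  apply: le_lt_trans (fL _ _ (xsS _ xxs) Sy) _.
  apply: (@le_lt_trans _ _ ((`|L| + 1) * edist x y)).
    by rewrite ler_wpM2r ?edist_ge0 // (le_trans (ler_norm L)) // lerDl.
  move: xy; rewrite ltr_pdivlMr // => xy; rewrite ltr_pdivlMr ?ltr0n //.
  by apply: le_lt_trans xy; rewrite le_eqVlt; apply/orP; left; apply/eqP; ring.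
exists g; split; first by exists Lg.
(* The whole sphere has been processed, so [m0] bounds its area, and [4 * m0 <= 2 * A]. *)
- apply: le_trans (le_nu d g 2 PE) _; apply: le_trans gP _; rewrite lee_fin.
  by clear -I2 m10 ntau; lra.
- move=> y Sy; have [->|[x xxs xy]] := grange y Sy.
    by apply: le_trans (fD _ Sy) _; rewrite lerDl mulr_ge0 ?ler0n ?(ltW s0).
  by apply: le_trans (dtri _ (f x) _) _; apply: lerD => //; exact: fD (xsS _ xxs).
- move=> w /gfill; apply: fills_le; rewrite lerD2l.
  have h1 : 80 * s * (A + (size xs)%:R * tau) <= 80 * s * (A + A).
    by rewrite ler_wpM2l ?lerD2l // mulr_ge0 ?ler0n ?(ltW s0).
  have h2 : 0 <= 80 * s * (m0 + m1) by rewrite mulr_ge0 ?addr_ge0 // mulr_ge0 ?ler0n ?(ltW s0).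
  have -> : 160 * s * A = 80 * s * (A + A) by ring.
  by clear -h1 h2 I1; lra.
Qed.

Lemma halving_rounds k (f : V -> T) (L A s D : R) (o : T) :
  (forall x y, S x -> S y -> d (f x) (f y) <= L * edist x y) ->
  (nu d f 2 S <= A%:E)%E -> 0 < A -> 0 < s -> K * Num.sqrt (2 * A) <= s ->
  (forall y, S y -> d o (f y) <= D) ->
  exists g : V -> T,
    [/\ exists L', forall x y, S x -> S y -> d (g x) (g y) <= L' * edist x y,
        (nu d g 2 S <= (A / 2 ^+ k)%:E)%E,
        forall y, S y -> d o (g y) <= D + k%:R * (2 * s) &
        forall w, fills d g w -> fills d f (w + 320 * s * A)].
Proof.
move=> fL fA A0 s0 sK fD.
(* The induction carries the exact partial sum of the series that starts with [160 * s * A] and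
   halves in each round. *)
suff [g [gL gA gD gfill]] : exists g : V -> T,
    [/\ exists L', forall x y, S x -> S y -> d (g x) (g y) <= L' * edist x y,
        (nu d g 2 S <= (A / 2 ^+ k)%:E)%E,
        forall y, S y -> d o (g y) <= D + k%:R * (2 * s) &
        forall w, fills d g w -> fills d f (w + 320 * s * A * (1 - (2 ^+ k)^-1))].
  exists g; split => // w /gfill; apply: fills_le; rewrite lerD2l.
  have c0 : 0 <= 320 * s * A by rewrite !mulr_ge0 ?ler0n ?(ltW s0) ?(ltW A0).
  by apply: (ler_piMr c0); rewrite gerBl invr_ge0 exprn_ge0 ?ler0n.
elim: k f L A D fL fA A0 sK fD => [|k IH] f L A D fL fA A0 sK fD.
  exists f; split; first by exists L.
  - by rewrite expr0 divr1.
  - by move=> y Sy; rewrite mul0r addr0 fD.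
  - by move=> w; rewrite expr0 invr1 subrr mulr0 addr0.
have [g [[Lg gL] gA gD gfill]] := halving_round fL fA A0 s0 sK fD.
have A20 : 0 < A / 2 by rewrite divr_gt0.
have sK2 : K * Num.sqrt (2 * (A / 2)) <= s.
  apply: le_trans sK; rewrite ler_wpM2l ?(ltW K0) // ler_wsqrtr //.
  by rewrite mulrC divfK ?pnatr_eq0 // mulr_natl mulr2n lerDl ltW.
have [h [hL hA hD hfill]] := IH g Lg (A / 2) (D + 2 * s) gL gA A20 sK2 gD.
exists h; split => //.
- by move: hA; rewrite exprS invfM mulrA.
- move=> y Sy; apply: le_trans (hD y Sy) _.
  by rewrite -addrA lerD2l -[k.+1%:R]natr1 [leRHS]mulrDl mul1r addrC.
- move=> w /hfill/gfill; apply: fills_le.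
  rewrite exprS le_eqVlt; apply/orP; left; apply/eqP; field.
  by rewrite expf_neq0.
Qed.

(** A cone is the move with [lam = 1] towards [o]; its end map is constant and is filled with volume
    0. *)
Lemma cone_fills (f : V -> T) (L b D : R) (o : T) :
  (forall x y, S x -> S y -> d (f x) (f y) <= L * edist x y) ->
  (nu d f 2 S <= b%:E)%E -> 0 <= D -> (forall y, S y -> d (f y) o <= D) ->
  fills d f (16 * D * b).
Proof.
move=> fL fb D0 fD; rewrite -[16 * D * b]add0r.
have l01 x : S x -> 0 <= (1 : R) <= 1 by rewrite lexx ler01.
have lL (x y : V) : S x -> S y -> `|(1 : R) - 1| <= 0 * edist x y by rewrite subrr normr0 mul0r.
have PC (x y : V) : S x -> S y -> edist x y < 1 -> [\/ o = o, (1 : R) = 0 | (1 : R) = 0].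
  by constructor 1.
have fDl x : S x -> (1 : R) != 0 -> d (f x) o <= D by move=> Sx _; exact: fD.
apply: (fills_move md cG fL l01 lL ltr01 PC (fun x => id) D0 D0 fDl fDl
  (fun x Sx nS => False_ind _ (nS Sx)) fb fb).
apply: fills_eq (fills_const md o) => x _.
by rewrite /move mulr1; case: cG.
Qed.

(** Serves the case of infinite area, in which the volume bound is void. *)
Lemma cone_extension (f : V -> T) (L : R) (o : T) :
  (forall x y, S x -> S y -> d (f x) (f y) <= L * edist x y) ->
  exists fbar : V -> T, lipschitz_map_on d ball3 fbar /\ forall x, S x -> fbar x = f x.
Proof.
move=> fL; case: (md) => d0 d00 dC dtri.
have [D D0 fD] := ball_compact_bounded o md (@ball_compact_sphere2 R) fL.
have l01 x : S x -> 0 <= (1 : R) <= 1 by rewrite lexx ler01.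
have lL (x y : V) : S x -> S y -> `|(1 : R) - 1| <= 0 * edist x y by rewrite subrr normr0 mul0r.
have PC (x y : V) : S x -> S y -> edist x y < 1 -> [\/ o = o, (1 : R) = 0 | (1 : R) = 0].
  by constructor 1.
have fDl x : S x -> (1 : R) != 0 -> d (f x) o <= D by move=> Sx _; rewrite dC fD.
have [||fbar [? ? _]] := extend_move md cG fL l01 lL ltr01 PC (gbar := fun=> o) D0 fDl.
- by exists 0 => x y _ _; rewrite mul0r (d00 _ _).2.
- by move=> x _; rewrite /move mulr1; case: cG.
- by exists fbar.
Qed.

Lemma exp2_dominates (c : R) : exists k : nat, c + 32 * k%:R <= 2 ^+ k.
Proof.
pose j := (Num.bound `|c| + 64)%N.
(* [2 ^+ (2 * j)] is the square of [2 ^+ j >= j + 1], and [j >= 64] lets this square absorb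
   [64 * j]. *)
exists (2 * j)%N.
have cj : c <= j%:R.
  apply: le_trans (ler_norm c) _; apply: ltW; apply: lt_le_trans (archi_boundP _) _ => //.
  by rewrite ler_nat leq_addr.
have j64 : 64 <= j%:R :> R by rewrite ler_nat leq_addl.
have p1 : j%:R + 1 <= (2 : R) ^+ j by rewrite natr1 -natrX ler_nat ltn_expl.
have : (j%:R + 1) * (j%:R + 1) <= (2 : R) ^+ j * 2 ^+ j.
  by apply: ler_pM => //; rewrite addr_ge0 ?ler0n.
rewrite -exprD addnn -mul2n; apply: le_trans.
rewrite natrM; have : 64 * j%:R <= j%:R * j%:R :> R by rewrite ler_wpM2r ?ler0n.
lra.
Qed.

Lemma fills_isoperimetric (f : V -> T) (L A : R) (o : T) :
  (forall x y, S x -> S y -> d (f x) (f y) <= L * edist x y) ->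
  (nu d f 2 S <= A%:E)%E -> 0 <= A ->
  fills d f (321 * K * (Num.sqrt (2 * A) * A)).
Proof.
move=> fL fA; case: (md) => d0 d00 dC dtri.
have [D D0 fD] := ball_compact_bounded o md (@ball_compact_sphere2 R) fL.
(* For [A = 0] the scale [s] would vanish, but then a cone already has volume 0. *)
rewrite le_eqVlt => /predU1P[A0|A0].
  rewrite -A0 !mulr0; have := @cone_fills f L 0 D o fL; rewrite mulr0; apply => //.
    by rewrite A0.
  by move=> y Sy; rewrite dC fD.
pose s := K * Num.sqrt (2 * A).
have s0 : 0 < s by rewrite mulr_gt0 // sqrtr_gt0 mulr_gt0.
(* After [k] rounds the cone has radius [D + 2 * k * s] over area [A / 2 ^+ k] and costs at most
   [s * A], which raises 320 to 321. *)
have [k kP] := exp2_dominates (16 * D / s).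
have [g [[Lg gL] gA gD gfill]] := halving_rounds k fL fA A0 s0 (lexx s) fD.
have gD' y : S y -> d (g y) o <= D + k%:R * (2 * s) by move=> Sy; rewrite dC gD.
have Dk0 : 0 <= D + k%:R * (2 * s) by rewrite addr_ge0 // mulr_ge0 ?ler0n // mulr_ge0 ?ler0n // ltW.
have := gfill _ (cone_fills gL gA Dk0 gD').
apply: fills_le.
have h1 : 16 * (D + k%:R * (2 * s)) * (A / 2 ^+ k) <= s * A.
  have -> : 16 * (D + k%:R * (2 * s)) * (A / 2 ^+ k) =
      (16 * D / s + 32 * k%:R) / 2 ^+ k * (s * A).
    by field; rewrite expf_neq0 //= gt_eqF.
  have sA0 : 0 <= s * A by apply: mulr_ge0; exact: ltW.
  by apply: (ler_piMl sA0); rewrite ler_pdivrMr ?exprn_gt0 ?ltr0n // mul1r.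
have -> : 321 * K * (Num.sqrt (2 * A) * A) = s * A + 320 * s * A by rewrite /s; ring.
by rewrite lerD2r.
Qed.

End rounds.

(** * The isoperimetric inequality for volumes *)

Theorem theoremC (R : realType) (X : pointedType) (d : X -> X -> R) :
  CAT0 d ->
  exists C : R, 0 < C /\
    forall f : 'rV[R]_3 -> X,
      lipschitz_map_on d sphere2 f ->
      exists fbar : 'rV[R]_3 -> X,
        [/\ lipschitz_map_on d ball3 fbar,
            (forall x, sphere2 x -> fbar x = f x) &
            (vol d 3 ball3 fbar <= C%:E * (vol d 2 sphere2 f) `^ (3 / 2))%E].
Proof.
move=> cat0; have md : is_metric d by case: cat0.
have [G cG] := CAT0_conical cat0.
(* The last factor comes from the covering area [2 * a]: [sqrt (2 * (2 * a)) * (2 * a)] equals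
   [4 * (sqrt a * a)]. *)
pose C : R := 321 * (8 * (64 * 40)) * 4.
have C0 : 0 < C by rewrite !mulr_gt0 ?ltr0n.
exists C; split => // f [L fL].
have vol0 : (0 <= vol d 2 sphere2 f)%E.
  by apply: integral_ge0 => y _; exact: multiplicity_ge0.
have [volE|volfin] := eqVneq (vol d 2 sphere2 f) +oo%E.
  have [fbar [? ?]] := cone_extension md cG point fL.
  exists fbar; split => //; rewrite volE poweRyr; last by rewrite gt_eqF // divr_gt0 ?ltr0n.
  by rewrite gt0_muley ?leey // lte_fin.
have vf : vol d 2 sphere2 f \is a fin_num by rewrite ge0_fin_numE // ltey.
pose a := fine (vol d 2 sphere2 f).
have a0 : 0 <= a by exact: fine_ge0.
have aE : vol d 2 sphere2 f = a%:E by rewrite fineK.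
have w2 : (2 : R) ^+ 2 <= 2 * omega_ 2.
  have -> : omega_ 2 = pi :> R by rewrite /=; field.
  by rewrite expr2 ler_pM2l ?ltr0n // pi_ge2.
have nuf : (nu d f 2 sphere2 <= (2 * a)%:E)%E.
  by rewrite EFinM -aE; apply: (nu_le_vol md (ltn0Sn 1) fL ball_compact_sphere2) w2.
have [fbar [fbarL fbarS fbarn]] := fills_isoperimetric md cG erefl point fL nuf (mulr_ge0 (ler0n R 2) a0).
exists fbar; split => //; case: fbarL => L' fbarL.
have w3 : omega_ 3 <= (2 : R) ^+ 3.
  have -> : omega_ 3 = 4 / 3 * pi :> R by rewrite /=; field.
  have := @pihalf_lt2 R; rewrite !exprS expr0; lra.
apply: le_trans (vol_le_nu md (ltn0Sn 2) fbarL ball_compact_ball3 w3) _.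
apply: le_trans fbarn _.
rewrite aE poweR_EFin -EFinM lee_fin.
have -> : a `^ (3 / 2) = Num.sqrt a * a.
  have [->|an0] := eqVneq a 0; first by rewrite mulr0 powR0 // gt_eqF // divr_gt0.
  have -> : 3 / 2 = 2^-1 + 1 :> R by field.
  rewrite powRD; last by rewrite an0 implybT.
  by rewrite powRr1 // powR12_sqrt.
have -> : 2 * (2 * a) = 2 ^+ 2 * a by rewrite expr2; ring.
rewrite sqrtrM ?sqr_ge0 // sqrtr_sqr ger0_norm ?ler0n //.
by rewrite le_eqVlt; apply/orP; left; apply/eqP; rewrite /C; ring.
Qed.
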